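(* The equivalence relations $E_{ck}$ and $\cong_{\mathrm{WO}}$ are infinite time computably bireducible: $E_{ck}\le_c\ \cong_{\mathrm{WO}}$ and $\cong_{\mathrm{WO}}\ \le_c E_{ck}$. (In particular, the map sending $x$ to a code for the supremum of the ordinals having a code Turing computable from $x$ is an infinite time computable reduction of $E_{ck}$ to $\cong_{\mathrm{WO}}$.)
   Context: $\mathbb{R}=2^\omega$. Infinite time Turing machines (ITTMs): three binary $\omega$-tapes, finite program, ordinary Turing steps at successors; at limit stages a special limit state, head at the first cell, each cell the $\limsup$ of earlier values; output read from the output tape upon halting. A function $f$ is infinite time computable if some ITTM program, possibly using a fixed real parameter on an extra oracle tape, computes it. For equivalence relations $E$ on $X\subseteq\mathbb{R}$ and $F$ on $Y\subseteq\mathbb{R}$, $E\le_c F$ means there is an infinite time computable $f:X\to Y$ with $x\,E\,x' \iff f(x)\,F\,f(x')$ for all $x,x'\in X$. A real codes the relation $n\triangleleft m$ iff bit $\langle n,m\rangle$ is $1$; $\mathrm{WO}$ is the set of codes of well-orders of $\omega$, and $\cong_{\mathrm{WO}}$ is the isomorphism relation on $\mathrm{WO}$ (same order type). $x\,E_{ck}\,y$ iff $x$ and $y$ compute (in the ordinary Turing sense) the same ordinals, i.e. an ordinal has a code Turing computable from $x$ iff it has one Turing computable from $y$. *)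

(* Defs.v *)
From Stdlib Require Import Arith List Bool.

Definition real := nat -> bool.

Definition pair (n m : nat) : nat := (n + m) * (n + m + 1) / 2 + m.

Definition rel_of (x : real) (n m : nat) : Prop := x (pair n m) = true.

Definition WO (x : real) : Prop :=
  (forall n, ~ rel_of x n n) /\
  (forall n m k, rel_of x n m -> rel_of x m k -> rel_of x n k) /\
  (forall n m, n = m \/ rel_of x n m \/ rel_of x m n) /\
  well_founded (rel_of x).

Definition cong_WO (x y : real) : Prop :=
  WO x /\ WO y /\
  exists f g : nat -> nat,
    (forall n, g (f n) = n) /\ (forall n, f (g n) = n) /\
    (forall n m, rel_of x n m <-> rel_of y (f n) (f m)).

Inductive move := MoveL | MoveR.

(** One instruction: in state [st], reading (input, scratch, output, oracle)
    bits [r_in r_sc r_out r_or], go to state [nst], write [w_in w_sc w_out]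
    on the three work tapes and move the head. The oracle tape is read only. *)
Record instr := mkInstr {
  st : nat; r_in : bool; r_sc : bool; r_out : bool; r_or : bool;
  nst : nat; w_in : bool; w_sc : bool; w_out : bool; mv : move }.

(** A program is a finite list of instructions; the first applicable one is
    used; the machine halts when no instruction applies. *)
Definition program := list instr.

Record config := mkConfig {
  state : nat; head : nat; tin : real; tsc : real; tout : real }.

Definition start_state : nat := 0.
Definition limit_state : nat := 1.

Definition upd (f : real) (k : nat) (b : bool) : real :=
  fun n => if Nat.eqb n k then b else f n.

Definition lookup (p : program) (a : real) (c : config) : option instr :=
  find (fun i => Nat.eqb (st i) (state c)
                 && Bool.eqb (r_in i) (tin c (head c))
                 && Bool.eqb (r_sc i) (tsc c (head c))
                 && Bool.eqb (r_out i) (tout c (head c))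
                 && Bool.eqb (r_or i) (a (head c))) p.

Definition apply_instr (i : instr) (c : config) : config :=
  mkConfig (nst i)
    (match mv i with MoveL => Nat.pred (head c) | MoveR => S (head c) end)
    (upd (tin c) (head c) (w_in i))
    (upd (tsc c) (head c) (w_sc i))
    (upd (tout c) (head c) (w_out i)).

(** One step with oracle (parameter) tape [a]; [None] = halted. *)
Definition step (p : program) (a : real) (c : config) : option config :=
  option_map (fun i => apply_instr i c) (lookup p a c).

Definition init_config (x : real) : config :=
  mkConfig start_state 0 x (fun _ => false) (fun _ => false).

Definition config_eq (c d : config) : Prop :=
  state c = state d /\ head c = head d /\
  (forall n, tin c n = tin d n) /\ (forall n, tsc c n = tsc d n) /\
  (forall n, tout c n = tout d n).

Definition is_succ {T : Type} (lt : T -> T -> Prop) (s t : T) : Prop :=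
  lt s t /\ ~ (exists u, lt s u /\ lt u t).

Definition is_limit {T : Type} (lt : T -> T -> Prop) (t : T) : Prop :=
  (exists s, lt s t) /\ ~ (exists s, is_succ lt s t).

(** P holds cofinally often below t (limsup of a 0/1 sequence is 1). *)
Definition cofinal {T : Type} (lt : T -> T -> Prop) (t : T) (P : T -> Prop) : Prop :=
  forall s, lt s t -> exists u, lt s u /\ lt u t /\ P u.

Definition limit_cond {T : Type} (lt : T -> T -> Prop) (c : T -> config) (t : T) : Prop :=
  state (c t) = limit_state /\ head (c t) = 0 /\
  (forall n, tin (c t) n = true <-> cofinal lt t (fun u => tin (c u) n = true)) /\
  (forall n, tsc (c t) n = true <-> cofinal lt t (fun u => tsc (c u) n = true)) /\
  (forall n, tout (c t) n = true <-> cofinal lt t (fun u => tout (c u) n = true)).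

(** [ittm_halts p a x y]: program p with oracle a on input x halts
    (at some ordinal stage) with output y.  The run is a map from a
    well-ordered type with a largest element (the halting stage). *)
Definition ittm_halts (p : program) (a x y : real) : Prop :=
  exists (T : Type) (lt : T -> T -> Prop) (c : T -> config) (top : T),
    well_founded lt /\
    (forall s t u, lt s t -> lt t u -> lt s u) /\
    (forall s t, s = t \/ lt s t \/ lt t s) /\
    (forall t, t = top \/ lt t top) /\
    (forall t, (forall s, ~ lt s t) -> config_eq (c t) (init_config x)) /\
    (forall s t, is_succ lt s t ->
        exists d, step p a (c s) = Some d /\ config_eq (c t) d) /\
    (forall t, is_limit lt t -> limit_cond lt c t) /\
    step p a (c top) = None /\
    (forall n, tout (c top) n = y n).

Definition ittm_computable (X : real -> Prop) (f : real -> real) : Prop :=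
  exists (p : program) (a : real), forall x, X x -> ittm_halts p a x (f x).

Definition c_reducible (X : real -> Prop) (E : real -> real -> Prop)
    (Y : real -> Prop) (F : real -> real -> Prop) : Prop :=
  exists f : real -> real,
    ittm_computable X f /\ (forall x, X x -> Y (f x)) /\
    (forall x x', X x -> X x' -> (E x x' <-> F (f x) (f x'))).

Fixpoint run (p : program) (a : real) (c : config) (k : nat) : option config :=
  match k with
  | 0 => Some c
  | S k' => match run p a c k' with Some d => step p a d | None => None end
  end.

Definition unary (n : nat) : real := fun i => Nat.ltb i n.

Definition turing_computable_from (z x : real) : Prop :=
  exists p : program, forall n, exists k d,
    run p x (init_config (unary n)) k = Some d /\ step p x d = None /\
    tout d 0 = z n.

Definition ck_ordinal (x w : real) : Prop :=
  exists z, turing_computable_from z x /\ WO z /\ cong_WO z w.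

Definition E_ck (x y : real) : Prop :=
  forall w, WO w -> (ck_ordinal x w <-> ck_ordinal y w).

Definition all_reals : real -> Prop := fun _ => True.

Definition codes_sup_ck (x v : real) : Prop :=
  WO v /\
  (forall z, turing_computable_from z x -> WO z ->
      exists g : nat -> nat, forall i j, rel_of z i j -> rel_of v (g i) (g j)) /\
  (forall m, exists z, turing_computable_from z x /\ WO z /\
      exists g : nat -> nat, forall i j,
        rel_of v i m -> rel_of v j m -> rel_of v i j -> rel_of z (g i) (g j)).

(* Main.v *)
(** An ITTM with a real parameter can iterate, along the countable ordinals and with limsup
    at limits, any operator on reals each of whose output bits is an open condition: the
    parameter lists the conditions, and each round takes [omega] steps to evaluate them and
    [omega] steps to copy the result.  The functions obtained in this way are closed under
    composition and transfinite loops, and a loop removing minimal elements decides the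
    well-founded part of a relation and compares ranks.  Hence the supremum of the well-orders
    computable from [x] is computed from [x]; as the set of ordinals computable from [x] is
    closed under successors and infinite initial segments, this supremum determines it.

    For the other direction, let [g b] be the least supremum attained by a copy of the
    well-order [b].  Whether some copy of [b] has its supremum at most a given ordinal is a
    question about branches of a tree, so that a copy attaining [g b] is found as a leftmost
    branch.  Iterating [g] transfinitely along [w], taking suprema of the values so far, gives
    a copy whose supremum is a strictly increasing function of the order type of [w]. *)

From Stdlib Require Import Arith List Bool Lia Classical ClassicalEpsilon
  FunctionalExtensionality PropExtensionality Cantor Wellfounded FinFun.
Require Import Defs.
Import ListNotations.

(** Output bits are restricted to open conditions because an output tape that only gains ones
    records in [omega] steps exactly what finite prefixes of the input force; complements and
    quantifiers then come from composition. The main obstacle is that a limsup may mix states of a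
    simulating system. Hence, between two simulated stages, a bit carrying simulated data may show a
    one only if the old or the new value has it; then limsup and encoding commute. A copy of least
    supremum is needed because isomorphic well-orders may compute different ordinals. The search is
    bounded: its candidates are the points of a code of the supremum attained by [b] itself, so [b]
    is the answer if no candidate succeeds. The least supremum alone does not separate order types,
    since all computable ones share it. But the supremum attained by [y] exceeds the order type of
    [y], as [y] computes itself, so iterating over suprema of earlier values strictly increases. All
    stages, ranks and order types live in one type of countable ordinals, in which every sequence is
    bounded, so that it is long enough for every run that occurs. *)

Definition asb (P : Prop) : bool :=
  if excluded_middle_informative P then true else false.

Lemma asbP (P : Prop) : asb P = true <-> P.
Proof. unfold asb; destruct (excluded_middle_informative P); intuition congruence. Qed.

Lemma asbF (P : Prop) : asb P = false <-> ~ P.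
Proof. unfold asb; destruct (excluded_middle_informative P); intuition congruence. Qed.

Lemma asb_ext (P Q : Prop) : (P <-> Q) -> asb P = asb Q.
Proof. intro H; f_equal; now apply propositional_extensionality. Qed.

Lemma bool_ext (a b : bool) : (a = true <-> b = true) -> a = b.
Proof. destruct a, b; intuition congruence. Qed.

Lemma choice_fun {A B : Type} (R : A -> B -> Prop) :
  (forall a, exists b, R a b) -> exists f, forall a, R a (f a).
Proof.
  intro H.
  exists (fun a => proj1_sig (constructive_indefinite_description _ (H a))).
  intro a; apply proj2_sig.
Qed.

Lemma nat_least (P : nat -> Prop) n : P n -> exists k, P k /\ forall j, j < k -> ~ P j.
Proof.
  induction (lt_wf n) as [n _ IH]. intro Hn.
  destruct (classic (exists j, j < n /\ P j)) as [[j [J1 J2]]|H]; [eauto|].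
  exists n; split; [exact Hn|]. intros j J1 J2. apply H; eauto.
Qed.

(** * Countable ordinals *)

(** [BL f] denotes the least ordinal above all [f n], so up to [beq] the trees are exactly the
    countable ordinals. Trees make bounds of sequences immediate: one node bounds them all. *)
Inductive brw := BZ | BL (f : nat -> brw).

Fixpoint ble (a b : brw) {struct a} : Prop :=
  match a with
  | BZ => True
  | BL f => forall n, match b with
                      | BZ => False
                      | BL g => exists m, ble (f n) (g m)
                      end
  end.

Definition blt (a b : brw) : Prop :=
  match b with BZ => False | BL g => exists m, ble a (g m) end.

Lemma ble_BL f b : ble (BL f) b <-> forall n, blt (f n) b.
Proof. destruct b; simpl; intuition. Qed.

Lemma ble_refl a : ble a a.
Proof. induction a as [|f IH]; simpl; [easy|]. intro n; exists n; apply IH. Qed.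

Lemma ble_trans a b c : ble a b -> ble b c -> ble a c.
Proof.
  revert b c; induction a as [|f IH]; intros b c Hab Hbc; [exact I|].
  apply ble_BL; intro n. rewrite ble_BL in Hab. specialize (Hab n).
  destruct b as [|g]; [easy|]. destruct Hab as [m Hm].
  rewrite ble_BL in Hbc. specialize (Hbc m).
  destruct c as [|h]; [easy|]. destruct Hbc as [k Hk].
  exists k; eapply IH; eauto.
Qed.

Lemma blt_ble_trans a b c : blt a b -> ble b c -> blt a c.
Proof.
  destruct b as [|g]; [easy|]; intros [m Hm] H. rewrite ble_BL in H.
  specialize (H m). destruct c as [|h]; [easy|]. destruct H as [k Hk].
  exists k; eapply ble_trans; eauto.
Qed.

Lemma ble_total a b : ble a b \/ blt b a.
Proof.
  revert b; induction a as [|f IH]; intro b; [now left|].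
  destruct (classic (forall n, blt (f n) b)) as [H|H].
  - left; now apply ble_BL.
  - right. apply not_all_ex_not in H as [n Hn]. exists n.
    destruct b as [|g]; [exact I|]. apply ble_BL; intro k.
    destruct (IH n (g k)) as [H|H]; [|easy].
    exfalso; apply Hn; now exists k.
Qed.

Lemma blt_wf : well_founded blt.
Proof.
  assert (H : forall a b, ble b a -> Acc blt b).
  { induction a as [|f IH]; intros b Hb; constructor; intros c Hc;
      pose proof (blt_ble_trans _ _ _ Hc Hb) as Hca.
    - easy.
    - destruct Hca as [n Hn]; eauto. }
  intro a; apply (H a), ble_refl.
Qed.

Definition beq (a b : brw) : Prop := ble a b /\ ble b a.

(** Choosing a representative of each class turns [beq] into Leibniz equality, so that the quotient
    [Om] is an ordinary type: a copy of the first uncountable ordinal. *)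
Definition canon (a : brw) : brw := epsilon (inhabits BZ) (beq a).

Lemma canon_spec a : beq a (canon a).
Proof. apply (epsilon_spec (inhabits BZ) (beq a)). exists a; split; apply ble_refl. Qed.

Lemma canon_eq a b : beq a b -> canon a = canon b.
Proof.
  intros [H1 H2]; unfold canon; f_equal.
  apply functional_extensionality; intro c; apply propositional_extensionality.
  split; intros [H3 H4]; split; eapply ble_trans; eauto.
Qed.

Definition Om : Type := {a : brw | canon a = a}.

Definition olt (i j : Om) : Prop := blt (proj1_sig i) (proj1_sig j).
Definition ole (i j : Om) : Prop := i = j \/ olt i j.

Definition mkO (a : brw) : Om :=
  exist _ (canon a) (eq_sym (canon_eq _ _ (canon_spec a))).

Lemma Om_ext (i j : Om) : beq (proj1_sig i) (proj1_sig j) -> i = j.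
Proof.
  destruct i as [a Ha], j as [b Hb]; simpl; intro H.
  assert (E : a = b) by (rewrite <- Ha, <- Hb; now apply canon_eq).
  subst b; f_equal; apply proof_irrelevance.
Qed.

Lemma olt_wf : well_founded olt.
Proof. exact (wf_inverse_image _ _ _ (fun i : Om => proj1_sig i) blt_wf). Qed.

Lemma olt_irrefl i : ~ olt i i.
Proof. intro H; induction (olt_wf i) as [i _ IH]; exact (IH i H H). Qed.

Lemma blt_ble a b : blt a b -> ble a b.
Proof.
  revert b; induction a as [|f IH]; intros b H; [exact I|].
  destruct b as [|g]; [easy|]. destruct H as [m Hm].
  apply ble_BL; intro n. exists m. apply IH.
  rewrite ble_BL in Hm; apply Hm.
Qed.

Lemma olt_trans i j k : olt i j -> olt j k -> olt i k.
Proof. intros H1 H2. exact (blt_ble_trans _ _ _ H1 (blt_ble _ _ H2)). Qed.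

Lemma olt_total i j : i = j \/ olt i j \/ olt j i.
Proof.
  unfold olt. destruct (ble_total (proj1_sig i) (proj1_sig j)) as [H|H]; [|tauto].
  destruct (ble_total (proj1_sig j) (proj1_sig i)) as [H'|H']; [|tauto].
  left; now apply Om_ext.
Qed.

Lemma Om_bounded (f : nat -> Om) : exists b, forall n, olt (f n) b.
Proof.
  exists (mkO (BL (fun n => proj1_sig (f n)))); intro n; unfold olt.
  eapply blt_ble_trans; [|exact (proj1 (canon_spec _))]. exists n; apply ble_refl.
Qed.

Lemma Om_countable (i : Om) : exists e : nat -> Om, forall j, olt j i -> exists n, e n = j.
Proof.
  unfold olt. generalize (proj1_sig i); intro a; clear i.
  induction a as [|f IH].
  - exists (fun _ => mkO BZ); easy.
  - destruct (choice_fun _ IH) as [e He].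
    exists (fun k => match of_nat k with
                     | (n, 0) => mkO (f n)
                     | (n, S m) => e n m end).
    intros j [n Hn]. destruct (ble_total (f n) (proj1_sig j)) as [H|H].
    + exists (to_nat (n, 0)). rewrite cancel_of_to. apply Om_ext; simpl.
      destruct (canon_spec (f n)) as [H1 H2].
      split; eapply ble_trans; eauto.
    + destruct (He n j H) as [m Hm]. exists (to_nat (n, S m)).
      now rewrite cancel_of_to.
Qed.

Lemma ole_lt_trans i j k : ole i j -> olt j k -> olt i k.
Proof. intros [->|H] H'; [exact H'|]. eapply olt_trans; eauto. Qed.

Lemma olt_le_trans i j k : olt i j -> ole j k -> olt i k.
Proof. intros H [<-|H']; [exact H|]. eapply olt_trans; eauto. Qed.

Lemma ole_refl i : ole i i.
Proof. now left. Qed.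

Lemma ole_trans i j k : ole i j -> ole j k -> ole i k.
Proof. intros [->|H] H'; [exact H'|]. right; eapply olt_le_trans; eauto. Qed.

Lemma ole_or_lt i j : ole i j \/ olt j i.
Proof. unfold ole; destruct (olt_total i j) as [H|[H|H]]; tauto. Qed.

Lemma not_olt i j : ~ olt i j <-> ole j i.
Proof.
  split.
  - intro H; destruct (ole_or_lt j i); tauto.
  - intros H H'. apply (olt_irrefl i). eapply olt_le_trans; eauto.
Qed.

Lemma not_ole i j : ~ ole i j <-> olt j i.
Proof. rewrite <- not_olt. split; [apply NNPP|tauto]. Qed.

Lemma ole_antisym i j : ole i j -> ole j i -> i = j.
Proof.
  intros [H|H] H'; [exact H|]. exfalso; apply (olt_irrefl i); eapply olt_le_trans; eauto.
Qed.

Definition is_least (P : Om -> Prop) (i : Om) : Prop := P i /\ forall j, P j -> ole i j.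

Lemma least_ex (P : Om -> Prop) : (exists i, P i) -> exists i, is_least P i.
Proof.
  intros [i Hi]. induction (olt_wf i) as [i _ IH].
  destruct (classic (exists j, olt j i /\ P j)) as [[j [Hj Pj]]|H].
  - exact (IH j Hj Pj).
  - exists i; split; [exact Hi|]. intros j Pj. apply not_olt; intro; eauto.
Qed.

Definition least (P : Om -> Prop) : Om := epsilon (inhabits (mkO BZ)) (is_least P).

Lemma least_spec P : (exists i, P i) -> is_least P (least P).
Proof. intro H; apply (epsilon_spec (inhabits (mkO BZ)) (is_least P)); now apply least_ex. Qed.

Lemma least_unique P i : is_least P i -> least P = i.
Proof.
  intros [H1 H2]. destruct (least_spec P) as [H3 H4]; [eauto|].
  apply ole_antisym; auto.
Qed.

Lemma least_ext P Q : (forall i, P i <-> Q i) -> least P = least Q.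
Proof.
  intro H; f_equal; apply functional_extensionality; intro i.
  now apply propositional_extensionality.
Qed.

Definition ozero : Om := least (fun _ => True).
Definition osucc (i : Om) : Om := least (olt i).

Lemma ozero_le i : ole ozero i.
Proof. apply (least_spec (fun _ => True)); [now exists i|exact I]. Qed.

Lemma olt_zero i : ~ olt i ozero.
Proof. apply not_olt, ozero_le. Qed.

Lemma osucc_spec i : is_least (olt i) (osucc i).
Proof. apply least_spec. destruct (Om_bounded (fun _ => i)) as [b Hb]. exists b; exact (Hb 0). Qed.

Lemma olt_succ i : olt i (osucc i).
Proof. apply osucc_spec. Qed.

Lemma osucc_le i j : olt i j -> ole (osucc i) j.
Proof. apply osucc_spec. Qed.

Lemma olt_succ_le i j : olt i (osucc j) <-> ole i j.
Proof.
  split; intro H.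
  - apply not_olt; intro H'. apply (olt_irrefl i).
    eapply olt_le_trans; [exact H|]. now apply osucc_le.
  - eapply ole_lt_trans; [exact H|apply olt_succ].
Qed.

Lemma is_succ_osucc i : is_succ olt i (osucc i).
Proof.
  split; [apply olt_succ|]. intros [u [H1 H2]]. apply (olt_irrefl u).
  eapply olt_le_trans; [exact H2|now apply osucc_le].
Qed.

Lemma is_succ_eq i j : is_succ olt i j -> j = osucc i.
Proof.
  intros [H1 H2]. apply ole_antisym; [|now apply osucc_le].
  apply not_olt; intro H. apply H2. exists (osucc i); split; [apply olt_succ|exact H].
Qed.

Lemma osucc_inj i j : osucc i = osucc j -> i = j.
Proof.
  intro H; apply ole_antisym; apply olt_succ_le.
  - rewrite <- H; apply olt_succ.
  - rewrite H; apply olt_succ.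
Qed.

Definition olim (i : Om) : Prop := is_limit olt i.

Lemma Om_cases i : i = ozero \/ (exists j, i = osucc j) \/ olim i.
Proof.
  destruct (classic (i = ozero)) as [H|H]; [tauto|].
  destruct (classic (exists j, i = osucc j)) as [H'|H']; [tauto|].
  right; right; split.
  - exists ozero. destruct (ozero_le i); [congruence|assumption].
  - intros [s Hs]. apply H'. exists s; now apply is_succ_eq.
Qed.

Lemma olim_succ i j : olim i -> olt j i -> olt (osucc j) i.
Proof.
  intros [_ H] Hj. destruct (osucc_le _ _ Hj) as [E|E]; [|exact E].
  exfalso; apply H. exists j; rewrite <- E; apply is_succ_osucc.
Qed.

Lemma olim_not_succ j : ~ olim (osucc j).
Proof. intros [_ H]; apply H. exists j; apply is_succ_osucc. Qed.

Lemma olim_not_zero : ~ olim ozero.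
Proof. intros [[s Hs] _]; exact (olt_zero _ Hs). Qed.

Lemma olim_zero_lt i : olim i -> olt ozero i.
Proof.
  intro Hl. destruct (ozero_le i) as [<-|H]; [|exact H]. now apply olim_not_zero in Hl.
Qed.

(** For a register that only gains ones, the limsup is a union. *)
Lemma cofinal_mono (P : Om -> Prop) i : olim i ->
  (forall u u', olt u u' -> olt u' i -> P u -> P u') ->
  (cofinal olt i P <-> exists u, olt u i /\ P u).
Proof.
  intros Hl HP. split.
  - intro H. destruct Hl as [[s Hs] _]. destruct (H s Hs) as [u (_ & U2 & U3)]. eauto.
  - intros [u [U1 U2]] s Hs.
    assert (M : exists v, olt s v /\ olt u v /\ olt v i).
    { destruct (ole_or_lt s u) as [H|H].
      - exists (osucc u). split; [now apply olt_succ_le|].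
        split; [apply olt_succ|now apply olim_succ].
      - exists (osucc s). split; [apply olt_succ|]. split; [|now apply olim_succ].
        eapply olt_trans; [exact H|apply olt_succ]. }
    destruct M as [v (V1 & V2 & V3)]. exists v. split; [exact V1|split; [exact V3|]].
    eapply HP; eauto.
Qed.

Lemma olt_ind (P : Om -> Prop) : (forall i, (forall j, olt j i -> P j) -> P i) -> forall i, P i.
Proof. exact (well_founded_ind olt_wf P). Qed.

Lemma Om_image_bounded (g : Om -> Om) i : exists b, forall j, olt j i -> olt (g j) b.
Proof.
  destruct (Om_countable i) as [e He]. destruct (Om_bounded (fun n => g (e n))) as [b Hb].
  exists b; intros j Hj. destruct (He j Hj) as [n <-]; apply Hb.
Qed.

(** Transfinite recursion as a fixed-point equation. Outside the segment below [i] the functional is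
    fed the junk value [s0], which locality renders harmless. *)
Lemma Om_rec {S : Type} (s0 : S) (H : Om -> (Om -> S) -> S) :
  (forall i f g, (forall u, olt u i -> f u = g u) -> H i f = H i g) ->
  exists f, forall i, f i = H i f.
Proof.
  intro Hloc.
  set (F := fun i (rec : forall j, olt j i -> S) =>
    H i (fun u => match excluded_middle_informative (olt u i) with
                  | left h => rec u h | right _ => s0 end)).
  exists (Fix olt_wf (fun _ => S) F). intro i.
  rewrite Fix_eq.
  - unfold F at 1. apply Hloc. intros u Hu.
    destruct (excluded_middle_informative (olt u i)); easy.
  - intros j f g Hfg. unfold F. f_equal. apply functional_extensionality; intro u.
    destruct (excluded_middle_informative (olt u j)); easy.
Qed.

Fixpoint oplus (i : Om) (k : nat) : Om :=
  match k with 0 => i | S k => osucc (oplus i k) end.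

Lemma oplus_lt i k l : k < l -> olt (oplus i k) (oplus i l).
Proof.
  induction 1; simpl; [apply olt_succ|]. eapply olt_trans; [eassumption|apply olt_succ].
Qed.

Definition oomega (i : Om) : Om := least (fun b => forall k, olt (oplus i k) b).

Lemma oplus_lt_omega i k : olt (oplus i k) (oomega i).
Proof.
  revert k. apply (least_spec (fun b => forall k, olt (oplus i k) b)). apply Om_bounded.
Qed.

Lemma olt_omega i u : ole i u -> olt u (oomega i) -> exists k, u = oplus i k.
Proof.
  intros H1 H2. assert (H3 : exists k, olt u (oplus i k)).
  { apply NNPP; intro H. apply (olt_irrefl u). eapply olt_le_trans; [exact H2|].
    apply (least_spec (fun b => forall k, olt (oplus i k) b)); [apply Om_bounded|].
    intro k. eapply olt_le_trans; [apply (oplus_lt i k (S k)); lia|].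
    apply not_olt; intro; eauto. }
  destruct H3 as [k Hk]. induction k as [|k IH]; simpl in Hk.
  - exfalso. apply (olt_irrefl u). eapply olt_le_trans; eauto.
  - apply olt_succ_le in Hk. destruct Hk as [->|Hk]; eauto.
Qed.

Lemma olim_omega i : olim (oomega i).
Proof.
  split; [exists (oplus i 0); apply oplus_lt_omega|]. intros [s Hs].
  assert (Hi : ole i s).
  { apply olt_succ_le. rewrite <- (is_succ_eq _ _ Hs). exact (oplus_lt_omega i 0). }
  destruct (olt_omega i s Hi (proj1 Hs)) as [k ->].
  apply (proj2 Hs). exists (oplus i (S k)); split; [apply olt_succ|apply oplus_lt_omega].
Qed.

Lemma cofinal_omega i P :
  cofinal olt (oomega i) P <-> (forall k, exists l, k < l /\ P (oplus i l)).
Proof.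
  split.
  - intros H k. destruct (H _ (oplus_lt_omega i k)) as [u [H1 [H2 H3]]].
    destruct (olt_omega i u) as [l ->]; [|exact H2|].
    + right. eapply ole_lt_trans; [|exact H1]. destruct k; [now left|].
      right. apply (oplus_lt i 0); lia.
    + exists l; split; [|exact H3]. destruct (le_lt_dec l k) as [Hl|Hl]; [|exact Hl].
      exfalso. apply (olt_irrefl (oplus i k)). eapply olt_le_trans; [exact H1|].
      destruct (Nat.eq_dec l k) as [->|]; [now left|]. right; apply oplus_lt; lia.
  - intros H s Hs. destruct (ole_or_lt i s) as [Hi|Hi].
    + destruct (olt_omega i s Hi Hs) as [k ->]. destruct (H k) as [l [Hl Pl]].
      exists (oplus i l); repeat split; [now apply oplus_lt|apply oplus_lt_omega|exact Pl].
    + destruct (H 0) as [l [Hl Pl]]. exists (oplus i l); repeat split;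
        [|apply oplus_lt_omega|exact Pl]. eapply olt_trans; [exact Hi|].
      apply (oplus_lt i 0); lia.
Qed.

(** * Transfinite iterations with limsup at limits *)

Definition limsup {S : Type} (obs : S -> real) (tr : Om -> S) (i : Om) : real :=
  fun n => asb (cofinal olt i (fun u => obs (tr u) n = true)).

(** A limit state depends on the history only through the limsup of the observed bits. This covers
    machine configurations, observed on their tapes, as well as iterated operators on reals, where
    state and observation coincide. *)
Definition traj {S : Type} (nxt : S -> S) (obs : S -> real) (lim : real -> S)
    (tr : Om -> S) : Prop :=
  (forall i, tr (osucc i) = nxt (tr i)) /\
  (forall i, olim i -> tr i = lim (limsup obs tr i)).

Lemma traj_ex {S : Type} (nxt : S -> S) (obs : S -> real) (lim : real -> S) (s0 : S) :
  exists tr, tr ozero = s0 /\ traj nxt obs lim tr.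
Proof.
  set (H := fun i (f : Om -> S) =>
    match excluded_middle_informative (exists j, i = osucc j) with
    | left h => nxt (f (proj1_sig (constructive_indefinite_description _ h)))
    | right _ => if excluded_middle_informative (olim i) then lim (limsup obs f i) else s0
    end).
  destruct (Om_rec s0 H) as [tr Htr].
  - intros i f g Hfg. unfold H.
    destruct (excluded_middle_informative _) as [h|_].
    + destruct (constructive_indefinite_description _ h) as [j Hj]; simpl.
      f_equal. apply Hfg. rewrite Hj; apply olt_succ.
    + destruct (excluded_middle_informative (olim i)); [|easy].
      f_equal. apply functional_extensionality; intro n. apply asb_ext.
      split; intros Hc s Hs; destruct (Hc s Hs) as [u [H1 [H2 H3]]]; exists u;
        [rewrite <- Hfg|rewrite Hfg]; tauto.
  - exists tr; repeat split.
    + rewrite Htr; unfold H.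
      destruct (excluded_middle_informative _) as [[j Hj]|_].
      { exfalso; apply (olt_zero j). rewrite Hj; apply olt_succ. }
      destruct (excluded_middle_informative (olim ozero)) as [h|_]; [|easy].
      now apply olim_not_zero in h.
    + intro i; rewrite Htr at 1; unfold H.
      destruct (excluded_middle_informative _) as [h|h].
      * destruct (constructive_indefinite_description _ h) as [j Hj]; simpl.
        now rewrite (osucc_inj _ _ Hj).
      * exfalso; eauto.
    + intros i Hi; rewrite Htr at 1; unfold H.
      destruct (excluded_middle_informative _) as [[j ->]|_].
      * now apply olim_not_succ in Hi.
      * destruct (excluded_middle_informative (olim i)); easy.
Qed.

Definition rtraj (G : real -> real) (tr : Om -> real) : Prop :=
  traj G (fun x => x) (fun x => x) tr.

Lemma traj_oplus {S : Type} (nxt : S -> S) obs lim (tr : Om -> S) :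
  traj nxt obs lim tr -> forall i k, tr (oplus i k) = Nat.iter k nxt (tr i).
Proof.
  intros [H _] i k; induction k as [|k IH]; [easy|]. simpl; rewrite H, IH; easy.
Qed.

(* The value of an observed bit of the simulating system at a limit of simulated stages:
   on, off, unconstrained, or bit [n] of the simulated state. *)
Inductive kind := KOn | KOff | KFree | KReg (n : nat).

Section Simulation.

Context {S : Type} (nxt : S -> S) (obs : S -> real) (lim : real -> S) (tr : Om -> S).
Hypothesis Htr : traj nxt obs lim tr.

Context (G : real -> real) (trB : Om -> real).
Hypothesis HtrB : rtraj G trB.

Context (E : real -> S -> Prop) (cls : nat -> kind) (Inv : S -> Prop).

(** The discipline for the times spent on simulating the step from [b] to [G b]: a data bit may be
    off at any time, but a one must be justified by [b] or by [G b]. *)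
Definition seg_ok (b : real) (s : S) : Prop :=
  Inv s /\ forall k, match cls k with
    | KOff => obs s k = false
    | KReg n => obs s k = true -> b n = true \/ G b n = true
    | _ => True end.

Hypothesis HE : forall b s, E b s -> forall k, match cls k with
    | KOn => obs s k = true
    | KReg n => b n = true -> obs s k = true
    | _ => True end.

Hypothesis Hstep : forall b t, b 0 = true -> E b (tr t) ->
  exists t', olt t t' /\ E (G b) (tr t') /\
    forall u, ole t u -> olt u t' -> seg_ok b (tr u).

Hypothesis Hlim : forall b o, (forall k, match cls k with
    | KOn => o k = true
    | KOff => o k = false
    | KReg n => o k = b n
    | KFree => True end) -> E b (lim o).

(** At a limit of simulated stages, ones of the simulated bits recur at the encoded stages by [HE],
    and ones seen in between are justified by [seg_ok]. So the limsup of the simulating system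
    encodes the limsup of the simulated one, and [Hlim] applies. *)
Theorem simulation (s0 : Om) (i : Om) :
  E (trB ozero) (tr s0) -> (forall j, olt j i -> trB j 0 = true) ->
  exists t, ole s0 t /\ E (trB i) (tr t) /\
    forall u, ole s0 u -> olt u t -> Inv (tr u).
Proof.
  intros E0 Hlive.
  (* [tau i] will be the first time after all earlier [tau j] at which state [i] is encoded. *)
  set (Q := fun (tau : Om -> Om) i t =>
    ole s0 t /\ (forall j, olt j i -> olt (tau j) t) /\ E (trB i) (tr t)).
  destruct (Om_rec ozero (fun i tau => least (Q tau i))) as [tau Htau].
  { intros k f g Hfg. apply least_ext; intro t. unfold Q.
    split; intros (H1 & H2 & H3); repeat split; auto; intros j Hj;
      [rewrite <- Hfg|rewrite Hfg]; auto. }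
  assert (Main : forall k, ole k i -> Q tau k (tau k) /\
    forall u, ole s0 u -> olt u (tau k) ->
      exists j, olt j k /\ olt u (tau (osucc j)) /\ seg_ok (trB j) (tr u)).
  { intro k; induction k as [k IH] using olt_ind; intro Hk.
    assert (IHQ : forall j, olt j k -> Q tau j (tau j))
      by (intros j Hj; apply IH; [exact Hj|right; eapply olt_le_trans; eauto]).
    assert (Hleast : forall t, Q tau k t -> is_least (Q tau k) (tau k))
      by (intros t Ht; rewrite Htau; apply least_spec; eauto).
    destruct (Om_cases k) as [->|[[j ->]|Hl]].
    - assert (L : is_least (Q tau ozero) (tau ozero)).
      { apply (Hleast s0). repeat split; [apply ole_refl| |exact E0].
        intros j Hj; now apply olt_zero in Hj. }
      split; [apply L|]. intros u Hu1 Hu2. exfalso. apply (olt_irrefl u).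
      eapply olt_le_trans; [exact Hu2|]. eapply ole_trans; [|exact Hu1].
      apply L. repeat split; [apply ole_refl| |exact E0].
      intros j Hj; now apply olt_zero in Hj.
    - destruct (IH j (olt_succ j)) as [(Q1 & Q2 & Q3) Seg].
      { right; eapply olt_le_trans; [apply olt_succ|exact Hk]. }
      destruct (Hstep (trB j) (tau j)) as [t' (T1 & T2 & T3)]; [|exact Q3|].
      { apply Hlive. eapply olt_le_trans; [apply olt_succ|exact Hk]. }
      assert (QT : Q tau (osucc j) t').
      { repeat split.
        - right; eapply ole_lt_trans; eauto.
        - intros l Hl. apply olt_succ_le in Hl as [->|Hl]; [exact T1|].
          eapply olt_trans; [apply Q2; exact Hl|exact T1].
        - rewrite (proj1 HtrB); exact T2. }
      destruct (Hleast _ QT) as [L1 L2]. split; [exact L1|].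
      intros u Hu1 Hu2. destruct (ole_or_lt (tau j) u) as [H|H].
      + exists j; split; [apply olt_succ|]. split; [exact Hu2|].
        apply T3; [exact H|]. eapply olt_le_trans; [exact Hu2|]. now apply L2.
      + destruct (Seg u Hu1 H) as [l [Hl1 Hl2]]. exists l; split; [|exact Hl2].
        eapply olt_trans; [exact Hl1|apply olt_succ].
    - set (UB := fun t => forall j, olt j k -> olt (tau j) t).
      destruct (least_spec UB) as [B1 B2].
      { destruct (Om_image_bounded tau k) as [b Hb]. exists b; exact Hb. }
      set (B := least UB) in *.
      assert (Bcof : forall u, olt u B -> exists j, olt j k /\ ole u (tau j)).
      { intros u Hu. apply NNPP; intro H. apply (olt_irrefl u).
        eapply olt_le_trans; [exact Hu|]. apply B2. intros j Hj.
        apply not_ole; intro; eauto. }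
      assert (Hz : olt ozero k) by now apply olim_zero_lt.
      assert (Mono : forall j l, olt j l -> olt l k -> olt (tau j) (tau l)).
      { intros j l H1 H2. apply (IHQ l H2); exact H1. }
      assert (Blim : olim B).
      { split; [exists (tau ozero); now apply B1|]. intros [s Hs].
        destruct (Bcof s (proj1 Hs)) as [j [Hj Hsj]]. apply (proj2 Hs).
        exists (tau (osucc j)). assert (olt (osucc j) k) by now apply olim_succ.
        split; [|now apply B1]. eapply ole_lt_trans; [exact Hsj|].
        apply Mono; [apply olt_succ|assumption]. }
      assert (Bs0 : ole s0 B).
      { right. eapply ole_lt_trans; [apply (IHQ ozero Hz)|now apply B1]. }
      assert (BSeg : forall u, ole s0 u -> olt u B ->
        exists j, olt j k /\ olt u (tau (osucc j)) /\ seg_ok (trB j) (tr u)).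
      { intros u Hu1 Hu2. destruct (Bcof u Hu2) as [j [Hj Hju]].
        assert (Hj' : olt (osucc j) k) by now apply olim_succ.
        destruct (IH _ Hj') as [_ Seg]; [right; eapply olt_le_trans; eauto|].
        destruct (Seg u Hu1) as [l [Hl1 Hl2]].
        - eapply ole_lt_trans; [exact Hju|]. apply Mono; [apply olt_succ|exact Hj'].
        - exists l; split; [|exact Hl2]. eapply olt_trans; eauto. }
      (* Times late below [B] belong to segments of late simulated stages; this converts cofinality
         below [B] into cofinality below [k]. *)
      assert (Late : forall l u, olt l k -> olt (tau (osucc l)) u -> olt u B ->
        exists j, olt l j /\ olt j k /\ seg_ok (trB j) (tr u)).
      { intros l u Hlk Hlu Hu.
        assert (Hl' : olt (osucc l) k) by now apply olim_succ.
        destruct (BSeg u) as [j (J1 & J2 & J3)]; [|exact Hu|].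
        { right. eapply ole_lt_trans; [apply (IHQ (osucc l) Hl')|exact Hlu]. }
        exists j; repeat split; [|exact J1|apply J3|apply J3].
        apply not_ole; intro H. apply (olt_irrefl u). eapply olt_trans; [exact J2|].
        eapply ole_lt_trans; [|exact Hlu]. destruct H as [->|H]; [apply ole_refl|].
        right; apply Mono; [|exact Hl']. apply olt_succ_le, osucc_le, H. }
      assert (EB : E (trB k) (tr B)).
      { rewrite (proj2 Htr B Blim). apply Hlim. intro n.
        pose proof (fun j Hj => HE _ _ (proj2 (proj2 (IHQ j Hj))) n) as HE'.
        destruct (cls n) as [| | |m] eqn:Hc; [| |exact I|].
        - apply asbP. intros s Hs. destruct (Bcof s Hs) as [j [Hj Hsj]].
          assert (Hj' : olt (osucc j) k) by now apply olim_succ.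
          exists (tau (osucc j)). split; [|split; [now apply B1|exact (HE' _ Hj')]].
          eapply ole_lt_trans; [exact Hsj|]. apply Mono; [apply olt_succ|exact Hj'].
        - apply asbF. intro H. assert (H0 : olt (osucc ozero) k) by now apply olim_succ.
          destruct (H (tau (osucc ozero)) (B1 _ H0)) as [u (U1 & U2 & U3)].
          destruct (Late ozero u Hz U1 U2) as [j (_ & _ & _ & J)].
          specialize (J n); rewrite Hc in J; congruence.
        - rewrite (proj2 HtrB k Hl). apply asb_ext. split; intros H s Hs.
          + assert (Hs' : olt (osucc s) k) by now apply olim_succ.
            destruct (H (tau (osucc s)) (B1 _ Hs')) as [u (U1 & U2 & U3)].
            (* A one observed in segment [j] is charged to the simulated stage [j] or to its
               successor, both strictly between [s] and [k]. *)
            destruct (Late s u Hs U1 U2) as [j (J1 & J2 & _ & J)].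
            specialize (J n); rewrite Hc in J. destruct (J U3) as [J'|J'].
            * exists j; auto.
            * exists (osucc j); split; [|split].
              -- eapply olt_trans; [exact J1|apply olt_succ].
              -- now apply olim_succ.
              -- now rewrite (proj1 HtrB).
          + destruct (Bcof s Hs) as [j [Hj Hsj]]. destruct (H j Hj) as [l (L1 & L2 & L3)].
            exists (tau l); split; [|split; [now apply B1|exact (HE' _ L2 L3)]].
            eapply ole_lt_trans; [exact Hsj|now apply Mono]. }
      assert (L : is_least (Q tau k) (tau k)) by (apply (Hleast B); now repeat split).
      split; [apply L|]. intros u Hu1 Hu2. apply BSeg; [exact Hu1|].
      eapply olt_le_trans; [exact Hu2|]. apply L. now repeat split. }
  destruct (Main i (ole_refl i)) as [(Q1 & Q2 & Q3) Seg].
  exists (tau i); repeat split; auto. intros u Hu1 Hu2.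
  destruct (Seg u Hu1 Hu2) as [j (_ & _ & H & _)]; exact H.
Qed.

End Simulation.

(** * Countable types *)

Definition countable (A : Type) : Prop :=
  exists e : nat -> A, forall a, exists n, e n = a.

Lemma countable_nat : countable nat.
Proof. exists (fun n => n); eauto. Qed.

Lemma countable_bool : countable bool.
Proof. exists (fun n => Nat.eqb n 0); intros []; [exists 0|exists 1]; easy. Qed.

Lemma countable_prod A B : countable A -> countable B -> countable (A * B).
Proof.
  intros [e He] [f Hf]. exists (fun n => (e (fst (of_nat n)), f (snd (of_nat n)))).
  intros [a b]. destruct (He a) as [n <-], (Hf b) as [m <-].
  exists (to_nat (n, m)). now rewrite cancel_of_to.
Qed.

Lemma countable_map A B (f : A -> B) : (forall b, exists a, f a = b) -> countable A -> countable B.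
Proof.
  intros Hf [e He]. exists (fun n => f (e n)). intro b. destruct (Hf b) as [a <-].
  destruct (He a) as [n <-]; eauto.
Qed.

Lemma countable_list A : countable A -> countable (list A).
Proof.
  intros [e He].
  set (d := fix d m k := match m with
    | 0 => [] | S m => e (fst (of_nat k)) :: d m (snd (of_nat k)) end).
  exists (fun k => d (fst (of_nat k)) (snd (of_nat k))).
  assert (H : forall l, exists k, d (length l) k = l).
  { induction l as [|x l [k IH]]; [now exists 0|]. destruct (He x) as [n Hn].
    exists (to_nat (n, k)). change (e (fst (of_nat (to_nat (n, k))))
      :: d (length l) (snd (of_nat (to_nat (n, k)))) = x :: l).
    rewrite cancel_of_to; simpl. congruence. }
  intro l. destruct (H l) as [k Hk]. exists (to_nat (length l, k)).
  now rewrite cancel_of_to.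
Qed.

(** * Programs given by a transition function on a finite set of states *)

Section Programs.

Context {St : Type} (enc : St -> nat)
  (dl : St -> bool -> bool -> bool -> bool -> option (St * bool * bool * bool * move)).

Definition instrs_of (q : St * (bool * bool * bool * bool)) : list instr :=
  let '(s, (a, b, c, d)) := q in
  match dl s a b c d with
  | Some (s', x, y, z, m) => [mkInstr (enc s) a b c d (enc s') x y z m]
  | None => []
  end.

Definition bools := [true; false].

Definition prog_of (L : list St) : program :=
  flat_map instrs_of (list_prod L (list_prod (list_prod (list_prod bools bools) bools) bools)).

Definition dstep (s : St) (a : real) (c : config) : option config :=
  match dl s (tin c (head c)) (tsc c (head c)) (tout c (head c)) (a (head c)) with
  | Some (s', x, y, z, m) => Some (mkConfig (enc s')
      (match m with MoveL => Nat.pred (head c) | MoveR => S (head c) end)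
      (upd (tin c) (head c) x) (upd (tsc c) (head c) y) (upd (tout c) (head c) z))
  | None => None
  end.

(** Injectivity of [enc] leaves at most one applicable instruction, so [find] cannot pick a wrong
    one. *)
Lemma step_prog_of L a s c :
  (forall s s', enc s = enc s' -> s = s') -> In s L -> state c = enc s ->
  step (prog_of L) a c = dstep s a c.
Proof.
  intros Hinj Hs Hc. unfold step, lookup.
  match goal with |- option_map _ (find ?f _) = _ => set (g := f) end.
  assert (Hin : forall i, In i (prog_of L) <->
    exists s x y z w, In s L /\ In i (instrs_of (s, (x, y, z, w)))).
  { intro i. unfold prog_of. rewrite in_flat_map. split.
    - intros [[s' [[[x y] z] w]] [H1 H2]]. apply in_prod_iff in H1 as [H1 _].
      exists s', x, y, z, w; auto.
    - intros (s' & x & y & z & w & H1 & H2). exists (s', (x, y, z, w)); split; [|exact H2].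
      rewrite !in_prod_iff. unfold bools; simpl.
      destruct x, y, z, w; intuition. }
  assert (Hg : forall i, In i (prog_of L) -> g i = true ->
    In i (instrs_of (s, (tin c (head c), tsc c (head c), tout c (head c), a (head c))))).
  { intros i H1 H2. apply Hin in H1 as (s' & x & y & z & w & H3 & H4).
    unfold g in H2. rewrite !andb_true_iff, Nat.eqb_eq, !eqb_true_iff in H2.
    unfold instrs_of in H4. destruct (dl s' x y z w) as [[[[[s2 x2] y2] z2] m]|] eqn:D; [|easy].
    destruct H4 as [<-|[]]. cbn in H2. destruct H2 as [[[[E1 E2] E3] E4] E5].
    rewrite Hc in E1. apply Hinj in E1. subst. unfold instrs_of. rewrite D. now left. }
  destruct (find g (prog_of L)) as [i|] eqn:F.
  - apply find_some in F as [F1 F2]. specialize (Hg i F1 F2).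
    unfold instrs_of in Hg. unfold dstep.
    destruct (dl s _ _ _ _) as [[[[[s2 x2] y2] z2] m]|]; [|easy].
    destruct Hg as [<-|[]]. reflexivity.
  - unfold dstep. destruct (dl s _ _ _ _) as [[[[[s2 x2] y2] z2] m]|] eqn:D; [|easy].
    exfalso. assert (H : g (mkInstr (enc s) (tin c (head c)) (tsc c (head c))
      (tout c (head c)) (a (head c)) (enc s2) x2 y2 z2 m) = true).
    { unfold g; cbn. rewrite Hc, Nat.eqb_refl, !eqb_reflx. easy. }
    rewrite (find_none _ _ F) in H; [easy|]. apply Hin.
    exists s, (tin c (head c)), (tsc c (head c)), (tout c (head c)), (a (head c)).
    split; [exact Hs|]. unfold instrs_of. rewrite D. now left.
Qed.

End Programs.

(** * An ITTM iterating an operator coded in its parameter *)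

(** Every limit stage resumes in [ILim], so the scratch tape must tell what has just ended. A marked
    first cell means an evaluation or a limit of simulated stages, whose result on the output tape
    either stops the machine or is swept back to the input; an unmarked one means a finished
    sweep. *)
Inductive ist :=
| IStart | ILim | ISweep | IInit (f : bool) | IGo (f e : bool) | IRd1 (f e b : bool)
| IRd2 (f e b b' : bool) | IBack (f e b b' b'' : bool) | IPut (f e : bool).

(** The codes 0 and 1 are forced by [start_state] and [limit_state]. *)
Definition ienc (s : ist) : nat :=
  let n := Nat.b2n in
  match s with
  | IStart => 0 | ILim => 1 | ISweep => 2
  | IInit f => 3 + n f
  | IGo f e => 5 + n f + 2 * n e
  | IRd1 f e b => 9 + n f + 2 * n e + 4 * n b
  | IRd2 f e b b' => 17 + n f + 2 * n e + 4 * n b + 8 * n b'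
  | IBack f e b b' b'' => 33 + n f + 2 * n e + 4 * n b + 8 * n b' + 16 * n b''
  | IPut f e => 65 + n f + 2 * n e
  end.

Arguments ienc : simpl never.

Definition istates : list ist :=
  let B := [false; true] in
  [IStart; ILim; ISweep] ++ map IInit B
  ++ flat_map (fun e => map (fun f => IGo f e) B) B
  ++ flat_map (fun b => flat_map (fun e => map (fun f => IRd1 f e b) B) B) B
  ++ flat_map (fun b' => flat_map (fun b => flat_map (fun e =>
       map (fun f => IRd2 f e b b') B) B) B) B
  ++ flat_map (fun b'' => flat_map (fun b' => flat_map (fun b => flat_map (fun e =>
       map (fun f => IBack f e b b' b'') B) B) B) B) B
  ++ flat_map (fun e => map (fun f => IPut f e) B) B.

Lemma istates_nth s : nth (ienc s) istates IStart = s.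
Proof. destruct s; repeat match goal with b : bool |- _ => destruct b end; reflexivity. Qed.

Lemma ienc_inj s s' : ienc s = ienc s' -> s = s'.
Proof. intro H. now rewrite <- (istates_nth s), H, istates_nth. Qed.

Lemma istates_in s : In s istates.
Proof.
  rewrite <- (istates_nth s). apply nth_In.
  destruct s; repeat match goal with b : bool |- _ => destruct b end; cbv; lia.
Qed.

(* The head position [j] of the simulated stream machine is the first [0] on the
   scratch tape and its reading position in the parameter is the second one.
   The flag [f] says that no limit stage has occurred yet, and [e] that a test of the
   current condition has failed. *)
Definition idelta (s : ist) (i c o a : bool) : option (ist * bool * bool * bool * move) :=
  match s with
  | IStart => Some (IInit true, i, c, o, MoveR)
  | ILim => if c then (if o then Some (ISweep, o, false, false, MoveR) else None)
            else Some (IInit false, i, c, o, MoveR)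
  | ISweep => Some (ISweep, o, false, false, MoveR)
  | IInit f => Some (IGo f false, i, true, o, MoveR)
  | IGo f e => if c then Some (IGo f e, i, c, o, MoveR)
               else Some (IRd1 f e a, i, true, o, MoveR)
  | IRd1 f e b => Some (IRd2 f e b a, i, true, o, MoveR)
  | IRd2 f e b b' => Some (IBack f e b b' a, i, true, o, MoveL)
  | IBack f e b b' b'' =>
    if c then Some (IBack f e b b' b'', i, c, o, MoveL) else
    match b, b' with
    | false, false => Some (IGo f (e || xorb i b''), i, false, o, MoveR)
    | false, true => Some (IGo f (e || xorb f b''), i, false, o, MoveR)
    | true, false => if b'' then Some (IGo f e, i, false, o || negb e, MoveR)
                     else Some (IGo f false, i, false, o, MoveR)
    | true, true => Some (IPut f e, i, true, o, if b'' then MoveR else MoveL)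
    end
  | IPut f e => Some (IGo f e, i, false, o, MoveR)
  end.

Definition iprog : program := prog_of ienc idelta istates.

Lemma step_iprog a s c : state c = ienc s -> step iprog a c = dstep ienc idelta s a c.
Proof. intro H. apply step_prog_of; [apply ienc_inj|apply istates_in|exact H]. Qed.

Definition nxt (p : program) (a : real) (c : config) : config :=
  match step p a c with Some d => d | None => c end.

(** The stream has no jumps: all control is in the error flag, which [OWrite] consults. Operation
    [t] occupies the parameter cells 2 + 3t to 4 + 3t; cells 0 and 1 are passed while starting, when
    cell 0 stays unmarked as the head position and cell 1 gets the first mark. *)
Inductive sop := OTest (v : bool) | OFirst (v : bool) | OClear | OWrite | OMove (v : bool).

Definition sop_bits (o : sop) : bool * bool * bool :=
  match o with
  | OTest v => (false, false, v) | OFirst v => (false, true, v)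
  | OClear => (true, false, false) | OWrite => (true, false, true)
  | OMove v => (true, true, v)
  end.

Definition sstate := (nat * bool * real)%type.

Definition sop_step (f : bool) (X : real) (s : sstate) (o : sop) : sstate :=
  let '(j, e, Y) := s in
  match o with
  | OTest v => (j, e || xorb (X j) v, Y)
  | OFirst v => (j, e || xorb f v, Y)
  | OClear => (j, false, Y)
  | OWrite => (j, e, upd Y j (Y j || negb e))
  | OMove v => (if v then S j else Nat.pred j, e, Y)
  end.

Lemma upd_same (X : real) n : upd X n (X n) = X.
Proof.
  apply functional_extensionality; intro k. unfold upd.
  destruct (Nat.eqb_spec k n); congruence.
Qed.

Definition marks (j P : nat) : real := fun n => Nat.ltb n P && negb (Nat.eqb n j).

Lemma real_ext (x y : real) : (forall n, x n = y n) -> x = y.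
Proof. apply functional_extensionality. Qed.

Ltac marks_tac :=
  apply real_ext; intro; unfold upd, marks;
  repeat match goal with
  | |- context [Nat.eqb ?a ?b] => destruct (Nat.eqb_spec a b)
  | |- context [Nat.ltb ?a ?b] => destruct (Nat.ltb_spec a b)
  end; simpl; try reflexivity; try lia.

Section Stream.

Context (ops : nat -> sop) (a : real) (f : bool) (X : real).
Hypothesis Ha : forall t, (a (2 + 3 * t), a (3 + 3 * t), a (4 + 3 * t)) = sop_bits (ops t).

Definition srun (t : nat) : sstate :=
  fold_left (sop_step f X) (map ops (seq 0 t)) (0, false, fun _ => false).

Lemma srun_S t : srun (S t) = sop_step f X (srun t) (ops t).
Proof. unfold srun. now rewrite seq_S, map_app, fold_left_app. Qed.

Definition reaches (c d : config) : Prop := exists k, Nat.iter k (nxt iprog a) c = d.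

Lemma reaches_trans c d e : reaches c d -> reaches d e -> reaches c e.
Proof. intros [k <-] [l <-]. exists (l + k). now rewrite Nat.iter_add. Qed.

Lemma reaches_step s c d :
  state c = ienc s -> dstep ienc idelta s a c = Some d -> reaches c d.
Proof. intros H1 H2. exists 1. simpl. unfold nxt. now rewrite (step_iprog a s c H1), H2. Qed.

Lemma reaches_right e Y j P n :
  forall h, h + n = P -> j < h ->
  reaches (mkConfig (ienc (IGo f e)) h X (marks j P) Y)
          (mkConfig (ienc (IGo f e)) P X (marks j P) Y).
Proof.
  induction n as [|n IH]; intros h Hn Hj.
  - replace h with P by lia. now exists 0.
  - eapply reaches_trans; [|apply (IH (S h)); lia].
    eapply reaches_step; [reflexivity|]. unfold dstep; cbn.
    assert (E : marks j P h = true).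
    { unfold marks. destruct (Nat.ltb_spec h P), (Nat.eqb_spec h j); simpl; auto; lia. }
    rewrite E. now rewrite <- E, !upd_same.
Qed.

Lemma reaches_left e b b' b'' Y j P n :
  forall h, h = j + n -> h < P ->
  reaches (mkConfig (ienc (IBack f e b b' b'')) h X (marks j P) Y)
          (mkConfig (ienc (IBack f e b b' b'')) j X (marks j P) Y).
Proof.
  induction n as [|n IH]; intros h Hn Hj.
  - replace h with j by lia. now exists 0.
  - eapply reaches_trans; [|apply (IH (Nat.pred h)); lia].
    eapply reaches_step; [reflexivity|]. unfold dstep; cbn -[Nat.pred].
    assert (E : marks j P h = true).
    { unfold marks. destruct (Nat.ltb_spec h P), (Nat.eqb_spec h j); simpl; auto; lia. }
    rewrite E. now rewrite <- E, !upd_same.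
Qed.

Lemma marks_at j P : marks j P j = false.
Proof. unfold marks. now rewrite Nat.eqb_refl, andb_false_r. Qed.

(** The machine goes right to the second unmarked cell, reads and marks three cells, returns to the
    first unmarked cell and acts there. The step count [S k] is positive so that the times of
    successive rounds are unbounded. *)
Lemma round (t h j : nat) (e : bool) (Y : real) :
  j < h -> h <= 2 + 3 * t ->
  let '(j', e', Y') := sop_step f X (j, e, Y) (ops t) in
  exists h', j' < h' /\ h' <= 5 + 3 * t /\ exists k,
  Nat.iter (S k) (nxt iprog a) (mkConfig (ienc (IGo f e)) h X (marks j (2 + 3 * t)) Y)
  = mkConfig (ienc (IGo f e')) h' X (marks j' (5 + 3 * t)) Y'.
Proof.
  intros H1 H2. specialize (Ha t).
  set (P := 2 + 3 * t) in *.
  replace (3 + 3 * t) with (S P) in Ha by lia.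
  replace (4 + 3 * t) with (S (S P)) in Ha by lia.
  replace (5 + 3 * t) with (S (S (S P))) by lia. clearbody P.
  set (c0 := mkConfig _ _ _ _ _).
  assert (R1 : reaches c0 (mkConfig (ienc (IBack f e (a P) (a (S P)) (a (S (S P)))))
      j X (marks j (S (S (S P)))) Y)).
  { eapply reaches_trans; [apply (reaches_right e Y j P (P - h)); lia|].
    eapply reaches_trans.
    { eapply reaches_step; [reflexivity|]. unfold dstep; cbn.
      assert (E : marks j P P = false).
      { unfold marks. destruct (Nat.ltb_spec P P); simpl; auto; lia. }
      rewrite E. rewrite !upd_same. reflexivity. }
    eapply reaches_trans.
    { eapply reaches_step; [reflexivity|]. unfold dstep; cbn. rewrite !upd_same. reflexivity. }
    eapply reaches_trans.
    { eapply reaches_step; [reflexivity|]. unfold dstep; cbn. rewrite !upd_same. reflexivity. }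
    match goal with |- reaches ?c _ => replace c with
      (mkConfig (ienc (IBack f e (a P) (a (S P)) (a (S (S P))))) (S P) X
        (marks j (S (S (S P)))) Y) end.
    - apply (reaches_left e _ _ _ Y j (S (S (S P))) (S P - j)); lia.
    - f_equal. marks_tac. }
  (* The count is not zero because the round marks at least one of the cells [P] and [S P], both
     unmarked before. *)
  assert (NE : forall h' j' e' Y',
    reaches c0 (mkConfig (ienc (IGo f e')) h' X (marks j' (S (S (S P)))) Y') ->
    exists k, Nat.iter (S k) (nxt iprog a) c0 =
      mkConfig (ienc (IGo f e')) h' X (marks j' (S (S (S P)))) Y').
  { intros h' j' e' Y' [[|k] Hk]; [|eauto]. exfalso.
    unfold c0 in Hk; simpl Nat.iter in Hk. injection Hk as _ _ Hm _.
    assert (Hm1 := f_equal (fun g => g P) Hm). assert (Hm2 := f_equal (fun g => g (S P)) Hm).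
    unfold marks in Hm1, Hm2.
    destruct (Nat.ltb_spec P P), (Nat.ltb_spec (S P) P), (Nat.ltb_spec P (S (S (S P)))),
      (Nat.ltb_spec (S P) (S (S (S P)))), (Nat.eqb_spec P j'), (Nat.eqb_spec (S P) j');
      simpl in *; try lia; discriminate. }
  assert (Fin : forall h' j' e' Y', reaches (mkConfig
      (ienc (IBack f e (a P) (a (S P)) (a (S (S P))))) j X (marks j (S (S (S P)))) Y)
      (mkConfig (ienc (IGo f e')) h' X (marks j' (S (S (S P)))) Y') ->
    exists k, Nat.iter (S k) (nxt iprog a) c0 =
      mkConfig (ienc (IGo f e')) h' X (marks j' (S (S (S P)))) Y').
  { intros. apply NE. eapply reaches_trans; eauto. }
  clear R1 NE.
  destruct (ops t) as [v|v| | |v] eqn:Ho; cbn [sop_bits] in Ha; injection Ha as E1 E2 E3;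
    rewrite E1, E2, E3 in Fin; simpl sop_step.
  - exists (S j); split; [lia|split; [lia|]]. apply Fin.
    eapply reaches_step; [reflexivity|]. unfold dstep; cbn.
    now rewrite <- (marks_at j (S (S (S P)))), !marks_at, <- (marks_at j (S (S (S P)))), !upd_same.
  - exists (S j); split; [lia|split; [lia|]]. apply Fin.
    eapply reaches_step; [reflexivity|]. unfold dstep; cbn.
    now rewrite <- (marks_at j (S (S (S P)))), !marks_at, <- (marks_at j (S (S (S P)))), !upd_same.
  - exists (S j); split; [lia|split; [lia|]]. apply Fin.
    eapply reaches_step; [reflexivity|]. unfold dstep; cbn.
    now rewrite <- (marks_at j (S (S (S P)))), !marks_at, <- (marks_at j (S (S (S P)))), !upd_same.
  - exists (S j); split; [lia|split; [lia|]]. apply Fin.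
    eapply reaches_step; [reflexivity|]. unfold dstep; cbn.
    now rewrite <- (marks_at j (S (S (S P)))), !marks_at, <- (marks_at j (S (S (S P)))), !upd_same.
  - exists (S (if v then S j else Nat.pred j)). split; [lia|split; [destruct v; lia|]]. apply Fin.
    eapply reaches_trans.
    { eapply reaches_step; [reflexivity|]. unfold dstep; cbn -[Nat.pred].
      rewrite marks_at, !upd_same. reflexivity. }
    eapply reaches_step; [reflexivity|]. unfold dstep; cbn -[Nat.pred].
    rewrite !upd_same. f_equal. destruct v; f_equal; marks_tac.
Qed.

End Stream.

Definition zeros : real := fun _ => false.

Definition cstart (f : bool) (X : real) : config :=
  mkConfig (ienc (if f then IStart else ILim)) 0 X zeros zeros.

Definition isproc (s : ist) : Prop :=
  match s with IStart | ILim | ISweep => False | _ => True end.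

Lemma upd_true (Y : real) n b k : (Y n = true -> b = true) -> Y k = true -> upd Y n b k = true.
Proof. unfold upd. destruct (Nat.eqb_spec k n); subst; auto. Qed.

Lemma proc_step a s c : state c = ienc s -> isproc s ->
  exists d s', step iprog a c = Some d /\ state d = ienc s' /\ isproc s' /\ tin d = tin c /\
    forall n, tout c n = true -> tout d n = true.
Proof.
  intros Hc Hs. rewrite (step_iprog a s c Hc). unfold dstep.
  assert (K : exists s' y z m, idelta s (tin c (head c)) (tsc c (head c)) (tout c (head c))
      (a (head c)) = Some (s', tin c (head c), y, z, m) /\ isproc s' /\
      (tout c (head c) = true -> z = true)).
  { destruct s; try easy; cbn.
    all: repeat match goal with |- context [if ?b then _ else _] => destruct b end.
    all: repeat eexists; eauto; try exact I; intros ->; reflexivity. }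
  destruct K as (s' & y & z & m & -> & H1 & H2). do 2 eexists; split; [reflexivity|].
  cbn. split; [reflexivity|]. split; [exact H1|]. split; [apply upd_same|].
  intros n Hn. now apply upd_true.
Qed.

Section Process.

Context (ops : nat -> sop) (a : real) (f : bool) (X : real).
Hypothesis Ha : forall t, (a (2 + 3 * t), a (3 + 3 * t), a (4 + 3 * t)) = sop_bits (ops t).

Lemma cstart_step : nxt iprog a (cstart f X) = mkConfig (ienc (IInit f)) 1 X zeros zeros /\
  step iprog a (cstart f X) <> None.
Proof.
  unfold nxt. rewrite (step_iprog a (if f then IStart else ILim)) by reflexivity.
  unfold dstep; destruct f; cbn; (split; [|discriminate]); f_equal;
    try apply upd_same; exact (upd_same zeros 0).
Qed.

Lemma checkpoint t : let '(j, e, Y) := srun ops f X t in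
  exists k h, t <= k /\ j < h /\ h <= 2 + 3 * t /\
    Nat.iter k (nxt iprog a) (cstart f X)
    = mkConfig (ienc (IGo f e)) h X (marks j (2 + 3 * t)) Y.
Proof.
  induction t as [|t IH].
  - change (srun ops f X 0) with (0, false, zeros). cbv beta iota zeta.
    exists 2, 2. repeat split; try lia. simpl Nat.iter.
    rewrite (proj1 cstart_step). unfold nxt.
    rewrite (step_iprog a (IInit f)) by reflexivity. unfold dstep; cbn. f_equal.
    + apply upd_same.
    + marks_tac.
    + exact (upd_same zeros 1).
  - rewrite srun_S. destruct (srun ops f X t) as [[j e] Y]. destruct IH as (k & h & H1 & H2 & H3 & H4).
    pose proof (round ops a f X Ha t h j e Y H2 H3) as R.
    destruct (sop_step f X (j, e, Y) (ops t)) as [[j' e'] Y'].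
    destruct R as (h' & R1 & R2 & l & R3).
    exists (S l + k), h'. replace (2 + 3 * S t) with (5 + 3 * t) by lia.
    repeat split; try lia. rewrite Nat.iter_add, H4. exact R3.
Qed.

Lemma process_proc k : exists s, state (Nat.iter (S k) (nxt iprog a) (cstart f X)) = ienc s /\
  isproc s /\ tin (Nat.iter (S k) (nxt iprog a) (cstart f X)) = X.
Proof.
  induction k as [|k (s & H1 & H2 & H3)].
  - simpl Nat.iter. rewrite (proj1 cstart_step). exists (IInit f); repeat split.
  - change (Nat.iter (S (S k)) (nxt iprog a) (cstart f X))
      with (nxt iprog a (Nat.iter (S k) (nxt iprog a) (cstart f X))).
    destruct (proc_step a s _ H1 H2) as (d & s' & D1 & D2 & D3 & D4 & D5).
    unfold nxt at 1 3. rewrite D1. exists s'; repeat split; congruence.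
Qed.

Lemma process_live k : step iprog a (Nat.iter k (nxt iprog a) (cstart f X)) <> None.
Proof.
  destruct k as [|k]; [apply cstart_step|].
  destruct (process_proc k) as (s & H1 & H2 & _).
  destruct (proc_step a s _ H1 H2) as (d & s' & D1 & _). congruence.
Qed.

Lemma process_mono k l n : k <= l -> tout (Nat.iter k (nxt iprog a) (cstart f X)) n = true ->
  tout (Nat.iter l (nxt iprog a) (cstart f X)) n = true.
Proof.
  induction 1 as [|l Hl IH]; [easy|]. intro H. specialize (IH H).
  change (Nat.iter (S l) (nxt iprog a) (cstart f X))
      with (nxt iprog a (Nat.iter l (nxt iprog a) (cstart f X))).
  destruct l as [|l]; [discriminate IH|].
  destruct (process_proc l) as (s & H1 & H2 & _).
  destruct (proc_step a s _ H1 H2) as (d & s' & D1 & _ & _ & _ & D5).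
  unfold nxt at 1. rewrite D1. now apply D5.
Qed.

Lemma process_out k n : tout (Nat.iter k (nxt iprog a) (cstart f X)) n = true ->
  exists t, snd (srun ops f X t) n = true.
Proof.
  intro H. exists k. pose proof (checkpoint k) as C.
  destruct (srun ops f X k) as [[j e] Y]. destruct C as (l & h & H1 & _ & _ & H4).
  simpl. change Y with (tout (mkConfig (ienc (IGo f e)) h X (marks j (2 + 3 * k)) Y)).
  rewrite <- H4. exact (process_mono k l n H1 H).
Qed.

Lemma process_out' t n : snd (srun ops f X t) n = true ->
  exists k, forall l, k <= l -> tout (Nat.iter l (nxt iprog a) (cstart f X)) n = true.
Proof.
  intro H. pose proof (checkpoint t) as C.
  destruct (srun ops f X t) as [[j e] Y]. destruct C as (l & h & H1 & _ & _ & H4).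
  exists l. intros m Hm. apply (process_mono l m n Hm). now rewrite H4.
Qed.

(** The simulated head leaves every position again and again, so each cell is marked cofinally often
    and the limsup of the scratch tape is all ones. This is the signal by which [ILim] recognizes
    the end of an evaluation. *)
Lemma process_marks :
  (forall n t, exists t', t <= t' /\ fst (fst (srun ops f X t')) <> n) ->
  forall n k, exists l, k < l /\ tsc (Nat.iter l (nxt iprog a) (cstart f X)) n = true.
Proof.
  intros H n k. destruct (H n (S k + n)) as [t [H1 H2]].
  pose proof (checkpoint t) as C.
  destruct (srun ops f X t) as [[j e] Y]. destruct C as (l & h & H3 & _ & _ & H4).
  exists l; split; [lia|]. rewrite H4; cbn [tsc]. unfold marks. simpl in H2.
  destruct (Nat.ltb_spec n (2 + 3 * t)), (Nat.eqb_spec n j); cbn; auto; lia.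
Qed.

End Process.

(** * Open operators and the streams of operations evaluating them *)

Definition agree (m : nat) (X X' : real) : Prop := forall i, i < m -> X' i = X i.

Definition popen (P : real -> Prop) : Prop :=
  forall X, P X -> exists m, forall X', agree m X X' -> P X'.

(** Only ones have to be forced by a finite prefix, not zeros: such an operator is enumerated from
    its argument, relative to a real listing the conditions, but need not be continuous. *)
Definition opn (G : real -> real) : Prop := forall n, popen (fun X => G X n = true).

(* One piece of the stream: with the head at [0], write at [n] if the flag is [v] and the
   first bits of [X] are [sg]. *)
Definition piece (v : bool) (sg : list bool) (n : nat) : list sop :=
  [OClear; OFirst v] ++ flat_map (fun b => [OTest b; OMove true]) sg
  ++ repeat (OMove false) (length sg - n) ++ [OWrite] ++ repeat (OMove false) n.

Lemma fold_tests f X Y sg : forall j e,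
  fold_left (sop_step f X) (flat_map (fun b => [OTest b; OMove true]) sg) (j, e, Y)
  = (j + length sg,
     e || negb (forallb (fun '(i, b) => Bool.eqb (X (j + i)) b)
                        (combine (seq 0 (length sg)) sg)), Y).
Proof.
  induction sg as [|b sg IH]; intros j e.
  - simpl. now rewrite Nat.add_0_r, orb_false_r.
  - cbn [flat_map app fold_left sop_step length]. rewrite IH. f_equal; f_equal; [lia|].
    cbn [seq combine forallb]. rewrite Nat.add_0_r.
    rewrite <- (orb_assoc e). f_equal. rewrite negb_andb. f_equal.
    + now destruct (X j), b.
    + f_equal. rewrite <- seq_shift.
      generalize (seq 0 (length sg)) as l; clear. revert j.
      induction sg as [|c sg IH]; intros j [|i l]; auto.
      cbn [map combine forallb]. rewrite IH. do 3 f_equal. lia.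
Qed.

Lemma fold_moves f X Y e n : forall j,
  fold_left (sop_step f X) (repeat (OMove false) n) (j, e, Y) = (j - n, e, Y).
Proof.
  induction n as [|n IH]; intro j; cbn [repeat fold_left].
  - now rewrite Nat.sub_0_r.
  - cbn [sop_step]. rewrite IH. now replace (Nat.pred j - n) with (j - S n) by lia.
Qed.

Definition fits (X : real) (sg : list bool) : bool :=
  forallb (fun '(i, b) => Bool.eqb (X i) b) (combine (seq 0 (length sg)) sg).

Lemma fold_piece f X Y v sg n e : n <= length sg ->
  exists e', fold_left (sop_step f X) (piece v sg n) (0, e, Y)
    = (0, e', upd Y n (Y n || (Bool.eqb f v && fits X sg))).
Proof.
  intro Hn. unfold piece. cbn [app fold_left sop_step orb].
  rewrite !fold_left_app, fold_tests, fold_moves. cbn [fold_left app sop_step].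
  rewrite fold_moves. replace (0 + length sg - (length sg - n)) with n by lia.
  eexists. f_equal; [f_equal; lia|]. f_equal. f_equal.
  rewrite negb_orb, negb_involutive. f_equal. now destruct f, v.
Qed.

Lemma fits_prefix X m : fits X (map X (seq 0 m)) = true.
Proof.
  unfold fits. apply forallb_forall. intros [i b] H.
  rewrite length_map, length_seq in H. apply eqb_true_iff.
  revert H. generalize 0. induction m as [|m IH]; intros s; cbn; [easy|].
  intros [H|H]; [congruence|eauto].
Qed.

Lemma fits_agree X X' m : fits X' (map X (seq 0 m)) = true -> agree m X X'.
Proof.
  unfold fits. rewrite forallb_forall. intros H i Hi.
  apply eqb_true_iff. apply (H (i, X i)).
  rewrite length_map, length_seq.
  assert (K : forall s, s <= i -> i < s + m -> In (i, X i) (combine (seq s m) (map X (seq s m)))).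
  { clear. induction m as [|m IH]; intros s H1 H2; [lia|]. cbn.
    destruct (Nat.eq_dec s i) as [->|]; [now left|right]. apply IH; lia. }
  apply K; lia.
Qed.

(** All triples of a flag, an output bit and a finite prefix are enumerated, and a piece is emitted
    for those whose prefix forces the bit. The selection is not effective, which does no harm as the
    stream becomes the real parameter. *)
Theorem stream_for (G : bool -> real -> real) : (forall f, opn (G f)) ->
  exists ops, forall f X,
    (forall n, G f X n = true <-> exists t, snd (srun ops f X t) n = true) /\
    (forall n t, exists t', t <= t' /\ fst (fst (srun ops f X t')) <> n).
Proof.
  intro HG.
  destruct (countable_prod _ _ (countable_prod _ _ countable_bool countable_nat)
    (countable_list _ countable_bool)) as [en Hen].
  (* After its tests the head stands at the end of the prefix and moves left to the cell to be
     written, hence [n <= length sg]; a forcing prefix can always be lengthened. *)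
  set (valid := fun (v : bool) (n : nat) sg => n <= length sg /\
    forall X, fits X sg = true -> G v X n = true).
  (* The move right and back makes the head leave cell 0 in every block, even in one without a
     piece. *)
  set (pc := fun k => let '((v, n), sg) := en k in
    [OMove true; OMove false] ++ if asb (valid v n sg) then piece v sg n else []).
  set (pref := fun k => flat_map pc (seq 0 k)).
  (* Each block is nonempty, so [pref (S t)] already has an operation number [t] and the default is
     never reached. *)
  set (ops := fun t => nth t (pref (S t)) OClear).
  assert (prefS : forall k, pref (S k) = pref k ++ pc k).
  { intro k. unfold pref. rewrite seq_S, flat_map_app. cbn. now rewrite app_nil_r. }
  assert (plen : forall k, k <= length (pref k)).
  { induction k as [|k IH]; [lia|]. rewrite prefS, length_app. unfold pc.
    destruct (en k) as [[v n] sg]. cbn. lia. }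
  assert (pext : forall k l, k <= l -> exists r, pref l = pref k ++ r).
  { induction 1 as [|l Hl [r IH]]; [exists []; now rewrite app_nil_r|].
    exists (r ++ pc l). now rewrite prefS, IH, app_assoc. }
  assert (Hops : forall k, map ops (seq 0 (length (pref k))) = pref k).
  { intro k. apply nth_ext with (d := ops 0) (d' := OClear).
    - now rewrite length_map, length_seq.
    - intros t Ht. rewrite length_map, length_seq in Ht. rewrite map_nth, seq_nth by exact Ht.
      cbn [Nat.add]. unfold ops. destruct (le_lt_dec k (S t)) as [H|H].
      + destruct (pext _ _ H) as [r ->]. now rewrite app_nth1.
      + destruct (pext (S t) k) as [r ->]; [lia|].
        rewrite app_nth1; [easy|]. specialize (plen (S t)); lia. }
  exists ops. intros f X.
  set (mt := fun k n => let '((v, n'), sg) := en k in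
    n' = n /\ v = f /\ valid v n sg /\ fits X sg = true).
  assert (Hrun : forall k, exists e Y, srun ops f X (length (pref k)) = (0, e, Y) /\
    forall n, Y n = true <-> exists k', k' < k /\ mt k' n).
  { induction k as [|k (e & Y & H1 & H2)].
    - exists false, zeros. split; [easy|]. intro n; split; [easy|]. intros [k' [H _]]; lia.
    - unfold srun in *. rewrite Hops in *. rewrite prefS, fold_left_app, H1.
      assert (K : exists e' Y', fold_left (sop_step f X) (pc k) (0, e, Y) = (0, e', Y') /\
        forall n, Y' n = true <-> Y n = true \/ mt k n).
      { unfold pc, mt. destruct (en k) as [[v n'] sg]. rewrite fold_left_app. cbn [fold_left sop_step Nat.pred].
        destruct (asb (valid v n' sg)) eqn:V.
        - apply -> asbP in V. destruct (fold_piece f X Y v sg n' e (proj1 V)) as [e' ->].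
          do 2 eexists; split; [reflexivity|]. intro n. unfold upd.
          destruct (Nat.eqb_spec n n') as [->|Hn].
          + rewrite orb_true_iff, andb_true_iff, eqb_true_iff. intuition.
          + intuition congruence.
        - apply -> asbF in V. do 2 eexists; split; [reflexivity|]. intro n; split; [tauto|].
          intros [H|(-> & -> & H & _)]; tauto. }
      destruct K as (e' & Y' & K1 & K2). exists e', Y'; split; [exact K1|].
      intro n. rewrite K2, H2. split.
      + intros [[k' [H3 H4]]|H3]; [exists k'|exists k]; split; auto; lia.
      + intros [k' [H3 H4]]. destruct (Nat.eq_dec k' k) as [->|]; [tauto|].
        left; exists k'; split; auto; lia. }
  assert (Hmono : forall n t t', t <= t' -> snd (srun ops f X t) n = true ->
    snd (srun ops f X t') n = true).
  { intros n t t'; induction 1 as [|t' Ht IH]; [easy|]. intro H. specialize (IH H).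
    rewrite srun_S. destruct (srun ops f X t') as [[j e] Y]. destruct (ops t'); cbn in *; auto.
    apply upd_true; [|exact IH]. intros ->; reflexivity. }
  split.
  - intro n. split.
    + intro H. destruct (HG f n X H) as [m Hm].
      set (sg := map X (seq 0 (m + n))).
      destruct (Hen ((f, n), sg)) as [k Hk].
      destruct (Hrun (S k)) as (e & Y & H1 & H2). exists (length (pref (S k))).
      rewrite H1. apply H2. exists k; split; [lia|]. unfold mt. rewrite Hk.
      assert (Hsg : length sg = m + n) by (unfold sg; now rewrite length_map, length_seq).
      repeat split; [lia| |apply fits_prefix].
      intros X' HX'. apply Hm. intros i Hi. apply (fits_agree _ _ _ HX'). lia.
    + intros [t Ht]. apply (Hmono n t (length (pref t)) (plen t)) in Ht.
      destruct (Hrun t) as (e & Y & H1 & H2). rewrite H1 in Ht. apply H2 in Ht as [k [_ Hk]].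
      unfold mt in Hk. destruct (en k) as [[v n'] sg]. destruct Hk as (-> & -> & [_ V] & F).
      now apply V.
  - intros n t. destruct (Hrun t) as (e & Y & H1 & _).
    destruct (Nat.eq_dec n 0) as [->|Hn].
    + exists (S (length (pref t))). split; [specialize (plen t); lia|].
      rewrite srun_S, H1.
      assert (E : ops (length (pref t)) = OMove true).
      { assert (E : nth (length (pref t)) (pref (S t)) OClear = OMove true).
        { rewrite prefS, app_nth2, Nat.sub_diag by lia. unfold pc.
          now destruct (en t) as [[v n] sg]. }
        rewrite <- (Hops (S t)) in E. rewrite (nth_indep _ _ (ops 0)) in E.
        - rewrite map_nth, seq_nth in E; [exact E|]. rewrite prefS, length_app.
          unfold pc. destruct (en t) as [[v n] sg]. cbn; lia.
        - rewrite length_map, length_seq, prefS, length_app.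
          unfold pc. destruct (en t) as [[v n] sg]. cbn; lia. }
      rewrite E. cbn. lia.
    + exists (length (pref t)). split; [apply plen|]. rewrite H1. cbn. congruence.
Qed.

Lemma oracle_for (ops : nat -> sop) : exists a : real,
  forall t, (a (2 + 3 * t), a (3 + 3 * t), a (4 + 3 * t)) = sop_bits (ops t).
Proof.
  exists (fun n => let '(b, b', b'') := sop_bits (ops ((n - 2) / 3)) in
    match (n - 2) mod 3 with 0 => b | 1 => b' | _ => b'' end).
  intro t.
  assert (E0 : forall r, r < 3 -> (2 + r + 3 * t - 2) / 3 = t /\ (2 + r + 3 * t - 2) mod 3 = r).
  { intros r Hr. replace (2 + r + 3 * t - 2) with (r + t * 3) by lia.
    rewrite Nat.div_add, Nat.Div0.mod_add, Nat.div_small, Nat.mod_small by lia. lia. }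
  destruct (E0 0) as [A0 B0], (E0 1) as [A1 B1], (E0 2) as [A2 B2]; try lia.
  cbn [Nat.add] in *. rewrite A0, B0, A1, B1, A2, B2.
  now destruct (sop_bits (ops t)) as [[b b'] b''].
Qed.

(** * Halting iterations and their execution by the machine *)

Definition halts (G : real -> real) (s Z : real) : Prop :=
  exists tr i, tr ozero = s /\ rtraj G tr /\ tr i = Z /\ Z 0 = false /\
    forall j, olt j i -> tr j 0 = true.

Definition cobs (c : config) : real := fun n =>
  match n mod 3 with 0 => tin c (n / 3) | 1 => tsc c (n / 3) | _ => tout c (n / 3) end.

Definition clim (o : real) : config :=
  mkConfig limit_state 0 (fun n => o (n * 3)) (fun n => o (1 + n * 3)) (fun n => o (2 + n * 3)).

(** When an evaluation is complete, the scratch tape is all ones, the output tape carries the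
    simulated state, and the input tape is unconstrained. *)
Definition ccls (n : nat) : kind :=
  match n mod 3 with 0 => KFree | 1 => KOn | _ => KReg (n / 3) end.

Lemma divmod3 r n : r < 3 -> (r + n * 3) mod 3 = r /\ (r + n * 3) / 3 = n.
Proof.
  intro H. rewrite Nat.div_add, Nat.Div0.mod_add, Nat.div_small, Nat.mod_small by lia. lia.
Qed.

Lemma cobs_in c n : cobs c (n * 3) = tin c n.
Proof. unfold cobs. change (n * 3) with (0 + n * 3). now rewrite (proj1 (divmod3 0 n ltac:(lia))), (proj2 (divmod3 0 n ltac:(lia))). Qed.

Lemma cobs_sc c n : cobs c (1 + n * 3) = tsc c n.
Proof. unfold cobs. now rewrite (proj1 (divmod3 1 n ltac:(lia))), (proj2 (divmod3 1 n ltac:(lia))). Qed.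

Lemma cobs_out c n : cobs c (2 + n * 3) = tout c n.
Proof. unfold cobs. now rewrite (proj1 (divmod3 2 n ltac:(lia))), (proj2 (divmod3 2 n ltac:(lia))). Qed.

Definition at_check (b : real) (c : config) : Prop :=
  state c = ienc ILim /\ head c = 0 /\ (forall n, tsc c n = true) /\ tout c = b.

Section Machine.

Context (G : bool -> real -> real) (ops : nat -> sop) (a : real).
Hypothesis Hops : forall f X,
    (forall n, G f X n = true <-> exists t, snd (srun ops f X t) n = true) /\
    (forall n t, exists t', t <= t' /\ fst (fst (srun ops f X t')) <> n).
Hypothesis Ha : forall t, (a (2 + 3 * t), a (3 + 3 * t), a (4 + 3 * t)) = sop_bits (ops t).

Context (tr : Om -> config).
Hypothesis Htr : traj (nxt iprog a) cobs clim tr.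

Definition live (c : config) : Prop := step iprog a c <> None.

Lemma tr_omega t : tr (oomega t) = clim (limsup cobs tr (oomega t)).
Proof. apply Htr, olim_omega. Qed.

Lemma limsup_omega t n : limsup cobs tr (oomega t) n = true <->
  forall k, exists l, k < l /\ cobs (Nat.iter l (nxt iprog a) (tr t)) n = true.
Proof.
  unfold limsup. rewrite asbP, cofinal_omega.
  split; intros H k; destruct (H k) as [l Hl]; exists l;
    rewrite (traj_oplus _ _ _ _ Htr) in *; exact Hl.
Qed.

Lemma process_omega t f X : tr t = cstart f X ->
  at_check (G f X) (tr (oomega t)) /\
  forall u, ole t u -> olt u (oomega t) ->
    live (tr u) /\ forall n, tout (tr u) n = true -> G f X n = true.
Proof.
  intro Ht. destruct (Hops f X) as [Hout Hmv]. split.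
  - rewrite tr_omega. repeat split; cbn.
    + intro n. apply limsup_omega. intro k. rewrite Ht.
      destruct (process_marks ops a f X Ha Hmv n k) as [l [Hl1 Hl2]].
      exists l; split; [exact Hl1|]. exact (eq_trans (cobs_sc _ n) Hl2).
    + apply real_ext; intro n. apply bool_ext. etransitivity; [apply limsup_omega|].
      rewrite Ht, Hout. split.
      * intro H. destruct (H 0) as [l [_ Hl]].
        apply (process_out ops a f X Ha l). now rewrite <- cobs_out.
      * intros [t' H] k. destruct (process_out' ops a f X Ha t' n H) as [l Hl].
        exists (S (k + l)); split; [lia|]. refine (eq_trans (cobs_out _ n) _). apply Hl; lia.
  - intros u H1 H2. destruct (olt_omega t u H1 H2) as [k ->].
    rewrite (traj_oplus _ _ _ _ Htr), Ht. split.
    + apply process_live.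
    + intros n Hn. apply Hout. now apply (process_out ops a f X Ha k).
Qed.

Definition sweeping (b X : real) (k : nat) : config :=
  mkConfig (ienc ISweep) k (fun n => if Nat.ltb n k then b n else X n)
    (fun n => negb (Nat.ltb n k)) (fun n => negb (Nat.ltb n k) && b n).

Lemma sweep_run b c k : at_check b c -> b 0 = true ->
  Nat.iter (S k) (nxt iprog a) c = sweeping b (tin c) (S k).
Proof.
  intros (H1 & H2 & H3 & H4) Hb. induction k as [|k IH].
  - simpl Nat.iter. unfold nxt. rewrite (step_iprog a ILim c H1). unfold dstep.
    rewrite H2, H3, H4. cbn. rewrite Hb. cbn. unfold sweeping. f_equal.
    + apply real_ext; intro n; unfold upd; destruct n; cbn; congruence.
    + apply real_ext; intro n; unfold upd; destruct n; cbn; [easy|apply H3].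
    + apply real_ext; intro n; unfold upd; destruct n; easy.
  - change (nxt iprog a (Nat.iter (S k) (nxt iprog a) c) = sweeping b (tin c) (S (S k))).
    rewrite IH. unfold nxt. rewrite (step_iprog a ISweep) by reflexivity.
    unfold dstep; cbn [idelta head tin tsc tout sweeping]. unfold sweeping.
    assert (L : Nat.ltb (S k) (S k) = false) by apply Nat.ltb_irrefl. rewrite L. cbn [negb andb].
    f_equal; apply real_ext; intro n; unfold upd;
      destruct (Nat.eqb_spec n (S k)), (Nat.ltb_spec n (S k)), (Nat.ltb_spec n (S (S k)));
      cbn; subst; try lia; reflexivity.
Qed.

Lemma sweep_live b c k : at_check b c -> b 0 = true -> live (Nat.iter k (nxt iprog a) c).
Proof.
  intros Hc Hb. destruct k as [|k].
  - destruct Hc as (H1 & H2 & H3 & H4). unfold live. simpl Nat.iter.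
    rewrite (step_iprog a ILim c H1). unfold dstep. rewrite H2, H3, H4. cbn. now rewrite Hb.
  - rewrite (sweep_run b c k Hc Hb). unfold live.
    now rewrite (step_iprog a ISweep) by reflexivity.
Qed.

Lemma sweep_omega t b : at_check b (tr t) -> b 0 = true ->
  tr (oomega t) = cstart false b /\
  forall u, ole t u -> olt u (oomega t) ->
    live (tr u) /\ forall n, tout (tr u) n = true -> b n = true.
Proof.
  intros Hc Hb. split.
  - rewrite tr_omega. unfold clim, cstart. f_equal; apply real_ext; intro n; apply bool_ext;
      (etransitivity; [apply limsup_omega|]).
    + split.
      * intro H. destruct (H (S n)) as [l [Hl1 Hl2]]. destruct l as [|l]; [lia|].
        rewrite (sweep_run b _ l Hc Hb), cobs_in in Hl2. cbn [tin sweeping] in Hl2.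
        destruct (Nat.ltb_spec n (S l)); [exact Hl2|lia].
      * intros H k. exists (S (k + n)); split; [lia|].
        rewrite (sweep_run b _ _ Hc Hb), cobs_in. cbn [tin sweeping].
        destruct (Nat.ltb_spec n (S (k + n))); [exact H|lia].
    + split; [|easy]. intro H. destruct (H (S n)) as [l [Hl1 Hl2]]. destruct l as [|l]; [lia|].
      rewrite (sweep_run b _ l Hc Hb), cobs_sc in Hl2. cbn [tsc sweeping] in Hl2.
      destruct (Nat.ltb_spec n (S l)); [easy|lia].
    + split; [|easy]. intro H. destruct (H (S n)) as [l [Hl1 Hl2]]. destruct l as [|l]; [lia|].
      rewrite (sweep_run b _ l Hc Hb), cobs_out in Hl2. cbn [tout sweeping] in Hl2.
      destruct (Nat.ltb_spec n (S l)); [easy|lia].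
  - intros u H1 H2. destruct (olt_omega t u H1 H2) as [k ->].
    rewrite (traj_oplus _ _ _ _ Htr). split; [now apply (sweep_live b)|].
    destruct k as [|k]; intro n.
    + simpl. destruct Hc as (_ & _ & _ & ->); auto.
    + rewrite (sweep_run b _ k Hc Hb). cbn [tout sweeping]. now intros H%andb_true_iff.
Qed.

(** One simulated step costs a sweep and an evaluation, [omega] steps each. During the sweep the
    output tape lies below the old state, during the evaluation below the new one, as [simulation]
    demands. A limit of simulated stages looks like the end of an evaluation, so [ILim] treats it
    correctly. *)
Lemma machine_simulates (trB : Om -> real) x i :
  tr ozero = init_config x -> rtraj (G false) trB -> trB ozero = G true x ->
  (forall j, olt j i -> trB j 0 = true) ->
  exists t, at_check (trB i) (tr t) /\ forall u, olt u t -> live (tr u).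
Proof.
  intros H0 HB HB0 Hlive.
  destruct (process_omega ozero true x H0) as [P1 P2].
  destruct (simulation (nxt iprog a) cobs clim tr Htr (G false) trB HB at_check ccls live)
    with (s0 := oomega ozero) (i := i) as (t & T1 & T2 & T3).
  - intros b c (_ & _ & Hs & Ho) k. unfold ccls, cobs.
    destruct (k mod 3) as [|[|r]]; [exact I|apply Hs|]. now rewrite Ho.
  - intros b t Hb Hc. destruct (sweep_omega t b Hc Hb) as [S1 S2].
    destruct (process_omega _ _ _ S1) as [Q1 Q2].
    exists (oomega (oomega t)). split; [|split; [exact Q1|]].
    + eapply olt_trans; [exact (oplus_lt_omega t 0)|exact (oplus_lt_omega _ 0)].
    + intros u U1 U2. unfold seg_ok, ccls, cobs.
      assert (K : live (tr u) /\ forall n, tout (tr u) n = true -> b n = true \/ G false b n = true).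
      { destruct (ole_or_lt (oomega t) u) as [U|U].
        - destruct (Q2 u U U2) as [Q3 Q4]; auto.
        - destruct (S2 u U1 U) as [Q3 Q4]; auto. }
      destruct K as [K1 K2]. split; [exact K1|]. intro k.
      destruct (k mod 3) as [|[|r]]; auto.
  - intros b o Ho. repeat split; cbn.
    + intro n. specialize (Ho (1 + n * 3)). unfold ccls in Ho.
      now rewrite (proj1 (divmod3 1 n ltac:(lia))) in Ho.
    + apply real_ext; intro n. specialize (Ho (2 + n * 3)). unfold ccls in Ho.
      now rewrite (proj1 (divmod3 2 n ltac:(lia))), (proj2 (divmod3 2 n ltac:(lia))) in Ho.
  - now rewrite HB0.
  - exact Hlive.
  - exists t; split; [exact T2|]. intros u Hu.
    destruct (ole_or_lt (oomega ozero) u) as [U|U].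
    + now apply T3.
    + apply (P2 u (ozero_le u) U).
Qed.

End Machine.

(** The run is the trajectory restricted to the stages up to [top]; that set is downward closed, so
    successors, limits and cofinality mean the same in it as in [Om]. *)
Lemma trajectory_halts p a x y (tr : Om -> config) (top : Om) :
  traj (nxt p a) cobs clim tr -> tr ozero = init_config x ->
  (forall u, olt u top -> step p a (tr u) <> None) -> step p a (tr top) = None ->
  (forall n, tout (tr top) n = y n) -> ittm_halts p a x y.
Proof.
  intros Htr H0 Hlive Hhalt Hy.
  set (T := {t : Om | ole t top}).
  set (lt := fun s t : T => olt (proj1_sig s) (proj1_sig t)).
  assert (Text : forall s t : T, proj1_sig s = proj1_sig t -> s = t).
  { intros [s Hs] [t Ht]; cbn; intros ->. f_equal; apply proof_irrelevance. }
  assert (Hsucc : forall s t : T, is_succ lt s t -> is_succ olt (proj1_sig s) (proj1_sig t)).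
  { intros s t [H1 H2]. split; [exact H1|]. intros [u [U1 U2]]. apply H2.
    assert (Hu : ole u top) by (right; eapply olt_le_trans; [exact U2|apply (proj2_sig t)]).
    exists (exist _ u Hu); split; assumption. }
  assert (Hlimit : forall t : T, is_limit lt t -> olim (proj1_sig t)).
  { intros t [[s Hs] H2]. split; [exists (proj1_sig s); exact Hs|]. intros [u Hu].
    apply H2. assert (Hu' : ole u top).
    { right; eapply olt_le_trans; [exact (proj1 Hu)|apply (proj2_sig t)]. }
    exists (exist _ u Hu'). split; [exact (proj1 Hu)|]. intros [v [V1 V2]].
    apply (proj2 Hu). exists (proj1_sig v); split; assumption. }
  exists T, lt, (fun t => tr (proj1_sig t)), (exist (fun t => ole t top) top (ole_refl top)).
  split; [|split; [|split; [|split; [|split; [|split; [|split; [|split]]]]]]].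
  - exact (Inverse_Image.wf_inverse_image T Om olt (fun t => proj1_sig t) olt_wf).
  - intros s t u; apply olt_trans.
  - intros s t. destruct (olt_total (proj1_sig s) (proj1_sig t)) as [H|[H|H]]; auto.
  - intros [t [->|Ht]]; [left; now apply Text|right; exact Ht].
  - intros [t Ht] Hmin. assert (E : t = ozero).
    { destruct (ozero_le t) as [E|E]; [easy|]. exfalso.
      assert (Hz : ole ozero top) by apply ozero_le.
      exact (Hmin (exist _ ozero Hz) E). }
    subst t; cbn. rewrite H0. repeat split.
  - intros s t Hst. apply Hsucc in Hst. pose proof (is_succ_eq _ _ Hst) as E.
    assert (L : step p a (tr (proj1_sig s)) <> None).
    { apply Hlive. eapply olt_le_trans; [exact (proj1 Hst)|apply (proj2_sig t)]. }
    rewrite E, (proj1 Htr). unfold nxt.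
    destruct (step p a (tr (proj1_sig s))) as [d|]; [|easy].
    exists d; split; [easy|]. repeat split.
  - intros t Ht. apply Hlimit in Ht. unfold limit_cond; cbv beta. rewrite (proj2 Htr _ Ht).
    assert (K : forall P : Om -> Prop, cofinal olt (proj1_sig t) P <->
      cofinal lt t (fun u => P (proj1_sig u))).
    { intro P. split.
      - intros H s Hs. destruct (H _ Hs) as [u (U1 & U2 & U3)].
        assert (Hu : ole u top) by (right; eapply olt_le_trans; [exact U2|apply (proj2_sig t)]).
        exists (exist _ u Hu); repeat split; assumption.
      - intros H s Hs.
        assert (Hs' : ole s top) by (right; eapply olt_le_trans; [exact Hs|apply (proj2_sig t)]).
        destruct (H (exist _ s Hs') Hs) as [u (U1 & U2 & U3)].
        exists (proj1_sig u); repeat split; assumption. }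
    split; [reflexivity|split; [reflexivity|]].
    split; [|split]; intro n; cbn; unfold limsup; rewrite asbP;
      rewrite K; unfold cofinal; [setoid_rewrite cobs_in|setoid_rewrite cobs_sc|setoid_rewrite cobs_out];
      reflexivity.
  - exact Hhalt.
  - exact Hy.
Qed.

(** The flag of the machine is on exactly before the first limit stage, so one stream can evaluate
    [G0] on the input and [G] in all later rounds. *)
Theorem halts_ittm (G0 G : real -> real) : opn G0 -> opn G ->
  exists p a, forall x Z, halts G (G0 x) Z -> ittm_halts p a x Z.
Proof.
  intros HG0 HG. set (GG := fun f : bool => if f then G0 else G).
  destruct (stream_for GG) as [ops Hops]; [now intros []|].
  destruct (oracle_for ops) as [a Ha]. exists iprog, a.
  intros x Z (trB & i & B1 & B2 & B3 & B4 & B5).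
  destruct (traj_ex (nxt iprog a) cobs clim (init_config x)) as [tr [T1 T2]].
  destruct (machine_simulates GG ops a Hops Ha tr T2 trB x i T1 B2 B1 B5) as (t & E & L).
  rewrite B3 in E. destruct E as (E1 & E2 & E3 & E4).
  apply (trajectory_halts iprog a x Z tr t); auto.
  - rewrite (step_iprog a ILim) by exact E1. unfold dstep. now rewrite E2, E3, E4, B4.
  - intro n; now rewrite E4.
Qed.

(** * Open operators and computable functions on reals *)

Lemma agree_le m m' X X' : m <= m' -> agree m' X X' -> agree m X X'.
Proof. intros H H' i Hi. apply H'. lia. Qed.

Lemma popen_const (P : Prop) : popen (fun _ => P).
Proof. intros X HP. now exists 0. Qed.

Lemma popen_bit k b : popen (fun X => X k = b).
Proof. intros X HX. exists (S k). intros X' H. rewrite (H k); [exact HX|lia]. Qed.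

Lemma popen_and P Q : popen P -> popen Q -> popen (fun X => P X /\ Q X).
Proof.
  intros HP HQ X [H1 H2]. destruct (HP X H1) as [m Hm], (HQ X H2) as [l Hl].
  exists (m + l). intros X' H; split; [apply Hm|apply Hl];
    (eapply agree_le; [|exact H]; lia).
Qed.

Lemma popen_or P Q : popen P -> popen Q -> popen (fun X => P X \/ Q X).
Proof.
  intros HP HQ X [H|H]; [destruct (HP X H) as [m Hm]|destruct (HQ X H) as [m Hm]];
    exists m; auto.
Qed.

Lemma popen_ex {A : Type} (P : A -> real -> Prop) :
  (forall a, popen (P a)) -> popen (fun X => exists a, P a X).
Proof. intros HP X [a Ha]. destruct (HP a X Ha) as [m Hm]. exists m; eauto. Qed.

Lemma popen_ext (P Q : real -> Prop) : (forall X, P X <-> Q X) -> popen P -> popen Q.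
Proof.
  intros H HP X HX. apply H in HX. destruct (HP X HX) as [m Hm]. exists m.
  intros X' HX'. apply H; auto.
Qed.

Lemma popen_reindex (h : nat -> nat) P : popen P -> popen (fun X => P (fun n => X (h n))).
Proof.
  intros HP X HX. destruct (HP _ HX) as [m Hm].
  assert (K : exists M, forall i, i < m -> h i < M).
  { clear. induction m as [|m [M IH]]; [exists 0; lia|]. exists (S (M + h m)).
    intros i Hi. destruct (Nat.eq_dec i m) as [->|]; [lia|].
    specialize (IH i ltac:(lia)); lia. }
  destruct K as [M HM]. exists M. intros X' H. apply Hm. intros i Hi. apply H, HM, Hi.
Qed.

Definition rcons (b : bool) (x : real) : real :=
  fun n => match n with 0 => b | S n => x n end.
Definition rtl (x : real) : real := fun n => x (S n).
Definition rjn (x y : real) : real :=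
  fun n => if Nat.even n then x (Nat.div2 n) else y (Nat.div2 n).
Definition rev (x : real) : real := fun n => x (2 * n).
Definition rod (x : real) : real := fun n => x (S (2 * n)).

Lemma rev_jn x y : rev (rjn x y) = x.
Proof.
  apply real_ext; intro n. unfold rev, rjn.
  now rewrite Nat.even_mul, Nat.div2_double.
Qed.

Lemma rod_jn x y : rod (rjn x y) = y.
Proof.
  apply real_ext; intro n. unfold rod, rjn.
  rewrite Nat.even_succ, Nat.odd_mul, Nat.div2_succ_double. easy.
Qed.

Lemma rtl_cons b x : rtl (rcons b x) = x.
Proof. reflexivity. Qed.

Lemma opn_if k A B : opn A -> opn B -> opn (fun X => if X k then A X else B X).
Proof.
  intros HA HB n. apply popen_ext with
    (P := fun X => (X k = true /\ A X n = true) \/ (X k = false /\ B X n = true)).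
  - intro X; destruct (X k); intuition congruence.
  - apply popen_or; apply popen_and; auto using popen_bit.
Qed.

Lemma opn_cons b A : opn A -> opn (fun X => rcons b (A X)).
Proof. intros HA [|n]; [exact (popen_const (b = true))|apply HA]. Qed.

Lemma opn_jn A B : opn A -> opn B -> opn (fun X => rjn (A X) (B X)).
Proof. intros HA HB n. unfold rjn. destruct (Nat.even n); [apply HA|apply HB]. Qed.

Lemma opn_sub (h : nat -> nat) A : opn A -> opn (fun X => A (fun n => X (h n))).
Proof. intros HA n. exact (popen_reindex h _ (HA n)). Qed.

Lemma opn_id : opn (fun X => X).
Proof. intro n; apply popen_bit. Qed.

Lemma opn_const x : opn (fun _ => x).
Proof. intro n; exact (popen_const (x n = true)). Qed.

Lemma opn_tl A : opn A -> opn (fun X => A (rtl X)).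
Proof. apply (opn_sub S). Qed.

Lemma opn_ev A : opn A -> opn (fun X => A (rev X)).
Proof. apply (opn_sub (fun n => 2 * n)). Qed.

Lemma opn_od A : opn A -> opn (fun X => A (rod X)).
Proof. apply (opn_sub (fun n => S (2 * n))). Qed.

(** Bit 0 of a state is the running flag and the remaining bits are data, whence [rtl]. Halting is
    required on every real, so such functions compose without domain conditions. *)
Definition comp (F : real -> real) : Prop :=
  exists G0 G, opn G0 /\ opn G /\
    forall x, exists Z, halts G (G0 x) Z /\ F x = rtl Z.

(** The case of [simulation] in which one step simulates one step and states are embedded exactly.
    An embedding made of constant bits and copies of simulated bits commutes with limsup. *)
Lemma lockstep (G G1 : real -> real) (emb : real -> real) (cls : nat -> kind) tr s0 w0 Z :
  (forall w k, match cls k with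
    | KOn => emb w k = true | KOff => emb w k = false
    | KReg n => emb w k = w n | KFree => False end) ->
  (forall w, w 0 = true -> G (emb w) = emb (G1 w)) ->
  rtraj G tr -> tr s0 = emb w0 -> halts G1 w0 Z ->
  exists t, ole s0 t /\ tr t = emb Z /\ forall u, ole s0 u -> olt u t -> exists w, tr u = emb w.
Proof.
  intros Hemb HG Htr H0 (trB & i & B1 & B2 & B3 & B4 & B5).
  destruct (simulation G (fun x => x) (fun x => x) tr Htr G1 trB B2 (fun w s => s = emb w) cls
    (fun s => exists w, s = emb w)) with (s0 := s0) (i := i) as (t & T1 & T2 & T3).
  - intros b s -> k. specialize (Hemb b k). destruct (cls k); auto. now rewrite Hemb.
  - intros b t Hb Ht. exists (osucc t). split; [apply olt_succ|]. split.
    + now rewrite (proj1 Htr), Ht, HG.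
    + intros u U1 U2. apply olt_succ_le in U2. rewrite <- (ole_antisym _ _ U1 U2), Ht.
      split; [eauto|]. intro k. specialize (Hemb b k). destruct (cls k); auto. rewrite Hemb; auto.
  - intros b o Ho. apply real_ext; intro k. specialize (Ho k). specialize (Hemb b k).
    destruct (cls k); congruence || easy.
  - now rewrite B1.
  - exact B5.
  - exists t; repeat split; [exact T1|congruence|exact T3].
Qed.

Lemma comp_opn G : opn G -> comp G.
Proof.
  intro HG. exists (fun x => rcons false (G x)), (fun x => x).
  split; [now apply opn_cons|split; [apply opn_id|]].
  intro x. exists (rcons false (G x)); split; [|easy].
  destruct (traj_ex (fun x => x) (fun x => x) (fun x => x) (rcons false (G x))) as [tr [T1 T2]].
  exists tr, ozero. repeat split; auto; try apply T2. intros j Hj; now apply olt_zero in Hj.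
Qed.

Lemma comp_ext F F' : (forall x n, F x n = F' x n) -> comp F -> comp F'.
Proof.
  intros H HF. replace F' with F; [exact HF|].
  apply functional_extensionality; intro x; apply real_ext, H.
Qed.

Definition ocons2 (a b : bool) (k : nat) : kind :=
  match k with 0 => if a then KOn else KOff | 1 => if b then KOn else KOff
             | S (S n) => KReg n end.

Lemma ocons2_emb a b w k : match ocons2 a b k with
    | KOn => rcons a (rcons b w) k = true | KOff => rcons a (rcons b w) k = false
    | KReg n => rcons a (rcons b w) k = w n | KFree => False end.
Proof. destruct k as [|[|k]]; cbn; [destruct a|destruct b|]; reflexivity. Qed.

Theorem comp_comp F F' : comp F -> comp F' -> comp (fun x => F' (F x)).
Proof.
  intros (A0 & A & HA0 & HA & HF) (B0 & B & HB0 & HB & HF').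
  (* Bit 0 is the running flag, bit 1 the phase, and bit 2 the running flag of the embedded
     iteration. The phase is constant within each phase and hence survives its limits. *)
  set (G := fun X : real => if X 1
    then (if X 2 then rcons true (rcons true (B (rtl (rtl X)))) else rcons false (rtl (rtl (rtl X))))
    else (if X 2 then rcons true (rcons false (A (rtl (rtl X))))
          else rcons true (rcons true (B0 (rtl (rtl (rtl X))))))).
  exists (fun x => rcons true (rcons false (A0 x))), G.
  split; [now repeat apply opn_cons|]. split.
  { unfold G. apply opn_if; apply opn_if; repeat apply opn_cons.
    - exact (opn_tl _ (opn_tl _ HB)).
    - exact (opn_tl _ (opn_tl _ (opn_tl _ opn_id))).
    - exact (opn_tl _ (opn_tl _ HA)).
    - exact (opn_tl _ (opn_tl _ (opn_tl _ HB0))). }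
  intro x. destruct (HF x) as (Z1 & HZ1 & E1). destruct (HF' (F x)) as (Z2 & HZ2 & E2).
  destruct (traj_ex G (fun x => x) (fun x => x) (rcons true (rcons false (A0 x)))) as [tr [T0 T]].
  pose proof HZ1 as (_ & _ & _ & _ & _ & Z10 & _). pose proof HZ2 as (_ & _ & _ & _ & _ & Z20 & _).
  destruct (lockstep G A (fun w => rcons true (rcons false w)) (ocons2 true false) tr ozero (A0 x) Z1)
    as (t1 & _ & L2 & L3); auto.
  { apply ocons2_emb. }
  { intros w Hw. unfold G; cbn. now rewrite Hw. }
  assert (N1 : tr (osucc t1) = rcons true (rcons true (B0 (F x)))).
  { rewrite (proj1 T), L2. unfold G; cbn. now rewrite Z10, E1. }
  destruct (lockstep G B (fun w => rcons true (rcons true w)) (ocons2 true true) tr (osucc t1) (B0 (F x)) Z2)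
    as (t2 & M1 & M2 & M3); auto.
  { apply ocons2_emb. }
  { intros w Hw. unfold G; cbn. now rewrite Hw. }
  assert (N2 : tr (osucc t2) = rcons false (rtl Z2)).
  { rewrite (proj1 T), M2. unfold G; cbn. now rewrite Z20. }
  exists (rcons false (rtl Z2)); split; [|exact E2].
  exists tr, (osucc t2). split; [exact T0|]. split; [exact T|]. split; [exact N2|].
  split; [reflexivity|]. intros j Hj. apply olt_succ_le in Hj.
  destruct Hj as [->|Hj]; [now rewrite M2|].
  destruct (ole_or_lt (osucc t1) j) as [H|H].
  - destruct (M3 j H Hj) as [w ->]; reflexivity.
  - apply olt_succ_le in H as [->|H]; [now rewrite L2|].
    destruct (L3 j (ozero_le j) H) as [w ->]; reflexivity.
Qed.

(** The saved real does not change during the simulated run, so each of its bits is a constant of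
    the embedding. *)
Definition keepcls (a : list bool) (x : real) (k : nat) : kind :=
  if Nat.ltb k (length a) then (if nth k a false then KOn else KOff)
  else if Nat.even (k - length a) then (if x (Nat.div2 (k - length a)) then KOn else KOff)
  else KReg (Nat.div2 (k - length a)).

Lemma keepcls_emb a x w k : match keepcls a x k with
    | KOn => fold_right rcons (rjn x w) a k = true
    | KOff => fold_right rcons (rjn x w) a k = false
    | KReg n => fold_right rcons (rjn x w) a k = w n | KFree => False end.
Proof.
  revert k; induction a as [|b a IH]; intro k.
  - unfold keepcls; cbn [length fold_right Nat.ltb Nat.leb]. rewrite Nat.sub_0_r. unfold rjn.
    cbn. destruct (Nat.even k); [destruct (x _)|]; reflexivity.
  - destruct k as [|k]; [cbn; now destruct b|]. exact (IH k).
Qed.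

(** This is what allows several functions to be evaluated on the same argument. *)
Theorem comp_keep F : comp F -> comp (fun x => rjn x (F x)).
Proof.
  intros (A0 & A & HA0 & HA & HF).
  set (G := fun X : real => if X 2 then rcons true (rjn (rev (rtl X)) (A (rod (rtl X))))
    else rcons false (rjn (rev (rtl X)) (rtl (rod (rtl X))))).
  exists (fun x => rcons true (rjn x (A0 x))), G.
  split; [apply opn_cons, opn_jn; [apply opn_id|exact HA0]|]. split.
  { unfold G. apply opn_if; apply opn_cons, opn_jn.
    - exact (opn_tl _ (opn_ev _ opn_id)).
    - exact (opn_tl _ (opn_od _ HA)).
    - exact (opn_tl _ (opn_ev _ opn_id)).
    - exact (opn_tl _ (opn_od _ (opn_tl _ opn_id))). }
  intro x. destruct (HF x) as (Z1 & HZ1 & E1).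
  destruct (traj_ex G (fun x => x) (fun x => x) (rcons true (rjn x (A0 x)))) as [tr [T0 T]].
  pose proof HZ1 as (_ & _ & _ & _ & _ & Z10 & _).
  assert (K2 : forall b x w, rcons b (rjn x w) 2 = w 0) by reflexivity.
  destruct (lockstep G A (fun w => rcons true (rjn x w)) (keepcls [true] x) tr ozero (A0 x) Z1)
    as (t1 & _ & L2 & L3); auto.
  { intros w k. exact (keepcls_emb [true] x w k). }
  { intros w Hw. unfold G. now rewrite K2, Hw, rtl_cons, rev_jn, rod_jn. }
  exists (rcons false (rjn x (F x))); split; [|easy].
  exists tr, (osucc t1). split; [exact T0|]. split; [exact T|]. split.
  { rewrite (proj1 T), L2. unfold G. now rewrite K2, Z10, rtl_cons, rev_jn, rod_jn, E1. }
  split; [reflexivity|]. intros j Hj. apply olt_succ_le in Hj.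
  destruct Hj as [->|Hj]; [now rewrite L2|].
  destruct (L3 j (ozero_le j) Hj) as [w ->]; reflexivity.
Qed.

Theorem comp_while B I F : comp B -> opn I ->
  (forall x, exists Z, halts B (I x) Z /\ F x = rtl Z) -> comp F.
Proof.
  intros (A0 & A & HA0 & HA & HB) HI HF.
  set (zs := zeros).
  set (G := fun X : real => if X 1
    then (if X 2 then rcons true (rcons false (rjn (rev (rtl (rtl X))) (A0 (rev (rtl (rtl X))))))
          else rcons false (rtl (rev (rtl (rtl X)))))
    else (if X 3 then rcons true (rcons false (rjn (rev (rtl (rtl X))) (A (rod (rtl (rtl X))))))
          else rcons true (rcons true (rjn (rtl (rod (rtl (rtl X)))) zs)))).
  exists (fun x => rcons true (rcons true (rjn (I x) zs))), G.
  split; [repeat apply opn_cons; apply opn_jn; [exact HI|apply opn_const]|]. split.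
  { pose proof (fun A H => opn_tl _ (opn_tl _ (opn_ev A H))) as He.
    pose proof (fun A H => opn_tl _ (opn_tl _ (opn_od A H))) as Ho.
    unfold G. apply opn_if; apply opn_if; repeat apply opn_cons; try apply opn_jn.
    - exact (He _ opn_id).
    - exact (He _ HA0).
    - exact (He _ (opn_tl _ opn_id)).
    - exact (He _ opn_id).
    - exact (Ho _ HA).
    - exact (Ho _ (opn_tl _ opn_id)).
    - apply opn_const. }
  assert (K2 : forall a b x w, rcons a (rcons b (rjn x w)) 2 = x 0) by reflexivity.
  assert (K3 : forall a b x w, rcons a (rcons b (rjn x w)) 3 = w 0) by reflexivity.
  assert (G1 : forall b W, b 0 = true -> G (rcons true (rcons true (rjn b W)))
    = rcons true (rcons false (rjn b (A0 b)))).
  { intros b W Hb. unfold G. rewrite K2, Hb, !rtl_cons, !rev_jn. reflexivity. }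
  assert (G2 : forall b W, b 0 = false -> G (rcons true (rcons true (rjn b W)))
    = rcons false (rtl b)).
  { intros b W Hb. unfold G. rewrite K2, Hb, !rtl_cons, !rev_jn. reflexivity. }
  assert (G3 : forall b W, W 0 = true -> G (rcons true (rcons false (rjn b W)))
    = rcons true (rcons false (rjn b (A W)))).
  { intros b W Hb. unfold G. rewrite K3, Hb, !rtl_cons, !rev_jn, rod_jn. reflexivity. }
  assert (G4 : forall b W, W 0 = false -> G (rcons true (rcons false (rjn b W)))
    = rcons true (rcons true (rjn (rtl W) zs))).
  { intros b W Hb. unfold G. rewrite K3, Hb, !rtl_cons, rod_jn. reflexivity. }
  clearbody G.
  intro x. destruct (HF x) as (Z & (trB & i & B1 & B2 & B3 & B4 & B5) & EZ).
  destruct (traj_ex G (fun x => x) (fun x => x) (rcons true (rcons true (rjn (I x) zs)))) as [tr [T0 T]].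
  set (E := fun b s : real => exists W, s = rcons true (rcons true (rjn b W))).
  set (cls := fun k => match k with 0 | 1 => KOn
    | S (S k) => if Nat.even k then KReg (Nat.div2 k) else KFree end).
  assert (Hbit : forall a c b W k, match cls (S (S k)) with
    | KReg n => rcons a (rcons c (rjn b W)) (S (S k)) = b n | KFree => True | _ => False end).
  { intros a c b W k. cbn. unfold rjn. now destruct (Nat.even k). }
  destruct (simulation G (fun x => x) (fun x => x) tr T B trB B2 E cls (fun s => s 0 = true))
    with (s0 := ozero) (i := i) as (t & _ & [W TE] & T3).
  - intros b s [W ->] k. destruct k as [|[|k]]; [easy|easy|].
    specialize (Hbit true true b W k). destruct (cls (S (S k))); auto. now rewrite Hbit.
  - intros b t Hb [W Ht]. destruct (HB b) as (Y & HY & EY).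
    assert (N1 : tr (osucc t) = rcons true (rcons false (rjn b (A0 b)))).
    { now rewrite (proj1 T), Ht, G1. }
    pose proof HY as (_ & _ & _ & _ & _ & Y0 & _).
    destruct (lockstep G A (fun w => rcons true (rcons false (rjn b w))) (keepcls [true; false] b)
      tr (osucc t) (A0 b) Y) as (t1 & L1 & L2 & L3); auto.
    { intros w k. exact (keepcls_emb [true; false] b w k). }
    exists (osucc t1). split; [|split].
    + eapply olt_trans; [apply olt_succ|]. now apply olt_succ_le.
    + exists zs. rewrite (proj1 T), L2, G4, EY; easy.
    + intros u U1 U2.
      assert (K : exists c W, tr u = rcons true (rcons c (rjn b W))).
      { destruct U1 as [<-|U1]; [eauto|]. apply osucc_le in U1. apply olt_succ_le in U2.
        destruct U2 as [->|U2]; [eauto|]. destruct (L3 u U1 U2); eauto. }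
      destruct K as (c & W' & ->). split; [reflexivity|].
      intros [|[|k]]; [easy|easy|]. specialize (Hbit true c b W' k).
      destruct (cls (S (S k))); auto; try easy. rewrite Hbit; auto.
  - intros b o Ho. exists (rod (rtl (rtl o))). apply real_ext; intros [|[|k]].
    + exact (Ho 0).
    + exact (Ho 1).
    + specialize (Ho (S (S k))). cbn in *. unfold rjn, rod, rtl.
      destruct (Nat.even k) eqn:Ev; [exact Ho|]. f_equal. f_equal. f_equal.
      rewrite (Nat.div2_odd k) at 1. unfold Nat.odd. rewrite Ev. cbn [negb Nat.b2n]. lia.
  - exists zs. now rewrite T0, B1.
  - exact B5.
  - exists (rcons false (rtl Z)); split; [|exact EZ].
    exists tr, (osucc t). split; [exact T0|]. split; [exact T|]. split.
    { rewrite (proj1 T), TE, G2; congruence. }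
    split; [reflexivity|]. intros j Hj. apply olt_succ_le in Hj as [->|Hj].
    + now rewrite TE.
    + apply T3; [apply ozero_le|exact Hj].
Qed.

(** The machine stops when the first output cell is off, so only outputs with that property can be
    delivered literally. The extra flag in front of the state is dropped by the last step. *)
Theorem comp_ittm (D : real -> Prop) F :
  comp F -> (forall x, D x -> F x 0 = false) -> ittm_computable D F.
Proof.
  intros (A0 & A & HA0 & HA & HF) H0.
  set (G := fun X : real => if X 1 then rcons true (A (rtl X)) else rtl (rtl X)).
  destruct (halts_ittm (fun x => rcons true (A0 x)) G) as (p & a & Hp).
  { now apply opn_cons. }
  { unfold G. apply opn_if; [apply opn_cons; exact (opn_tl _ HA)|].
    exact (opn_tl _ (opn_tl _ opn_id)). }
  exists p, a. intros x Hx. apply Hp.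
  destruct (HF x) as (Z & HZ & EZ). pose proof HZ as (_ & _ & _ & _ & _ & Z0 & _).
  destruct (traj_ex G (fun x => x) (fun x => x) (rcons true (A0 x))) as [tr [T0 T]].
  destruct (lockstep G A (rcons true) (fun k => match k with 0 => KOn | S n => KReg n end)
    tr ozero (A0 x) Z) as (t & _ & L2 & L3); auto.
  { now intros w [|k]. }
  { intros w Hw. unfold G; cbn. now rewrite Hw. }
  exists tr, (osucc t). split; [exact T0|]. split; [exact T|]. split.
  { rewrite (proj1 T), L2, EZ. unfold G; cbn. now rewrite Z0. }
  split; [now apply H0|]. intros j Hj. apply olt_succ_le in Hj as [->|Hj].
  - now rewrite L2.
  - destruct (L3 j (ozero_le j) Hj) as [w ->]; reflexivity.
Qed.

(** * Computable families of predicates *)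

(** Uniform decidability in the index. An arbitrary sequence [d] of indices is allowed, since
    noncomputable countable information fits into the parameter; reindexing is then immediate and
    index types need no coding. *)
Definition cfam {A : Type} (P : A -> real -> Prop) : Prop :=
  forall d : nat -> A, comp (fun x n => asb (P (d n) x)).

Lemma cfam_ext {A} (P Q : A -> real -> Prop) :
  (forall a x, P a x <-> Q a x) -> cfam P -> cfam Q.
Proof. intros H HP d. apply (comp_ext _ _ (fun x n => asb_ext _ _ (H (d n) x)) (HP d)). Qed.

Lemma cfam_open {A} (P : A -> real -> Prop) : (forall a, popen (P a)) -> cfam P.
Proof.
  intros HP d. apply comp_opn. intro n.
  apply (popen_ext (P (d n))); [intro X; symmetry; apply asbP|apply HP].
Qed.

Lemma cfam_bit {A} (h : A -> nat) : cfam (fun a x => x (h a) = true).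
Proof. apply cfam_open; intro a; apply popen_bit. Qed.

Lemma cfam_const {A} (C : A -> Prop) : cfam (fun a _ => C a).
Proof. apply cfam_open; intro a; apply popen_const. Qed.

Lemma cfam_reindex {A B} (h : B -> A) (P : A -> real -> Prop) :
  cfam P -> cfam (fun b x => P (h b) x).
Proof. intros HP d. exact (HP (fun n => h (d n))). Qed.

Lemma cfam_subst {A} (P : A -> real -> Prop) F :
  cfam P -> comp F -> cfam (fun a x => P a (F x)).
Proof. intros HP HF d. exact (comp_comp _ _ HF (HP d)). Qed.

Lemma comp_of_cfam (P : nat -> real -> Prop) : cfam P -> comp (fun x n => asb (P n x)).
Proof. intro HP. exact (HP (fun n => n)). Qed.

Lemma cfam_of_comp {A} F (h : A -> nat) : comp F -> cfam (fun a x => F x (h a) = true).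
Proof. intro HF. exact (cfam_subst _ F (cfam_bit h) HF). Qed.

Lemma cfam_not {A} (P : A -> real -> Prop) : cfam P -> cfam (fun a x => ~ P a x).
Proof.
  intros HP d. apply (comp_ext (fun x n => negb (asb (P (d n) x)))).
  - intros x n. apply bool_ext. rewrite negb_true_iff, asbP, asbF. reflexivity.
  - apply (comp_comp _ (fun y n => negb (y n)) (HP d)). apply comp_opn. intro n.
    apply (popen_ext (fun X => X n = false)); [intro X; now rewrite negb_true_iff|].
    apply popen_bit.
Qed.

(** The two truth tables must be present together: the argument is saved while the first is
    computed, and both are saved while the second is computed from the saved argument. *)
Lemma cfam_and {A} (P Q : A -> real -> Prop) :
  cfam P -> cfam Q -> cfam (fun a x => P a x /\ Q a x).
Proof.
  intros HP HQ d.
  pose proof (comp_keep _ (HP d)) as H1.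
  assert (He : comp rev) by (apply comp_opn; exact (opn_ev _ opn_id)).
  pose proof (comp_keep _ (comp_comp _ _ He (HQ d))) as H2.
  pose proof (comp_comp _ _ H1 H2) as H3. cbv beta in H3.
  apply (comp_ext (fun x n => asb (P (d n) x) && asb (Q (d n) x))).
  - intros x n. apply bool_ext. rewrite andb_true_iff, !asbP. reflexivity.
  - apply (comp_ext (fun x n => (fun y : real => fun n => rod (rev y) n && rod y n)
      (rjn (rjn x (fun n => asb (P (d n) x)))
        (fun n => asb (Q (d n) (rev (rjn x (fun n => asb (P (d n) x))))))) n)).
    + intros x n. cbv beta. now rewrite !rev_jn, !rod_jn.
    + apply (comp_comp _ (fun (y : real) n => rod (rev y) n && rod y n) H3).
      apply comp_opn. intro n.
      apply (popen_ext (fun y => rod (rev y) n = true /\ rod y n = true)).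
      * intro y; now rewrite andb_true_iff.
      * apply popen_and; apply popen_bit.
Qed.

(** Once the truth values for all pairs are tabulated, the existential quantifier is an open
    condition on the table. *)
Lemma cfam_ex {A B} (P : A -> B -> real -> Prop) : countable B ->
  cfam (fun ab x => P (fst ab) (snd ab) x) -> cfam (fun a x => exists b, P a b x).
Proof.
  intros [e He] HP d.
  specialize (HP (fun n => (d (fst (of_nat n)), e (snd (of_nat n))))). cbn [fst snd] in HP.
  apply (comp_ext (fun x n => (fun (y : real) n => asb (exists k, y (to_nat (n, k)) = true))
    (fun n => asb (P (d (fst (of_nat n))) (e (snd (of_nat n))) x)) n)).
  - intros x n. apply asb_ext. split.
    + intros [k Hk]. rewrite cancel_of_to, asbP in Hk. eauto.
    + intros [b Hb]. destruct (He b) as [k <-]. exists k. now rewrite cancel_of_to, asbP.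
  - apply (comp_comp _ (fun (y : real) n => asb (exists k, y (to_nat (n, k)) = true)) HP).
    apply comp_opn. intro n.
    apply (popen_ext (fun y => exists k, y (to_nat (n, k)) = true)).
    + intro y; symmetry; apply asbP.
    + apply popen_ex; intro k; apply popen_bit.
Qed.

Lemma cfam_or {A} (P Q : A -> real -> Prop) :
  cfam P -> cfam Q -> cfam (fun a x => P a x \/ Q a x).
Proof.
  intros HP HQ. apply (cfam_ext (fun a x => ~ (~ P a x /\ ~ Q a x))).
  - intros a x; destruct (classic (P a x)); tauto.
  - auto using cfam_not, cfam_and.
Qed.

Lemma cfam_imp {A} (P Q : A -> real -> Prop) :
  cfam P -> cfam Q -> cfam (fun a x => P a x -> Q a x).
Proof.
  intros HP HQ. apply (cfam_ext (fun a x => ~ (P a x /\ ~ Q a x))).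
  - intros a x; destruct (classic (Q a x)); tauto.
  - auto using cfam_not, cfam_and.
Qed.

Lemma cfam_iff {A} (P Q : A -> real -> Prop) :
  cfam P -> cfam Q -> cfam (fun a x => P a x <-> Q a x).
Proof. intros HP HQ. apply cfam_and; now apply cfam_imp. Qed.

Lemma cfam_all {A B} (P : A -> B -> real -> Prop) : countable B ->
  cfam (fun ab x => P (fst ab) (snd ab) x) -> cfam (fun a x => forall b, P a b x).
Proof.
  intros HB HP. apply (cfam_ext (fun a x => ~ exists b, ~ P a b x)).
  - intros a x; split; [apply not_ex_not_all|]. intros H [b Hb]; auto.
  - apply cfam_not, (cfam_ex _ HB), cfam_not, HP.
Qed.

(** * Counter programs with an oracle, compiled to Turing machines *)

Definition regs := nat -> nat.

Definition rset (s : regs) (r v : nat) : regs := fun k => if Nat.eqb k r then v else s k.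

(* [CAsk r] queries the oracle at the value of register [0]. *)
Inductive cmd :=
| CInc (r : nat) | CDec (r : nat) | CAsk (r : nat) | CSeq (c c' : cmd)
| CIf (r : nat) (c c' : cmd) | CWhile (r : nat) (c : cmd).

Inductive exec (x : real) : cmd -> regs -> regs -> Prop :=
| EInc r s : exec x (CInc r) s (rset s r (S (s r)))
| EDec r s : exec x (CDec r) s (rset s r (Nat.pred (s r)))
| EAsk r s : exec x (CAsk r) s (if x (s 0) then rset s r (S (s r)) else s)
| ESeq c c' s s' s'' : exec x c s s' -> exec x c' s' s'' -> exec x (CSeq c c') s s''
| EIf0 r c c' s s' : s r = 0 -> exec x c s s' -> exec x (CIf r c c') s s'
| EIfS r c c' s s' : s r <> 0 -> exec x c' s s' -> exec x (CIf r c c') s s'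
| EWhile0 r c s : s r = 0 -> exec x (CWhile r c) s s
| EWhileS r c s s' s'' : s r <> 0 -> exec x c s s' -> exec x (CWhile r c) s' s'' ->
    exec x (CWhile r c) s s''.

Inductive finstr :=
| FInc (r l : nat) | FDec (r l : nat) | FTst (r l0 l1 : nat) | FAsk (l0 l1 : nat)
| FHalt (b : bool).

Fixpoint csize (c : cmd) : nat :=
  match c with
  | CInc _ | CDec _ => 1 | CAsk _ => 2 | CSeq c c' => csize c + csize c'
  | CIf _ c c' => 1 + (csize c + csize c') | CWhile _ c => 1 + csize c
  end.

(** The code is placed at address [k] and continues at address [nx]; addresses are absolute. *)
Fixpoint flat (c : cmd) (k nx : nat) : list finstr :=
  match c with
  | CInc r => [FInc r nx]
  | CDec r => [FDec r nx]
  | CAsk r => [FAsk nx (1 + k); FInc r nx]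
  | CSeq c c' => flat c k (k + csize c) ++ flat c' (k + csize c) nx
  | CIf r c c' => FTst r (1 + k) (1 + k + csize c) :: flat c (1 + k) nx ++ flat c' (1 + k + csize c) nx
  | CWhile r c => FTst r nx (1 + k) :: flat c (1 + k) k
  end.

Lemma flat_length c : forall k nx, length (flat c k nx) = csize c.
Proof. induction c; intros k nx; cbn; rewrite ?length_app; auto. Qed.

Definition fnext (x : real) (i : finstr) (s : regs) : option (nat * regs) :=
  match i with
  | FInc r l => Some (l, rset s r (S (s r)))
  | FDec r l => Some (l, rset s r (Nat.pred (s r)))
  | FTst r l0 l1 => Some (if Nat.eqb (s r) 0 then l0 else l1, s)
  | FAsk l0 l1 => Some (if x (s 0) then l1 else l0, s)
  | FHalt _ => None
  end.

Section Flat.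

Context (x : real) (code : list finstr).

Inductive fsteps : nat -> regs -> nat -> regs -> Prop :=
| FS0 l s : fsteps l s l s
| FS1 l s i l' s' l'' s'' : nth_error code l = Some i -> fnext x i s = Some (l', s') ->
    fsteps l' s' l'' s'' -> fsteps l s l'' s''.

Lemma fsteps_trans l s l' s' l'' s'' :
  fsteps l s l' s' -> fsteps l' s' l'' s'' -> fsteps l s l'' s''.
Proof. induction 1; auto. intro. eapply FS1; eauto. Qed.

Definition code_at (k : nat) (p : list finstr) : Prop :=
  forall i, i < length p -> nth_error code (k + i) = nth_error p i.

Lemma code_at_app k p q : code_at k (p ++ q) -> code_at k p /\ code_at (k + length p) q.
Proof.
  intro H; split; intros i Hi.
  - rewrite H by (rewrite length_app; lia). now apply nth_error_app1.
  - rewrite <- Nat.add_assoc, H by (rewrite length_app; lia).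
    rewrite nth_error_app2 by lia. f_equal; lia.
Qed.

Lemma code_at_cons k i p : code_at k (i :: p) -> nth_error code k = Some i /\ code_at (1 + k) p.
Proof.
  intro H; split.
  - rewrite <- (Nat.add_0_r k). exact (H 0 ltac:(cbn; lia)).
  - intros j Hj. replace (1 + k + j) with (k + S j) by lia. apply (H (S j)). cbn; lia.
Qed.

Lemma flat_correct c s s' : exec x c s s' ->
  forall k nx, code_at k (flat c k nx) -> fsteps k s nx s'.
Proof.
  induction 1; intros k nx Hc; cbn [flat] in Hc.
  - apply code_at_cons in Hc as [Hc _]. eapply FS1; [exact Hc|reflexivity|constructor].
  - apply code_at_cons in Hc as [Hc _]. eapply FS1; [exact Hc|reflexivity|constructor].
  - apply code_at_cons in Hc as [Hc Hc']. apply code_at_cons in Hc' as [Hc' _].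
    eapply FS1; [exact Hc|reflexivity|]. destruct (x (s 0)); [|constructor].
    eapply FS1; [exact Hc'|reflexivity|constructor].
  - apply code_at_app in Hc as [H1 H2]. rewrite flat_length in H2.
    eapply fsteps_trans; eauto.
  - apply code_at_cons in Hc as [H1 H2]. apply code_at_app in H2 as [H2 H3].
    eapply FS1; [exact H1|reflexivity|]. rewrite H. cbn [Nat.eqb]. auto.
  - apply code_at_cons in Hc as [H1 H2]. apply code_at_app in H2 as [H2 H3].
    rewrite flat_length in H3. eapply FS1; [exact H1|reflexivity|].
    destruct (Nat.eqb_spec (s r) 0); [easy|]. auto.
  - apply code_at_cons in Hc as [H1 H2]. eapply FS1; [exact H1|reflexivity|].
    rewrite H. constructor.
  - pose proof Hc as Hc'. apply code_at_cons in Hc as [H2 H3].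
    eapply FS1; [exact H2|reflexivity|].
    destruct (Nat.eqb_spec (s r) 0); [easy|]. eapply fsteps_trans; eauto.
Qed.

(** * Turing machines executing flat counter code *)

Inductive tst :=
| TStart | TDone | TScan (l c : nat) (fs : bool) | TBack (l c : nat) | TRet (l : nat).

Definition tenc (s : tst) : nat :=
  match s with
  | TStart => 0 | TDone => 1
  | TScan l c fs => 2 + to_nat (Nat.b2n fs, to_nat (l, c))
  | TBack l c => 2 + to_nat (2, to_nat (l, c))
  | TRet l => 2 + to_nat (3, l)
  end.

Lemma tenc_inj s s' : tenc s = tenc s' -> s = s'.
Proof.
  assert (I : forall p q, to_nat p = to_nat q -> p = q).
  { intros p q H. now rewrite <- (cancel_of_to p), H, cancel_of_to. }
  destruct s as [| |l c []|l c|l], s' as [| |l' c' []|l' c'|l']; cbn [tenc Nat.b2n];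
    intro H; try discriminate H; try reflexivity;
    apply (proj1 (Nat.add_cancel_l _ _ 2)), I in H; try discriminate H;
    pose proof (f_equal snd H) as H'; cbn [snd] in H'; try apply I in H'; congruence.
Qed.

(* Register [0] is the unary input tape; register [r > 0] is stored in unary on the cells
   [i * K + r] of the scratch tape.  The only mark on the output tape is at cell [0]. *)
Context (K : nat).

Definition stride (r : nat) : nat := if Nat.eqb r 0 then 1 else K.
Definition rbit (r : nat) (i c : bool) : bool := if Nat.eqb r 0 then i else c.

Definition freg (i : finstr) : nat :=
  match i with FInc r _ | FDec r _ | FTst r _ _ => r | _ => 0 end.

Definition entry (l : nat) : tst :=
  match nth_error code l with Some i => TScan l (freg i) true | None => TDone end.

Definition tmove (s : tst) (i c o : bool) (m : move) : option (tst * bool * bool * bool * move) :=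
  Some (s, i, c, o, m).

Definition twrite (r : nat) (b : bool) (s : tst) (i c o : bool) :=
  if Nat.eqb r 0 then tmove s b c o MoveL else tmove s i b o MoveL.

(** [TScan l c fs] executes instruction [l] with [c] cells to go before the next digit of its
    register; [fs] records that no one has been passed yet, so that a decrement leaves an empty
    register alone. [TBack] returns to the last one for a decrement, and [TRet] to the mark at cell
    0. *)
Definition tdelta (s : tst) (i c o a : bool) : option (tst * bool * bool * bool * move) :=
  match s with
  | TStart => tmove (entry 0) i c true MoveL
  | TDone => None
  | TRet l => if o then tmove (entry l) i c o MoveL else tmove (TRet l) i c o MoveL
  | TScan l (S k) fs => tmove (TScan l k fs) i c o MoveR
  | TScan l 0 fs =>
    match nth_error code l with
    | Some (FInc r l') =>
      if rbit r i c then tmove (TScan l (stride r - 1) false) i c o MoveR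
      else twrite r true (TRet l') i c o
    | Some (FDec r l') =>
      if rbit r i c then tmove (TScan l (stride r - 1) false) i c o MoveR
      else if fs then tmove (TRet l') i c o MoveL
      else tmove (TBack l (stride r - 1)) i c o MoveL
    | Some (FTst r l0 l1) => tmove (TRet (if rbit r i c then l1 else l0)) i c o MoveL
    | Some (FAsk l0 l1) =>
      if i then tmove (TScan l 0 false) i c o MoveR
      else tmove (TRet (if a then l1 else l0)) i c o MoveL
    | Some (FHalt b) => tmove TDone i c b MoveL
    | None => None
    end
  | TBack l (S k) => tmove (TBack l k) i c o MoveL
  | TBack l 0 =>
    match nth_error code l with
    | Some (FDec r l') => twrite r false (TRet l') i c o
    | _ => None
    end
  end.

Definition tstates : list tst :=
  let N := seq 0 (length code) in let C := seq 0 (S K) in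
  TStart :: TDone :: map TRet N ++ map (fun lc => TBack (fst lc) (snd lc)) (list_prod N C)
  ++ map (fun lcf => TScan (fst (fst lcf)) (snd (fst lcf)) (snd lcf))
         (list_prod (list_prod N C) bools).

Definition tok (s : tst) : Prop :=
  match s with
  | TStart | TDone => True
  | TRet l => l < length code
  | TBack l c | TScan l c _ => l < length code /\ c <= K
  end.

Lemma tok_in s : tok s -> In s tstates.
Proof.
  intro H. unfold tstates. cbn [In]. rewrite !in_app_iff.
  destruct s as [| |l c fs|l c|l]; cbn in H; auto; right; right.
  - right; right. apply in_map_iff. exists ((l, c), fs). split; [easy|].
    rewrite !in_prod_iff, !in_seq. unfold bools. destruct fs; cbn; lia || (repeat split; try lia; auto).
  - right; left. apply in_map_iff. exists (l, c). split; [easy|].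
    rewrite in_prod_iff, !in_seq. lia.
  - left. apply in_map_iff. exists l. rewrite in_seq. split; [easy|lia].
Qed.

Definition tprog : program := prog_of tenc tdelta tstates.

Definition treach (c d : config) : Prop := exists k, run tprog x c k = Some d.

Lemma run_step p a c d k : step p a c = Some d -> run p a c (S k) = run p a d k.
Proof.
  intro H. induction k as [|k IH]; [exact H|].
  change (run p a c (S (S k))) with
    (match run p a c (S k) with Some d => step p a d | None => None end).
  rewrite IH. reflexivity.
Qed.

Lemma treach_refl c : treach c c.
Proof. now exists 0. Qed.

Lemma treach_step s c d e : state c = tenc s -> tok s ->
  dstep tenc tdelta s x c = Some d -> treach d e -> treach c e.
Proof.
  intros H1 H2 H3 [k Hk]. exists (S k). rewrite (run_step _ _ _ d); [exact Hk|].
  rewrite <- H3. apply step_prog_of; auto using tenc_inj, tok_in.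
Qed.

Lemma treach_trans c d e : treach c d -> treach d e -> treach c e.
Proof.
  intros [k Hk] [l Hl]. exists (k + l). revert c Hk; induction k as [|k IH]; intros c Hk.
  - injection Hk as <-. exact Hl.
  - assert (E : exists c', step tprog x c = Some c').
    { destruct (step tprog x c) as [c'|] eqn:E; [eauto|]. exfalso.
      assert (N : run tprog x c (S k) = None).
      { clear -E. induction k as [|k IH]; [exact E|]. cbn in *. now rewrite IH. }
      congruence. }
    destruct E as [c' E]. rewrite (run_step _ _ _ _ _ E) in Hk.
    cbn [Nat.add]. rewrite (run_step _ _ _ _ _ E). auto.
Qed.

Definition scratch (s : regs) : real :=
  fun n => negb (Nat.eqb (n mod K) 0) && Nat.ltb (n / K) (s (n mod K)).

Definition lmark : real := fun n => Nat.eqb n 0.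

Definition rep (q : tst) (h : nat) (s : regs) : config :=
  mkConfig (tenc q) h (unary (s 0)) (scratch s) lmark.

Lemma rep_step q q' h s s' e m i c :
  tok q ->
  tdelta q (unary (s 0) h) (scratch s h) (lmark h) (x h) = Some (q', i, c, lmark h, m) ->
  unary (s' 0) = upd (unary (s 0)) h i -> scratch s' = upd (scratch s) h c ->
  treach (rep q' (match m with MoveL => Nat.pred h | MoveR => S h end) s') e ->
  treach (rep q h s) e.
Proof.
  intros H1 H2 H3 H4 H5. eapply treach_step; [reflexivity|exact H1| |exact H5].
  unfold dstep, rep; cbn [head tin tsc tout]. rewrite H2, H3, H4, upd_same. reflexivity.
Qed.

Lemma rep_move q q' h s e m :
  tok q ->
  tdelta q (unary (s 0) h) (scratch s h) (lmark h) (x h)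
    = tmove q' (unary (s 0) h) (scratch s h) (lmark h) m ->
  treach (rep q' (match m with MoveL => Nat.pred h | MoveR => S h end) s) e ->
  treach (rep q h s) e.
Proof.
  intros H1 H2 H3. eapply rep_step; eauto; symmetry; apply upd_same.
Qed.

Hypothesis HK : forall l i, nth_error code l = Some i -> freg i < K.

Lemma code_lt l i : nth_error code l = Some i -> l < length code.
Proof. intro H. apply nth_error_Some. congruence. Qed.

Lemma ret_reach l s i h : nth_error code l = Some i ->
  treach (rep (TRet l) h s) (rep (TScan l (freg i) true) 0 s).
Proof.
  intro H. pose proof (code_lt _ _ H) as Hl.
  induction h as [|h IH].
  - eapply (rep_move (TRet l) (entry l) 0 s _ MoveL); [exact Hl|reflexivity|].
    unfold entry. rewrite H. apply treach_refl.
  - eapply (rep_move (TRet l) (TRet l) (S h) s _ MoveL); [exact Hl|reflexivity|exact IH].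
Qed.

Lemma scan_count l fs s k : forall h, l < length code -> k <= K ->
  treach (rep (TScan l k fs) h s) (rep (TScan l 0 fs) (h + k) s).
Proof.
  induction k as [|k IH]; intros h Hl Hk.
  - rewrite Nat.add_0_r. apply treach_refl.
  - eapply (rep_move (TScan l (S k) fs) (TScan l k fs) h s _ MoveR);
      [cbn; lia|reflexivity|].
    replace (h + S k) with (S h + k) by lia. apply IH; lia.
Qed.

Lemma back_count l s k : forall h, l < length code -> k <= K ->
  treach (rep (TBack l k) h s) (rep (TBack l 0) (h - k) s).
Proof.
  induction k as [|k IH]; intros h Hl Hk.
  - rewrite Nat.sub_0_r. apply treach_refl.
  - eapply (rep_move (TBack l (S k)) (TBack l k) h s _ MoveL);
      [cbn; lia|reflexivity|].
    replace (h - S k) with (Nat.pred h - k) by lia. apply IH; lia.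
Qed.

Lemma rbit_rep r s j : r < K ->
  rbit r (unary (s 0) (r + j * stride r)) (scratch s (r + j * stride r)) = Nat.ltb j (s r).
Proof.
  intro Hr. unfold rbit, stride. destruct (Nat.eqb_spec r 0) as [->|H0].
  - unfold unary. f_equal; lia.
  - unfold scratch. rewrite Nat.div_add, Nat.Div0.mod_add, Nat.div_small, Nat.mod_small by lia.
    destruct (Nat.eqb_spec r 0); [easy|]. reflexivity.
Qed.

Lemma scan_ones l i s fs v : nth_error code l = Some i ->
  match i with FInc _ _ | FDec _ _ | FAsk _ _ => True | _ => False end -> v <= s (freg i) ->
  treach (rep (TScan l 0 fs) (freg i) s)
    (rep (TScan l 0 (fs && Nat.eqb v 0)) (freg i + v * stride (freg i)) s).
Proof.
  intros Hl Hi Hv. induction v as [|v IH].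
  - rewrite Nat.add_0_r, andb_true_r. apply treach_refl.
  - eapply treach_trans; [apply IH; lia|].
    pose proof (HK _ _ Hl) as Hr. pose proof (code_lt _ _ Hl) as Hl'.
    pose proof (rbit_rep (freg i) s v Hr) as Hb.
    destruct (Nat.ltb_spec v (s (freg i))); [|lia].
    set (h := freg i + v * stride (freg i)) in *.
    assert (St : stride (freg i) >= 1) by (clear -Hr; unfold stride; destruct (Nat.eqb (freg i) 0); lia).
    assert (St' : stride (freg i) <= K) by (clear -Hr; unfold stride; destruct (Nat.eqb (freg i) 0); lia).
    apply (rep_move _ (TScan l (stride (freg i) - 1) false) h s _ MoveR).
    + cbn; lia.
    + cbn [tdelta]. rewrite Hl. destruct i as [r l'|r l'|r l0 l1|l0 l1|b]; try easy; cbn [freg] in *.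
      * now rewrite Hb.
      * now rewrite Hb.
      * unfold rbit in Hb; cbn [Nat.eqb] in Hb. now rewrite Hb.
    + replace (freg i + S v * stride (freg i)) with (S h + (stride (freg i) - 1)) by (unfold h; lia).
      rewrite andb_false_r. apply scan_count; [exact Hl'|lia].
Qed.

(** Changing a register by one flips a single cell: the first zero of its unary block is set, or its
    last one is erased. *)
Lemma unary_set s r b j : r < K ->
  (b = true /\ j = s r \/ b = false /\ S j = s r) ->
  let s' := rset s r (if b then S j else j) in
  let h := r + j * stride r in
  unary (s' 0) = upd (unary (s 0)) h (if Nat.eqb r 0 then b else unary (s 0) h) /\
  scratch s' = upd (scratch s) h (if Nat.eqb r 0 then scratch s h else b).
Proof.
  intros Hr Hb s' h. unfold s', h, rset, stride.
  destruct (Nat.eqb_spec r 0) as [->|H0].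
  - split.
    + cbn [Nat.eqb]. apply real_ext; intro n. unfold unary, upd.
      destruct (Nat.eqb_spec n (0 + j * 1)), b; destruct Hb as [[H1 H2]|[H1 H2]]; try discriminate;
      rewrite <- ?H2;
      repeat match goal with |- context [Nat.ltb ?a ?b] => destruct (Nat.ltb_spec a b) end;
      try reflexivity; lia.
    + rewrite upd_same. apply real_ext; intro n. unfold scratch.
      destruct (Nat.eqb_spec (n mod K) 0) as [E|E]; [easy|reflexivity].
  - split.
    + rewrite upd_same. destruct (Nat.eqb_spec 0 r); [congruence|reflexivity].
    + apply real_ext; intro n. unfold scratch, upd.
      pose proof (Nat.div_mod_eq n K) as En.
      destruct (Nat.eqb_spec n (r + j * K)) as [->|Hn].
      * rewrite Nat.div_add, Nat.Div0.mod_add, Nat.div_small, Nat.mod_small by lia.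
        rewrite Nat.eqb_refl. destruct (Nat.eqb_spec r 0); [easy|]. cbn.
        destruct b; destruct Hb as [[H1 H2]|[H1 H2]]; try discriminate.
        -- apply Nat.leb_refl.
        -- destruct j; [easy|]. apply Nat.leb_gt; lia.
      * destruct (Nat.eqb_spec (n mod K) r) as [E|E]; [|reflexivity].
        rewrite E in *. f_equal.
        assert (n / K <> j) by (intro; subst j; lia).
        destruct b; destruct Hb as [[H1 H2]|[H1 H2]]; try discriminate; rewrite <- H2;
          apply bool_ext; rewrite !Nat.ltb_lt; lia.
Qed.

Lemma instr_reach l s i l' s' i' : nth_error code l = Some i -> fnext x i s = Some (l', s') ->
  nth_error code l' = Some i' ->
  treach (rep (TScan l (freg i) true) 0 s) (rep (TScan l' (freg i') true) 0 s').
Proof.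
  intros Hl Hn Hl'. pose proof (code_lt _ _ Hl) as Ll. pose proof (code_lt _ _ Hl') as Ll'.
  pose proof (HK _ _ Hl) as Hr.
  eapply treach_trans; [apply scan_count; [exact Ll|lia]|]. cbn [Nat.add].
  set (r := freg i) in *. set (h := r + s r * stride r).
  assert (Hb : rbit r (unary (s 0) h) (scratch s h) = false).
  { unfold h. rewrite (rbit_rep r s (s r) Hr). apply Nat.ltb_irrefl. }
  destruct i as [q l1|q l1|q l0 l1|l0 l1|b]; cbn [freg] in r; subst r; cbn in Hn;
    injection Hn as Hn1 Hn2 || discriminate Hn; try subst l1; subst s'.
  - eapply treach_trans; [apply (scan_ones l _ s true (s q) Hl); cbn; auto|].
    cbn [freg]. fold h. destruct (unary_set s q true (s q) Hr) as [U1 U2]; [auto|]. fold h in U1, U2.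
    eapply (rep_step _ (TRet l') h s _ _ MoveL); [cbn; lia| |exact U1|exact U2|].
    + cbn [tdelta]. rewrite Hl, Hb. unfold twrite. destruct (Nat.eqb q 0); reflexivity.
    + now apply ret_reach.
  - eapply treach_trans; [apply (scan_ones l _ s true (s q) Hl); cbn; auto|].
    cbn [freg]. fold h. destruct (s q) as [|v] eqn:Ev; cbn [Nat.eqb andb].
    + replace (rset s q (Nat.pred 0)) with s.
      2:{ apply functional_extensionality; intro k. unfold rset.
          destruct (Nat.eqb_spec k q); subst; auto. }
      apply (rep_move _ (TRet l') h s _ MoveL); [cbn; lia| |now apply ret_reach].
      cbn [tdelta]. now rewrite Hl, Hb.
    + cbn [Nat.pred].
      assert (St : stride q >= 1) by (unfold stride; destruct (Nat.eqb q 0); lia).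
      assert (St' : stride q <= K) by (unfold stride; destruct (Nat.eqb q 0); lia).
      apply (rep_move _ (TBack l (stride q - 1)) h s _ MoveL); [cbn; lia| |].
      { cbn [tdelta]. now rewrite Hl, Hb. }
      eapply treach_trans; [apply back_count; [exact Ll|lia]|].
      replace (Nat.pred h - (stride q - 1)) with (q + v * stride q) by (unfold h; lia).
      destruct (unary_set s q false v Hr) as [U1 U2]; [auto|].
      eapply (rep_step _ (TRet l') _ s _ _ MoveL); [cbn; lia| |exact U1|exact U2|].
      * cbn [tdelta]. rewrite Hl. unfold twrite. destruct (Nat.eqb q 0); reflexivity.
      * now apply ret_reach.
  - apply (rep_move _ (TRet l') q s _ MoveL); [cbn; lia| |now apply ret_reach].
    cbn [tdelta]. rewrite Hl. pose proof (rbit_rep q s 0 Hr) as Hq.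
    rewrite Nat.add_0_r in Hq. rewrite Hq. rewrite <- Hn1. unfold tmove. repeat f_equal.
    destruct (s q); reflexivity.
  - eapply treach_trans; [apply (scan_ones l _ s true (s 0) Hl); cbn; auto|].
    cbn [freg]. fold h. apply (rep_move _ (TRet l') h s _ MoveL); [cbn; lia| |now apply ret_reach].
    cbn [tdelta]. rewrite Hl. unfold rbit in Hb; cbn [Nat.eqb] in Hb. rewrite Hb.
    replace (x h) with (x (s 0)) by (unfold h, stride; cbn; f_equal; lia).
    now rewrite Hn1.
Qed.

Lemma fsteps_reach l s l' s' : fsteps l s l' s' -> forall i i',
  nth_error code l = Some i -> nth_error code l' = Some i' ->
  treach (rep (TScan l (freg i) true) 0 s) (rep (TScan l' (freg i') true) 0 s').
Proof.
  induction 1 as [l s|l s i l1 s1 l2 s2 H1 H2 H3 IH]; intros j j' Hj Hj'.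
  - rewrite Hj in Hj'. injection Hj' as <-. apply treach_refl.
  - rewrite H1 in Hj. injection Hj as <-.
    assert (E : exists i1, nth_error code l1 = Some i1) by (destruct H3; eauto).
    destruct E as [i1 E]. eapply treach_trans; [eapply instr_reach; eauto|]. now apply IH.
Qed.

End Flat.

Lemma code_bound (code : list finstr) : exists K, forall l i, nth_error code l = Some i -> freg i < K.
Proof.
  exists (S (list_max (map freg code))). intros l i H. apply nth_error_In in H.
  apply Nat.lt_succ_r. pose proof (proj1 (list_max_le (map freg code) _) (le_n _)) as M.
  rewrite Forall_forall in M. apply M. now apply in_map.
Qed.

Theorem compile (x z : real) (c : cmd) :
  (forall n, exists s, exec x c (rset (fun _ => 0) 0 n) s /\ (s 1 <> 0 <-> z n = true)) ->
  turing_computable_from z x.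
Proof.
  intro H. set (N := csize c).
  (* The epilogue tests register 1 and halts at cell 0, where the answer replaces the left mark on
     the output tape. *)
  set (code := flat c 0 N ++ [FTst 1 (1 + N) (2 + N); FHalt false; FHalt true]).
  assert (LN : length (flat c 0 N) = N) by apply flat_length.
  assert (C0 : nth_error code N = Some (FTst 1 (1 + N) (2 + N))).
  { unfold code. rewrite nth_error_app2 by lia. rewrite LN, Nat.sub_diag. reflexivity. }
  assert (C1 : nth_error code (1 + N) = Some (FHalt false)).
  { unfold code. rewrite nth_error_app2 by lia. rewrite LN. now replace (1 + N - N) with 1 by lia. }
  assert (C2 : nth_error code (2 + N) = Some (FHalt true)).
  { unfold code. rewrite nth_error_app2 by lia. rewrite LN. now replace (2 + N - N) with 2 by lia. }
  assert (Cc : code_at code 0 (flat c 0 N)).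
  { intros i Hi. unfold code. cbn. now rewrite nth_error_app1. }
  destruct (code_bound code) as [K HK].
  exists (tprog code K). intro n. destruct (H n) as [s [Hs Hz]].
  assert (E0 : exists i0, nth_error code 0 = Some i0).
  { destruct code as [|i0 cd] eqn:E; [|now exists i0].
    exfalso. unfold code in E. now destruct (flat c 0 N). }
  destruct E0 as [i0 E0].
  assert (Hf : fsteps x code 0 (rset (fun _ => 0) 0 n) (if z n then 2 + N else 1 + N) s).
  { eapply fsteps_trans; [exact (flat_correct x code c _ _ Hs 0 N Cc)|].
    eapply FS1; [exact C0|reflexivity|].
    destruct (z n) eqn:Ez; destruct (Nat.eqb_spec (s 1) 0) as [E|E]; try constructor.
    - exfalso; tauto.
    - exfalso. destruct Hz as [Hz _]. discriminate (Hz E). }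
  assert (CE : nth_error code (if z n then 2 + N else 1 + N) = Some (FHalt (z n)))
    by (destruct (z n); assumption).
  pose proof (fsteps_reach x code K HK _ _ _ _ Hf _ _ E0 CE) as R.
  set (le := if z n then 2 + N else 1 + N) in *.
  assert (R' : treach x code K (init_config (unary n))
    (mkConfig (tenc TDone) 0 (unary (s 0)) (scratch K s) (upd lmark 0 (z n)))).
  { eapply treach_step with (s := TStart); [reflexivity|exact I|reflexivity|].
    eapply treach_trans.
    - match goal with |- treach _ _ _ ?c _ => replace c with
        (rep K (TScan 0 (freg i0) true) 0 (rset (fun _ => 0) 0 n)) end; [exact R|].
      unfold rep, entry. rewrite E0. cbn. f_equal.
      + apply real_ext; intro k. symmetry. apply (f_equal (fun g => g k) (upd_same (unary n) 0)).
      + apply real_ext; intro k. unfold scratch, upd, rset. 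
        destruct (Nat.eqb_spec (k mod K) 0); cbn; destruct (Nat.eqb k 0); reflexivity.
      + apply real_ext; intro k. unfold lmark, upd. now destruct (Nat.eqb k 0).
    - eapply treach_step with (s := TScan le 0 true); [reflexivity| | |apply treach_refl].
      + cbn. split; [|lia]. apply nth_error_Some. congruence.
      + unfold dstep, rep. cbn [head tin tsc tout tdelta]. rewrite CE.
        cbn. now rewrite !upd_same. }
  destruct R' as [k Rk]. exists k; eexists; split; [exact Rk|]. split.
  - unfold tprog. rewrite (step_prog_of tenc (tdelta code K) (tstates code K) x TDone);
      [reflexivity|apply tenc_inj|apply tok_in; exact I|reflexivity].
  - reflexivity.
Qed.

(** * Functions computable by counter programs *)

(* The registers above the argument are scratch space, clean before and after the call. *)
Definition cfun (x : real) (f : nat -> nat) : Prop :=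
  forall b, 1 <= b -> exists c, forall s, s 0 = 0 -> (forall r, b < r -> s r = 0) ->
    exec x c s (rset s b (f (s b))).

Definition cfun2 (x : real) (f : nat -> nat -> nat) : Prop :=
  forall b, 1 <= b -> exists c, forall s, s 0 = 0 -> (forall r, S b < r -> s r = 0) ->
    exec x c s (rset (rset s b (f (s b) (s (S b)))) (S b) 0).

Lemma exec_eq x c s s' s'' : s' = s'' -> exec x c s s' -> exec x c s s''.
Proof. now intros ->. Qed.

Ltac regs_tac :=
  apply functional_extensionality; intro; unfold rset;
  repeat (match goal with
  | |- context [Nat.eqb ?a ?b] => destruct (Nat.eqb_spec a b)
  | H : context [Nat.eqb ?a ?b] |- _ => destruct (Nat.eqb_spec a b)
  end; try (exfalso; lia); subst); try lia; try reflexivity; auto.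

Ltac eqb_simp :=
  unfold rset; repeat match goal with
  | |- context [Nat.eqb ?a ?b] => destruct (Nat.eqb_spec a b); try (exfalso; lia)
  end.

Definition cmv (i j : nat) : cmd := CWhile i (CSeq (CDec i) (CInc j)).
Definition cclr (i : nat) : cmd := CWhile i (CDec i).
Definition ccp (i j t : nat) : cmd :=
  CSeq (CWhile i (CSeq (CDec i) (CSeq (CInc j) (CInc t)))) (cmv t i).

Lemma exec_mv x i j s : i <> j -> exec x (cmv i j) s (rset (rset s j (s j + s i)) i 0).
Proof.
  intro Hij. remember (s i) as v eqn:Ev. revert s Ev; induction v as [|v IH]; intros s Ev.
  - eapply exec_eq; [|apply EWhile0; auto]. regs_tac.
  - eapply EWhileS; [lia| |].
    + eapply ESeq; constructor.
    + eapply exec_eq; [|apply IH; eqb_simp; lia]. regs_tac.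
Qed.

Lemma exec_clr x i s : exec x (cclr i) s (rset s i 0).
Proof.
  remember (s i) as v eqn:Ev. revert s Ev; induction v as [|v IH]; intros s Ev.
  - eapply exec_eq; [|apply EWhile0; auto]. regs_tac.
  - eapply EWhileS; [lia|constructor|].
    eapply exec_eq; [|apply IH; eqb_simp; lia]. regs_tac.
Qed.

Lemma exec_cp x i j t s : i <> j -> i <> t -> j <> t -> s t = 0 ->
  exec x (ccp i j t) s (rset s j (s j + s i)).
Proof.
  intros H1 H2 H3 H4.
  assert (L : forall s, exec x (CWhile i (CSeq (CDec i) (CSeq (CInc j) (CInc t)))) s
    (rset (rset (rset s j (s j + s i)) t (s t + s i)) i 0)).
  { clear s H4. intro s. remember (s i) as v eqn:Ev. revert s Ev; induction v as [|v IH]; intros s Ev.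
    - eapply exec_eq; [|apply EWhile0; auto]. regs_tac.
    - eapply EWhileS; [lia| |].
      + eapply ESeq; [constructor|]. eapply ESeq; constructor.
      + eapply exec_eq; [|apply IH; eqb_simp; lia]. regs_tac. }
  eapply ESeq; [apply L|]. eapply exec_eq; [|apply exec_mv; auto]. regs_tac.
Qed.

Lemma cfun_ext x f g : (forall n, f n = g n) -> cfun x f -> cfun x g.
Proof. intros H Hf. replace g with f; [exact Hf|]. now apply functional_extensionality. Qed.

Lemma cfun_comp x f g : cfun x f -> cfun x g -> cfun x (fun n => g (f n)).
Proof.
  intros Hf Hg b Hb. destruct (Hf b Hb) as [c Hc], (Hg b Hb) as [c' Hc'].
  exists (CSeq c c'). intros s H0 Hs. eapply ESeq; [now apply Hc|].
  eapply exec_eq; [|apply Hc'].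
  - regs_tac.
  - eqb_simp; auto.
  - intros r Hr. eqb_simp; auto.
Qed.

Lemma cfun_S x : cfun x S.
Proof. intros b Hb. exists (CInc b). intros; constructor. Qed.

Lemma cfun_pred x : cfun x Nat.pred.
Proof. intros b Hb. exists (CDec b). intros; constructor. Qed.

Lemma cfun_const x k : cfun x (fun _ => k).
Proof.
  induction k as [|k IH].
  - intros b Hb. exists (cclr b). intros; apply exec_clr.
  - exact (cfun_comp x _ _ IH (cfun_S x)).
Qed.

Lemma cfun_id x : cfun x (fun n => n).
Proof. apply (cfun_ext x (fun n => Nat.pred (S n))); [easy|]. exact (cfun_comp x _ _ (cfun_S x) (cfun_pred x)). Qed.

Lemma cfun_oracle x : cfun x (fun n => Nat.b2n (x n)).
Proof.
  intros b Hb. exists (CSeq (cmv b 0) (CSeq (CAsk b) (cclr 0))). intros s H0 Hs.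
  eapply ESeq; [apply exec_mv; lia|]. eapply ESeq; [constructor|].
  eapply exec_eq; [|apply exec_clr].
  replace (rset (rset s 0 (s 0 + s b)) b 0 0) with (s b) by (eqb_simp; lia).
  destruct (x (s b)); cbn [Nat.b2n]; regs_tac.
Qed.

Lemma cfun_op x f g h : cfun2 x f -> cfun x g -> cfun x h -> cfun x (fun n => f (g n) (h n)).
Proof.
  intros Hf Hg Hh b Hb. destruct (Hf b Hb) as [cf Hcf].
  destruct (Hg (S b) ltac:(lia)) as [cg Hcg], (Hh (S (S b)) ltac:(lia)) as [ch Hch].
  exists (CSeq (ccp b (S b) (S (S b))) (CSeq cg (CSeq (ccp b (S (S b)) (S (S (S b)))) (CSeq ch
    (CSeq (cclr b) (CSeq (cmv (S b) b) (CSeq (cmv (S (S b)) (S b)) cf))))))).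
  intros s H0 Hs.
  eapply ESeq; [apply exec_cp; try lia; apply Hs; lia|]. rewrite (Hs (S b)) by lia. cbn [Nat.add].
  eapply ESeq; [apply Hcg; [|intros r Hr]; eqb_simp; auto; apply Hs; lia|].
  eapply ESeq; [apply exec_cp; try lia; eqb_simp; apply Hs; lia|].
  eapply ESeq; [apply Hch; [|intros r Hr]; eqb_simp; auto; apply Hs; lia|].
  eapply ESeq; [apply exec_clr|]. eapply ESeq; [apply exec_mv; lia|].
  eapply ESeq; [apply exec_mv; lia|].
  set (n := s b). match goal with |- exec _ _ ?s1 _ =>
    replace s1 with (rset (rset s b (g n)) (S b) (h n)) end.
  - eapply exec_eq; [|apply Hcf].
    + assert (E1 : rset (rset s b (g n)) (S b) (h n) b = g n) by (eqb_simp; auto).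
      assert (E2 : rset (rset s b (g n)) (S b) (h n) (S b) = h n) by (eqb_simp; auto).
      rewrite E1, E2. regs_tac. symmetry; apply Hs; lia.
    + eqb_simp; auto.
    + intros r Hr. eqb_simp. apply Hs; lia.
  - assert (E1 : rset s (S b) n (S b) = n) by (eqb_simp; auto).
    assert (E0 : s (S (S b)) = 0) by (apply Hs; lia).
    fold n. rewrite E1.
    assert (E2 : rset (rset s (S b) n) (S b) (g n) (S (S b)) = 0) by (eqb_simp; auto).
    assert (E3 : rset (rset s (S b) n) (S b) (g n) b = n) by (eqb_simp; auto).
    rewrite E2, E3. cbn [Nat.add].
    assert (E4 : forall s, rset s (S (S b)) n (S (S b)) = n) by (intro; eqb_simp; auto).
    rewrite E4. regs_tac.
Qed.

Lemma cfun2_iter x f : cfun x f -> cfun2 x (fun n a => Nat.iter n f a).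
Proof.
  intros Hf b Hb. destruct (Hf (S b) ltac:(lia)) as [c Hc].
  exists (CSeq (CWhile b (CSeq (CDec b) c)) (cmv (S b) b)). intros s H0 Hs.
  assert (L : forall k s, s b = k -> s 0 = 0 -> (forall r, S b < r -> s r = 0) ->
    exec x (CWhile b (CSeq (CDec b) c)) s (rset (rset s b 0) (S b) (Nat.iter k f (s (S b))))).
  { clear s H0 Hs. induction k as [|k IH]; intros s Hk H0 Hs.
    - eapply exec_eq; [|apply EWhile0; exact Hk]. cbn. regs_tac.
    - eapply EWhileS; [lia| |].
      + eapply ESeq; [constructor|]. apply Hc; [|intros r Hr]; eqb_simp; auto.
      + eapply exec_eq; [|apply IH; [|  |intros r Hr]; eqb_simp; auto; lia].
        replace (Nat.iter (S k) f (s (S b))) with (Nat.iter k f (f (s (S b))))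
          by (symmetry; apply Nat.iter_succ_r).
        assert (E : rset s b (Nat.pred (s b)) (S b) = s (S b)) by (eqb_simp; auto).
        rewrite E. assert (E' : forall s v, rset s (S b) v (S b) = v) by (intros; eqb_simp; auto).
        rewrite E'. regs_tac. }
  eapply ESeq; [apply (L (s b)); auto|]. eapply exec_eq; [|apply exec_mv; lia].
  cbn. assert (E' : forall s v, rset s (S b) v (S b) = v) by (intros; eqb_simp; auto).
  rewrite E'. assert (E2 : forall v, rset (rset s b 0) (S b) v b = 0) by (intros; eqb_simp; auto).
  rewrite E2. regs_tac.
Qed.

Lemma pair_to_nat n m : pair n m = to_nat (n, m).
Proof.
  unfold pair. pose proof (to_nat_spec n m) as H.
  assert (E : (n + m) * (n + m + 1) = (to_nat (n, m) - m) * 2) by nia.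
  assert (m <= to_nat (n, m)) by nia.
  rewrite E, Nat.div_mul by lia. lia.
Qed.

Lemma cfun2_pair x : cfun2 x (fun n m => to_nat (n, m)).
Proof.
  intros b Hb. set (m := S b). set (a := S m). set (t := S a).
  (* The pairing adds [m] to the triangular number of [n + m]: the first loop leaves [n + m] in [b]
     and [m] in [a], and the second adds to [a] the values of [b] while counting it down. *)
  exists (CSeq (CWhile m (CSeq (CDec m) (CSeq (CInc b) (CInc a))))
    (CSeq (CWhile b (CSeq (ccp b a t) (CDec b))) (cmv a b))).
  intros s H0 Hs.
  assert (L1 : forall v s, s m = v -> exec x (CWhile m (CSeq (CDec m) (CSeq (CInc b) (CInc a)))) s
    (rset (rset (rset s m 0) b (s b + v)) a (s a + v))).
  { clear s H0 Hs. induction v as [|v IH]; intros s Hv; unfold t, a, m in *.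
    - eapply exec_eq; [|apply EWhile0; exact Hv]. regs_tac.
    - eapply EWhileS; [lia| |].
      + eapply ESeq; [constructor|]. eapply ESeq; constructor.
      + eapply exec_eq; [|apply IH; eqb_simp; lia]. regs_tac. }
  assert (L2 : forall v s, s b = v -> s t = 0 -> exec x (CWhile b (CSeq (ccp b a t) (CDec b))) s
    (rset (rset s b 0) a (s a + to_nat (v, 0)))).
  { clear s H0 Hs. induction v as [|v IH]; intros s Hv Ht; unfold t, a, m in *.
    - eapply exec_eq; [|apply EWhile0; exact Hv]. cbn. regs_tac.
    - eapply EWhileS; [lia| |].
      + eapply ESeq; [apply exec_cp; auto; lia|constructor].
      + assert (E : to_nat (S v, 0) = S v + to_nat (v, 0)) by (cbn; lia).
        rewrite E. eapply exec_eq; [|apply IH; eqb_simp; lia]. regs_tac. }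
  eapply ESeq; [apply (L1 _ _ eq_refl)|]. unfold t, a, m in *.
  eapply ESeq; [apply (L2 _ _ eq_refl); eqb_simp; apply Hs; lia|].
  eapply exec_eq; [|apply exec_mv; lia].
  assert (E : to_nat (s b, s (S b)) = s (S b) + to_nat (s b + s (S b), 0)).
  { cbn. now rewrite (Nat.add_comm (s (S b)) (s b)). }
  assert (Ea : s (S (S b)) = 0) by (apply Hs; lia).
  assert (Ez : rset (rset (rset s (S b) 0) b (s b + s (S b))) (S (S b)) (s (S (S b)) + s (S b)) b
    = s b + s (S b)) by (eqb_simp; lia).
  rewrite Ez, E. regs_tac.
Qed.

Definition nextp (q : nat * nat) : nat * nat :=
  match q with (0, m) => (S m, 0) | (S n, m) => (n, S m) end.

Lemma of_nat_S k : of_nat (S k) = nextp (of_nat k).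
Proof. unfold of_nat; cbn [nat_rec nat_rect]. destruct (nat_rect _ _ _ k) as [[|n] m]; reflexivity. Qed.

(** Unpairing walks along the diagonals from (0, 0), one [nextp] for each unit of the argument. *)
Lemma exec_unpair x b : 1 <= b -> exists c, forall s,
  s 0 = 0 -> (forall r, b < r -> s r = 0) ->
  exec x c s (rset (rset (rset s b 0) (S b) (fst (of_nat (s b)))) (S (S b)) (snd (of_nat (s b)))).
Proof.
  intro Hb. set (n := S b). set (m := S n).
  set (body := CSeq (CDec b) (CIf n (CSeq (cmv m n) (CInc n)) (CSeq (CDec n) (CInc m)))).
  exists (CWhile b body). intros s H0 Hs.
  assert (L : forall v k s, s b = v -> (s n, s m) = of_nat k ->
    exec x (CWhile b body) s
      (rset (rset (rset s b 0) n (fst (of_nat (v + k)))) m (snd (of_nat (v + k))))).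
  { clear s H0 Hs. induction v as [|v IH]; intros k s Hv Hk; unfold m, n in *.
    - eapply exec_eq; [|apply EWhile0; exact Hv]. cbn [Nat.add]. rewrite <- Hk. cbn. regs_tac.
    - replace (S v + k) with (v + S k) by lia.
      destruct (s (S b)) as [|p] eqn:Ep.
      + eapply EWhileS; [lia| |].
        * eapply ESeq; [constructor|]. apply EIf0; [eqb_simp; auto|].
          eapply ESeq; [apply exec_mv; lia|constructor].
        * eapply exec_eq; [|apply (IH (S k)); [eqb_simp; lia|]].
          -- regs_tac.
          -- rewrite of_nat_S, <- Hk. cbn. eqb_simp. f_equal; lia.
      + eapply EWhileS; [lia| |].
        * eapply ESeq; [constructor|]. apply EIfS; [eqb_simp; lia|].
          eapply ESeq; constructor.
        * eapply exec_eq; [|apply (IH (S k)); [eqb_simp; lia|]].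
          -- regs_tac.
          -- rewrite of_nat_S, <- Hk. cbn. eqb_simp. f_equal; lia. }
  specialize (L (s b) 0 s eq_refl). rewrite Nat.add_0_r in L. apply L.
  unfold m, n. now rewrite !Hs by lia.
Qed.

Lemma cfun_fst x : cfun x (fun k => fst (of_nat k)).
Proof.
  intros b Hb. destruct (exec_unpair x b Hb) as [c Hc].
  exists (CSeq c (CSeq (cclr (S (S b))) (cmv (S b) b))). intros s H0 Hs.
  eapply ESeq; [now apply Hc|]. eapply ESeq; [apply exec_clr|].
  eapply exec_eq; [|apply exec_mv; lia].
  assert (s (S b) = 0) by (apply Hs; lia). assert (s (S (S b)) = 0) by (apply Hs; lia).
  regs_tac.
Qed.

Lemma cfun_snd x : cfun x (fun k => snd (of_nat k)).
Proof.
  intros b Hb. destruct (exec_unpair x b Hb) as [c Hc].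
  exists (CSeq c (CSeq (cclr (S b)) (cmv (S (S b)) b))). intros s H0 Hs.
  eapply ESeq; [now apply Hc|]. eapply ESeq; [apply exec_clr|].
  eapply exec_eq; [|apply exec_mv; lia].
  assert (s (S b) = 0) by (apply Hs; lia). assert (s (S (S b)) = 0) by (apply Hs; lia).
  regs_tac.
Qed.

Lemma cfun_mu x P h : cfun2 x P ->
  (forall a, P a (h a) = 0 /\ forall k, k < h a -> P a k <> 0) -> cfun x h.
Proof.
  intros HP Hh b Hb. destruct (HP (S (S b)) ltac:(lia)) as [c Hc].
  set (k := S b). set (r := S k). set (r' := S r). set (t := S r').
  set (test := CSeq (ccp b r t) (CSeq (ccp k r' t) c)).
  set (body := CSeq (cclr r) (CSeq (CInc k) test)).
  exists (CSeq test (CSeq (CWhile r body) (CSeq (cclr b) (cmv k b)))).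
  intros s H0 Hs.
  assert (T : forall s a j, s 0 = 0 -> s b = a -> s k = j -> (forall i, k < i -> s i = 0) ->
    exec x test s (rset s r (P a j))).
  { clear s H0 Hs. intros s a j H0 Ha Hj Hs. unfold test, t, r', r, k in *.
    eapply ESeq; [apply exec_cp; try lia; apply Hs; lia|].
    eapply ESeq; [apply exec_cp; try lia; eqb_simp; apply Hs; lia|].
    assert (s (S (S b)) = 0) by (apply Hs; lia). assert (E0 : s (S (S (S b))) = 0) by (apply Hs; lia).
    assert (E : forall s', s' = rset (rset s (S (S b)) a) (S (S (S b))) j ->
      exec x c s' (rset s (S (S b)) (P a j))).
    { intros s' ->. eapply exec_eq; [|apply Hc].
      - replace (rset (rset s (S (S b)) a) (S (S (S b))) j (S (S b))) with a by (eqb_simp; auto).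
        replace (rset (rset s (S (S b)) a) (S (S (S b))) j (S (S (S b)))) with j by (eqb_simp; auto).
        regs_tac.
      - eqb_simp; auto.
      - intros i Hi. eqb_simp; apply Hs; lia. }
    apply E. regs_tac. }
  assert (L : forall d a j s, s 0 = 0 -> s b = a -> s k = j -> s r = P a j ->
      (forall i, r < i -> s i = 0) -> j + d = h a ->
    exec x (CWhile r body) s (rset (rset s k (h a)) r 0)).
  { clear s H0 Hs. induction d as [|d IH]; intros a j s H0 Ha Hj Hr Hs Hd.
    - replace j with (h a) in * by lia.
      assert (Z : s r = 0) by (rewrite Hr; apply Hh).
      eapply exec_eq; [|apply EWhile0; exact Z]. unfold r, k in *. regs_tac.
    - eapply EWhileS; [rewrite Hr; apply Hh; lia| |].
      + unfold body. eapply ESeq; [apply exec_clr|]. eapply ESeq; [constructor|].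
        apply (T _ a (S j)); unfold r, k in *; try (intros i Hi); eqb_simp; auto; try lia.
        apply Hs; lia.
      + unfold r, k in *. eapply exec_eq; [|apply (IH a (S j)); try (intros i Hi); eqb_simp; auto; lia].
        regs_tac. }
  eapply ESeq; [apply (T s (s b) 0); unfold k; auto; try (intros i Hi); apply Hs; lia|].
  eapply ESeq.
  { apply (L (h (s b)) (s b) 0); unfold r, k; try (intros i Hi); eqb_simp; auto; apply Hs; lia. }
  eapply ESeq; [apply exec_clr|]. unfold r, k.
  assert (s (S b) = 0) by (apply Hs; lia). assert (s (S (S b)) = 0) by (apply Hs; lia).
  eapply exec_eq; [|apply exec_mv; lia]. regs_tac.
Qed.

Section Arithmetic.

Context (x : real).

Lemma cfun2_post f g : cfun2 x f -> cfun x g -> cfun2 x (fun n m => g (f n m)).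
Proof.
  intros Hf Hg b Hb. destruct (Hf b Hb) as [c Hc], (Hg b Hb) as [c' Hc'].
  exists (CSeq c c'). intros s H0 Hs. eapply ESeq; [now apply Hc|].
  eapply exec_eq; [|apply Hc'; [|intros r Hr]; eqb_simp; auto; apply Hs; lia].
  replace (rset (rset s b (f (s b) (s (S b)))) (S b) 0 b) with (f (s b) (s (S b)))
    by (eqb_simp; auto). regs_tac.
Qed.

Lemma cfun2_curry f : cfun x (fun q => f (fst (of_nat q)) (snd (of_nat q))) -> cfun2 x f.
Proof.
  intro H. pose proof (cfun2_post _ _ (cfun2_pair x) H) as H'. cbv beta in H'.
  replace f with (fun n m => f (fst (of_nat (to_nat (n, m)))) (snd (of_nat (to_nat (n, m)))));
    [exact H'|]. do 2 (apply functional_extensionality; intro). now rewrite cancel_of_to.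
Qed.

Lemma cfun_pair f g : cfun x f -> cfun x g -> cfun x (fun n => to_nat (f n, g n)).
Proof. exact (cfun_op x _ f g (cfun2_pair x)). Qed.

Lemma cfun_fst' f : cfun x f -> cfun x (fun n => fst (of_nat (f n))).
Proof. intro H. exact (cfun_comp x _ _ H (cfun_fst x)). Qed.

Lemma cfun_snd' f : cfun x f -> cfun x (fun n => snd (of_nat (f n))).
Proof. intro H. exact (cfun_comp x _ _ H (cfun_snd x)). Qed.

(** The iterated function sees only its own value, so the parameter travels with it in a pair. *)
Lemma cfun_iterp F g p h : cfun2 x F -> cfun x g -> cfun x p -> cfun x h ->
  cfun x (fun n => Nat.iter (g n) (F (p n)) (h n)).
Proof.
  intros HF Hg Hp Hh.
  set (G := fun q => to_nat (fst (of_nat q), F (fst (of_nat q)) (snd (of_nat q)))).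
  assert (HG : cfun x G).
  { apply cfun_pair; [apply cfun_fst|]. apply (cfun_op x F); auto using cfun_fst, cfun_snd. }
  assert (E : forall k a b, Nat.iter k G (to_nat (a, b)) = to_nat (a, Nat.iter k (F a) b)).
  { induction k as [|k IH]; intros a b; [easy|]. rewrite !Nat.iter_succ, IH. unfold G.
    now rewrite cancel_of_to. }
  apply (cfun_ext x (fun n => snd (of_nat (Nat.iter (g n) G (to_nat (p n, h n)))))).
  - intro n. now rewrite E, cancel_of_to.
  - apply cfun_snd'. apply (cfun_op x (fun k a => Nat.iter k G a)); auto using cfun2_iter, cfun_pair.
Qed.

Lemma cfun_S' f : cfun x f -> cfun x (fun n => S (f n)).
Proof. intro H. exact (cfun_comp x _ _ H (cfun_S x)). Qed.

Lemma cfun_pred' f : cfun x f -> cfun x (fun n => Nat.pred (f n)).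
Proof. intro H. exact (cfun_comp x _ _ H (cfun_pred x)). Qed.

Lemma cfun_prec F c (f : nat -> nat) : cfun2 x F -> f 0 = c -> (forall k, f (S k) = F k (f k)) ->
  cfun x f.
Proof.
  intros HF H0 HS.
  set (G := fun q => to_nat (S (fst (of_nat q)), F (fst (of_nat q)) (snd (of_nat q)))).
  assert (HG : cfun x G).
  { apply cfun_pair; [apply cfun_S', cfun_fst|]. apply (cfun_op x F); auto using cfun_fst, cfun_snd. }
  assert (E : forall k, Nat.iter k G (to_nat (0, c)) = to_nat (k, f k)).
  { induction k as [|k IH]; [now rewrite H0|]. rewrite !Nat.iter_succ, IH. unfold G.
    now rewrite cancel_of_to, HS. }
  apply (cfun_ext x (fun n => snd (of_nat (Nat.iter n G (to_nat (0, c)))))).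
  - intro n. now rewrite E, cancel_of_to.
  - apply cfun_snd'. apply (cfun_op x (fun k a => Nat.iter k G a));
      auto using cfun2_iter, cfun_const, cfun_id.
Qed.

Lemma cfun_add f g : cfun x f -> cfun x g -> cfun x (fun n => f n + g n).
Proof.
  intros Hf Hg. apply (cfun_ext x (fun n => Nat.iter (f n) S (g n))).
  - intro n. induction (f n) as [|k IH]; [easy|]. rewrite Nat.iter_succ, IH. easy.
  - apply (cfun_op x (fun k a => Nat.iter k S a)); auto using cfun2_iter, cfun_S.
Qed.

Lemma cfun_sub f g : cfun x f -> cfun x g -> cfun x (fun n => f n - g n).
Proof.
  intros Hf Hg. apply (cfun_ext x (fun n => Nat.iter (g n) Nat.pred (f n))).
  - intro n. induction (g n) as [|k IH]; [cbn; lia|]. rewrite Nat.iter_succ, IH; lia.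
  - apply (cfun_op x (fun k a => Nat.iter k Nat.pred a)); auto using cfun2_iter, cfun_pred.
Qed.

Lemma cfun_mul f g : cfun x f -> cfun x g -> cfun x (fun n => f n * g n).
Proof.
  intros Hf Hg. apply (cfun_ext x (fun n => Nat.iter (f n) (Nat.add (g n)) 0)).
  - intro n. induction (f n) as [|k IH]; [easy|]. rewrite Nat.iter_succ, IH. easy.
  - apply cfun_iterp; auto using cfun_const.
    apply cfun2_curry, cfun_add; auto using cfun_fst, cfun_snd.
Qed.

Definition cpred (P : nat -> bool) : Prop := cfun x (fun n => Nat.b2n (P n)).

Lemma cfun_if P g h : cpred P -> cfun x g -> cfun x h ->
  cfun x (fun n => if P n then g n else h n).
Proof.
  intros HP Hg Hh.
  apply (cfun_ext x (fun n => Nat.b2n (P n) * g n + (1 - Nat.b2n (P n)) * h n)).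
  - intro n. destruct (P n); cbn; lia.
  - auto using cfun_add, cfun_mul, cfun_sub, cfun_const.
Qed.

Lemma cpred_const b : cpred (fun _ => b).
Proof. exact (cfun_const x (Nat.b2n b)). Qed.

Lemma cpred_if P Q R : cpred P -> cpred Q -> cpred R -> cpred (fun n => if P n then Q n else R n).
Proof.
  intros HP HQ HR. apply (cfun_ext x (fun n => if P n then Nat.b2n (Q n) else Nat.b2n (R n))).
  - intro n; now destruct (P n).
  - now apply cfun_if.
Qed.

Lemma cpred_and P Q : cpred P -> cpred Q -> cpred (fun n => P n && Q n).
Proof.
  intros HP HQ. apply (cfun_ext x (fun n => Nat.b2n (if P n then Q n else false))).
  - intro n; now destruct (P n).
  - apply cpred_if; auto using cpred_const.
Qed.

Lemma cpred_eqb f g : cfun x f -> cfun x g -> cpred (fun n => Nat.eqb (f n) (g n)).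
Proof.
  intros Hf Hg. apply (cfun_ext x (fun n => 1 - ((f n - g n) + (g n - f n)))).
  - intro n. destruct (Nat.eqb_spec (f n) (g n)); cbn [Nat.b2n]; lia.
  - auto using cfun_add, cfun_sub, cfun_const.
Qed.

Lemma cpred_ltb f g : cfun x f -> cfun x g -> cpred (fun n => Nat.ltb (f n) (g n)).
Proof.
  intros Hf Hg. apply (cfun_ext x (fun n => 1 - (1 - (g n - f n)))).
  - intro n. destruct (Nat.ltb_spec (f n) (g n)); cbn [Nat.b2n]; lia.
  - auto using cfun_sub, cfun_const.
Qed.

Lemma cpred_comp P f : cpred P -> cfun x f -> cpred (fun n => P (f n)).
Proof. intros HP Hf. exact (cfun_comp x _ _ Hf HP). Qed.

Lemma cpred_beqb b P : cpred P -> cpred (fun n => Bool.eqb b (P n)).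
Proof.
  intro HP. apply (cfun_ext x (fun n => Nat.b2n (if P n then b else negb b))).
  - intro n. now destruct b, (P n).
  - apply cpred_if; auto using cpred_const.
Qed.

Lemma cpred_odd : cpred Nat.odd.
Proof.
  apply (cfun_prec (fun _ y => 1 - y) 0); [|easy|].
  - apply cfun2_curry. auto using cfun_sub, cfun_const, cfun_snd.
  - intro k. rewrite Nat.odd_succ, <- Nat.negb_odd. now destruct (Nat.odd k).
Qed.

Lemma cfun_div2 : cfun x Nat.div2.
Proof.
  apply (cfun_prec (fun k y => y + Nat.b2n (Nat.odd k)) 0); [|easy|].
  - apply cfun2_curry, cfun_add; [apply cfun_snd|].
    exact (cpred_comp _ _ cpred_odd (cfun_fst x)).
  - intro k. pose proof (Nat.div2_odd k) as H1. pose proof (Nat.div2_odd (S k)) as H2.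
    rewrite Nat.odd_succ, <- Nat.negb_odd in H2. destruct (Nat.odd k); cbn [Nat.b2n negb] in *; lia.
Qed.

Lemma cfun_pow2 f : cfun x f -> cfun x (fun n => 2 ^ f n).
Proof.
  intro Hf. apply (cfun_comp x f (fun n => 2 ^ n) Hf).
  apply (cfun_prec (fun _ y => y + y) 1); [|easy|].
  - apply cfun2_curry, cfun_add; apply cfun_snd.
  - intro k. cbn. lia.
Qed.

Lemma cpred_testbit f g : cfun x f -> cfun x g -> cpred (fun n => Nat.testbit (f n) (g n)).
Proof.
  intros Hf Hg. apply (cfun_ext x (fun n => Nat.b2n (Nat.odd (Nat.iter (g n) Nat.div2 (f n))))).
  - intro n. rewrite Nat.testbit_odd. do 2 f_equal.
  - apply (cpred_comp _ _ cpred_odd).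
    apply (cfun_op x (fun k a => Nat.iter k Nat.div2 a)); auto using cfun2_iter, cfun_div2.
Qed.

(** * Turing machine runs as functions on numbers *)

Definition wbit (a n : nat) (b : bool) : nat :=
  if b then (if Nat.testbit a n then a else a + 2 ^ n)
  else (if Nat.testbit a n then a - 2 ^ n else a).

Lemma testbit_wbit a n b : Nat.testbit (wbit a n b) = upd (Nat.testbit a) n b.
Proof.
  apply real_ext; intro m. unfold upd, wbit. destruct b, (Nat.testbit a n) eqn:E.
  - destruct (Nat.eqb_spec m n); congruence.
  - assert (L : Nat.land a (2 ^ n) = 0).
    { apply Nat.bits_inj_0; intro k. rewrite Nat.land_spec, Nat.pow2_bits_eqb.
      destruct (Nat.eqb_spec n k); subst; rewrite ?E, ?andb_false_r; easy. }
    rewrite Nat.add_nocarry_lxor by exact L. rewrite Nat.lxor_spec, Nat.pow2_bits_eqb.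
    destruct (Nat.eqb_spec n m), (Nat.eqb_spec m n); try congruence; subst.
    + now rewrite E.
    + now rewrite xorb_false_r.
  - assert (L : Nat.ldiff (2 ^ n) a = 0).
    { apply Nat.bits_inj_0; intro k. rewrite Nat.ldiff_spec, Nat.pow2_bits_eqb.
      destruct (Nat.eqb_spec n k); subst; rewrite ?E; easy. }
    rewrite Nat.sub_nocarry_ldiff by exact L. rewrite Nat.ldiff_spec, Nat.pow2_bits_eqb.
    destruct (Nat.eqb_spec n m), (Nat.eqb_spec m n); try congruence; subst.
    + now rewrite andb_false_r.
    + now rewrite andb_true_r.
  - destruct (Nat.eqb_spec m n); congruence.
Qed.

Lemma cfun_wbit f g b : cfun x f -> cfun x g -> cfun x (fun n => wbit (f n) (g n) b).
Proof.
  intros Hf Hg. unfold wbit.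
  destruct b; apply cfun_if; auto using cfun_add, cfun_sub, cfun_pow2, cpred_testbit.
Qed.

(* Configurations with finitely many marks, coded as numbers. *)
Definition q_st (q : nat) := fst (of_nat q).
Definition q_hd (q : nat) := fst (of_nat (snd (of_nat q))).
Definition q_in (q : nat) := fst (of_nat (snd (of_nat (snd (of_nat q))))).
Definition q_sc (q : nat) := fst (of_nat (snd (of_nat (snd (of_nat (snd (of_nat q))))))).
Definition q_out (q : nat) := snd (of_nat (snd (of_nat (snd (of_nat (snd (of_nat q))))))).
Definition q_mk (s h i c o : nat) := to_nat (s, to_nat (h, to_nat (i, to_nat (c, o)))).

Definition qcfg (q : nat) : config :=
  mkConfig (q_st q) (q_hd q) (Nat.testbit (q_in q)) (Nat.testbit (q_sc q)) (Nat.testbit (q_out q)).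

Lemma qcfg_mk s h i c o : qcfg (q_mk s h i c o)
  = mkConfig s h (Nat.testbit i) (Nat.testbit c) (Nat.testbit o).
Proof.
  unfold qcfg, q_st, q_hd, q_in, q_sc, q_out, q_mk. now rewrite !cancel_of_to; cbn [fst snd];
  rewrite !cancel_of_to; cbn [fst snd]; rewrite !cancel_of_to; cbn [fst snd]; rewrite !cancel_of_to.
Qed.

Lemma cfun_mk f1 f2 f3 f4 f5 : cfun x f1 -> cfun x f2 -> cfun x f3 -> cfun x f4 -> cfun x f5 ->
  cfun x (fun n => q_mk (f1 n) (f2 n) (f3 n) (f4 n) (f5 n)).
Proof. intros; unfold q_mk; auto using cfun_pair. Qed.

Lemma cfun_q : cfun x q_st /\ cfun x q_hd /\ cfun x q_in /\ cfun x q_sc /\ cfun x q_out.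
Proof.
  unfold q_st, q_hd, q_in, q_sc, q_out.
  repeat split; auto using cfun_fst, cfun_snd, cfun_fst', cfun_snd'.
Qed.

Definition q_match (i : instr) (q : nat) : bool :=
  Nat.eqb (st i) (q_st q) && Bool.eqb (r_in i) (Nat.testbit (q_in q) (q_hd q))
  && Bool.eqb (r_sc i) (Nat.testbit (q_sc q) (q_hd q))
  && Bool.eqb (r_out i) (Nat.testbit (q_out q) (q_hd q))
  && Bool.eqb (r_or i) (x (q_hd q)).

Definition q_apply (i : instr) (q : nat) : nat :=
  q_mk (nst i) (match mv i with MoveL => Nat.pred (q_hd q) | MoveR => S (q_hd q) end)
    (wbit (q_in q) (q_hd q) (w_in i)) (wbit (q_sc q) (q_hd q) (w_sc i))
    (wbit (q_out q) (q_hd q) (w_out i)).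

Fixpoint q_step (p : program) (q : nat) : nat :=
  match p with [] => q | i :: p => if q_match i q then q_apply i q else q_step p q end.

Fixpoint q_halt (p : program) (q : nat) : bool :=
  match p with [] => true | i :: p => if q_match i q then false else q_halt p q end.

Lemma q_step_spec p q : nxt p x (qcfg q) = qcfg (q_step p q) /\
  (q_halt p q = true <-> step p x (qcfg q) = None).
Proof.
  unfold nxt, step. induction p as [|i p IH]; [easy|].
  cbn [q_step q_halt]. unfold lookup in *. cbn [find].
  change (q_match i q) with (Nat.eqb (st i) (state (qcfg q))
                 && Bool.eqb (r_in i) (tin (qcfg q) (head (qcfg q)))
                 && Bool.eqb (r_sc i) (tsc (qcfg q) (head (qcfg q)))
                 && Bool.eqb (r_out i) (tout (qcfg q) (head (qcfg q)))
                 && Bool.eqb (r_or i) (x (head (qcfg q)))).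
  destruct (Nat.eqb (st i) (state (qcfg q)) && _ && _ && _ && _); [|exact IH].
  split; [|easy]. change (apply_instr i (qcfg q) = qcfg (q_apply i q)). unfold apply_instr, q_apply. rewrite qcfg_mk, !testbit_wbit. reflexivity.
Qed.

Lemma cpred_match i : cpred (q_match i).
Proof.
  destruct cfun_q as (H1 & H2 & H3 & H4 & H5). unfold q_match.
  repeat apply cpred_and; try apply cpred_beqb; auto using cpred_testbit, cpred_eqb, cfun_const.
  exact (cpred_comp x (q_hd) (cfun_oracle x) H2).
Qed.

Lemma cfun_apply i : cfun x (q_apply i).
Proof.
  destruct cfun_q as (H1 & H2 & H3 & H4 & H5). unfold q_apply.
  apply cfun_mk; auto using cfun_const, cfun_wbit.
  destruct (mv i); auto using cfun_pred', cfun_S'.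
Qed.

Lemma cfun_q_step p : cfun x (q_step p).
Proof.
  induction p as [|i p IH]; [apply cfun_id|]. cbn [q_step].
  apply cfun_if; auto using cpred_match, cfun_apply.
Qed.

Lemma cpred_q_halt p : cpred (q_halt p).
Proof.
  induction p as [|i p IH]; [apply cpred_const|]. cbn [q_halt].
  apply cpred_if; auto using cpred_match, cpred_const.
Qed.

Lemma run_iter p c d k : run p x c k = Some d -> Nat.iter k (nxt p x) c = d.
Proof.
  revert d; induction k as [|k IH]; intros d H; [now injection H|].
  cbn in H. destruct (run p x c k) as [e|]; [|easy].
  rewrite Nat.iter_succ, (IH e eq_refl). unfold nxt. now rewrite H.
Qed.

(** The converse of compilation, needed to process reals given only by a Turing machine.
    Configurations become numbers, the run an iteration, and the halting time an unbounded search
    that succeeds since the machine is total. *)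
Theorem cpred_of_turing z : turing_computable_from z x -> cpred z.
Proof.
  intros [p Hp].
  (* The binary digits of [2 ^ n - 1] are the unary code of [n]. *)
  set (q0 := fun n => q_mk 0 0 (2 ^ n - 1) 0 0).
  assert (Hq0 : forall n, qcfg (q0 n) = init_config (unary n)).
  { intro n. unfold q0. rewrite qcfg_mk. unfold init_config. f_equal;
      try (apply real_ext; intro; now rewrite Nat.bits_0).
    apply real_ext; intro m. unfold unary.
    replace (2 ^ n - 1) with (Nat.ones n) by (rewrite Nat.ones_equiv; lia).
    destruct (Nat.ltb_spec m n); [now apply Nat.ones_spec_low|now apply Nat.ones_spec_high]. }
  assert (Hiter : forall n k, qcfg (Nat.iter k (q_step p) (q0 n))
    = Nat.iter k (nxt p x) (init_config (unary n))).
  { intros n k; induction k as [|k IH]; [apply Hq0|]. rewrite !Nat.iter_succ.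
    now rewrite <- IH, (proj1 (q_step_spec p _)). }
  set (hk := fun n k => q_halt p (Nat.iter k (q_step p) (q0 n))).
  assert (Hh : exists h, forall n, hk n (h n) = true /\ forall k, k < h n -> hk n k <> true).
  { apply (choice_fun (fun n h => hk n h = true /\ forall k, k < h -> hk n k <> true)). intro n.
    destruct (Hp n) as (k & d & H1 & H2 & _).
    assert (Hk : hk n k = true).
    { apply q_step_spec. now rewrite Hiter, (run_iter _ _ _ _ H1). }
    exact (nat_least (fun k => hk n k = true) k Hk). }
  destruct Hh as [h Hh].
  assert (Cq0 : cfun x q0).
  { apply cfun_mk; auto using cfun_const. apply cfun_sub; auto using cfun_const, cfun_pow2, cfun_id. }
  assert (Crun : forall f g, cfun x f -> cfun x g ->
    cfun x (fun n => Nat.iter (f n) (q_step p) (q0 (g n)))).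
  { intros f g Hf Hg. apply (cfun_op x (fun k a => Nat.iter k (q_step p) a));
      [apply cfun2_iter, cfun_q_step|exact Hf|exact (cfun_comp x _ _ Hg Cq0)]. }
  assert (Ch : cfun x h).
  { apply (cfun_mu x (fun n k => 1 - Nat.b2n (hk n k))).
    - apply cfun2_curry, cfun_sub; [apply cfun_const|]. unfold hk.
      apply (cpred_comp (q_halt p)); [apply cpred_q_halt|].
      apply Crun; auto using cfun_fst, cfun_snd.
    - intro n. destruct (Hh n) as [H1 H2]. rewrite H1. split; [easy|].
      intros k Hk. specialize (H2 k Hk). destruct (hk n k); easy. }
  apply (cfun_ext x (fun n => Nat.b2n (Nat.testbit (q_out (Nat.iter (h n) (q_step p) (q0 n))) 0))).
  - intro n. f_equal. destruct (Hp n) as (k & d & H1 & H2 & <-).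
    destruct (Hh n) as [Hn1 Hn2].
    change (tout (qcfg (Nat.iter (h n) (q_step p) (q0 n))) 0 = tout d 0).
    assert (Hk : hk n k = true).
    { apply q_step_spec. now rewrite Hiter, (run_iter _ _ _ _ H1). }
    (* The given halting count [k] may exceed the first one, but [nxt] fixes a halted configuration,
       so the output bit is the same. *)
    assert (Hle : h n <= k).
    { destruct (le_lt_dec (h n) k); [easy|]. exfalso. exact (Hn2 k l Hk). }
    rewrite <- (run_iter _ _ _ _ H1), Hiter. replace k with ((k - h n) + h n) by lia.
    rewrite Nat.iter_add. set (c := Nat.iter (h n) _ _).
    assert (Hc : nxt p x c = c).
    { unfold nxt. unfold c. rewrite <- Hiter. apply (proj2 (q_step_spec p _)) in Hn1.
      now rewrite Hn1. }
    f_equal. induction (k - h n) as [|j IH]; [easy|]. rewrite Nat.iter_succ. congruence.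
  - apply cpred_testbit; [|apply cfun_const].
    exact (cfun_comp x _ _ (Crun h (fun n => n) Ch (cfun_id x)) (proj2 (proj2 (proj2 (proj2 cfun_q))))).
Qed.

Theorem turing_of_cpred z : cpred z -> turing_computable_from z x.
Proof.
  intro H. destruct (H 1 (le_n 1)) as [c Hc]. apply (compile x z (CSeq (cmv 0 1) c)).
  intro n. eexists; split.
  - eapply ESeq; [apply exec_mv; lia|]. apply Hc.
    + eqb_simp; auto.
    + intros r Hr. eqb_simp; auto.
  - unfold rset. cbn. destruct (z n); easy.
Qed.

End Arithmetic.

(** * Operations on Turing computable well-orders *)

Lemma turing_refl x : turing_computable_from x x.
Proof. apply turing_of_cpred, cfun_oracle. Qed.

Definition std_code : real := fun k => Nat.ltb (fst (of_nat k)) (snd (of_nat k)).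

Lemma turing_std x : turing_computable_from std_code x.
Proof. apply turing_of_cpred, cpred_ltb; auto using cfun_fst, cfun_snd. Qed.

(* The order [z] with a new largest element, which is [0]. *)
Definition succ_code (z : real) : real := fun k =>
  if Nat.eqb (fst (of_nat k)) 0 then false else
  if Nat.eqb (snd (of_nat k)) 0 then true else
  z (to_nat (Nat.pred (fst (of_nat k)), Nat.pred (snd (of_nat k)))).

Lemma turing_succ x z : turing_computable_from z x -> turing_computable_from (succ_code z) x.
Proof.
  intro H. apply cpred_of_turing in H. apply turing_of_cpred. unfold succ_code.
  repeat apply cpred_if; auto using cpred_const, cpred_eqb, cfun_fst, cfun_snd, cfun_const.
  apply (cpred_comp x z); [exact H|]. auto using cfun_pair, cfun_pred', cfun_fst, cfun_snd.
Qed.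

Definition sub_code (z : real) (g : nat -> nat) : real := fun k =>
  z (to_nat (g (fst (of_nat k)), g (snd (of_nat k)))).

(** An initial segment has to be recoded as an order on all of [nat]: [nx k] searches for the least
    predecessor of [m] that is at least [k], which terminates because the segment is infinite, and
    iterating it enumerates the segment increasingly. *)
Lemma turing_sub x z m : turing_computable_from z x ->
  (forall k, exists n, k < n /\ rel_of z n m) ->
  exists g, (forall i j, i < j -> g i < g j) /\ (forall i, rel_of z (g i) m) /\
    (forall n, rel_of z n m -> exists i, g i = n) /\
    turing_computable_from (sub_code z g) x.
Proof.
  intros Hz Hinf. apply cpred_of_turing in Hz.
  set (ok := fun k n => Nat.ltb k (S n) && z (to_nat (n, m))).
  assert (Hnx : exists nx, forall k, ok k (nx k) = true /\ forall j, j < nx k -> ok k j <> true).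
  { apply (choice_fun (fun k h => ok k h = true /\ forall j, j < h -> ok k j <> true)).
    intro k. destruct (Hinf k) as [n [H1 H2]].
    apply (nat_least (fun n => ok k n = true) n).
    unfold ok. rewrite andb_true_iff, Nat.ltb_lt. split; [lia|].
    unfold rel_of in H2. now rewrite pair_to_nat in H2. }
  destruct Hnx as [nx Hnx].
  assert (Cnx : cfun x nx).
  { apply (cfun_mu x (fun k n => 1 - Nat.b2n (ok k n))).
    - apply cfun2_curry, cfun_sub; [apply cfun_const|]. unfold ok. apply cpred_and.
      + apply cpred_ltb; auto using cfun_fst, cfun_snd, cfun_S'.
      + apply (cpred_comp x z); [exact Hz|]. auto using cfun_pair, cfun_snd, cfun_const.
    - intro k. destruct (Hnx k) as [H1 H2]. rewrite H1. split; [easy|].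
      intros n Hn. specialize (H2 n Hn). now destruct (ok k n). }
  set (g := fun i => Nat.iter i (fun a => nx (S a)) (nx 0)).
  assert (Cg : cfun x g).
  { apply (cfun_op x (fun k a => Nat.iter k (fun a => nx (S a)) a)); auto using cfun_id, cfun_const.
    apply cfun2_iter. exact (cfun_comp x _ _ (cfun_S x) Cnx). }
  assert (Hlow : forall k, k <= nx k /\ rel_of z (nx k) m).
  { intro k. destruct (Hnx k) as [H _]. unfold ok in H.
    rewrite andb_true_iff, Nat.ltb_lt in H. unfold rel_of. rewrite pair_to_nat. split; [lia|tauto]. }
  assert (HS : forall i, g (S i) = nx (S (g i))) by reflexivity.
  exists g. split; [|split; [|split]].
  - induction 1.
    + rewrite HS. specialize (Hlow (S (g i))). lia.
    + rewrite HS. specialize (Hlow (S (g m0))). lia.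
  - intros [|i]; apply Hlow.
  - intros n Hn. unfold rel_of in Hn. rewrite pair_to_nat in Hn.
    assert (Hge : forall i, i <= g i).
    { induction i as [|i IH]; [lia|]. rewrite HS. specialize (Hlow (S (g i))). lia. }
    assert (Hmin : forall k, k <= n -> nx k <= n).
    { intros k Hk. destruct (le_lt_dec (nx k) n) as [H|H]; [exact H|]. exfalso.
      apply (proj2 (Hnx k) n H). unfold ok. rewrite Hn, andb_true_r. apply Nat.ltb_lt; lia. }
    assert (K : forall i, n < g i -> exists j, g j = n).
    { induction i as [|i IH]; intro Hi.
      - specialize (Hmin 0 ltac:(lia)). cbn in Hi. lia.
      - destruct (lt_eq_lt_dec (g i) n) as [[H|H]|H]; [|eauto|auto].
        specialize (Hmin (S (g i)) ltac:(lia)). rewrite HS in Hi. lia. }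
    apply (K (S n)). specialize (Hge (S n)). lia.
  - apply turing_of_cpred. unfold sub_code. apply (cpred_comp x z); [exact Hz|].
    apply cfun_pair.
    + exact (cfun_comp x _ _ (cfun_fst x) Cg).
    + exact (cfun_comp x _ _ (cfun_snd x) Cg).
Qed.

Lemma rel_pair (z : real) n m : rel_of z n m <-> z (to_nat (n, m)) = true.
Proof. unfold rel_of. now rewrite pair_to_nat. Qed.

(** * Continuity of oracle computations *)

Lemma run_agree p c k : forall x d, run p x c k = Some d ->
  exists m, forall x', agree m x x' -> run p x' c k = Some d.
Proof.
  induction k as [|k IH]; intros x d H; [exists 0; auto|].
  cbn in *. destruct (run p x c k) as [e|] eqn:E; [|easy].
  destruct (IH x e E) as [m Hm]. exists (m + S (head e)). intros x' Hx.
  rewrite Hm by (apply (agree_le m (m + S (head e))); [lia|exact Hx]).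
  rewrite <- H. unfold step, lookup. now rewrite (Hx (head e)) by lia.
Qed.

Definition tval (p : program) (n : nat) (b : bool) (x : real) : Prop :=
  exists k d, run p x (init_config (unary n)) k = Some d /\ step p x d = None /\ tout d 0 = b.

Lemma popen_tval p n b : popen (tval p n b).
Proof.
  intros x (k & d & H1 & H2 & H3). destruct (run_agree _ _ _ _ _ H1) as [m Hm].
  exists (m + S (head d)). intros x' Hx. exists k, d. split; [|split; [|exact H3]].
  - apply Hm. apply (agree_le m (m + S (head d))); [lia|exact Hx].
  - rewrite <- H2. unfold step, lookup. now rewrite (Hx (head d)) by lia.
Qed.

Lemma tval_fun p n b b' x : tval p n b x -> tval p n b' x -> b = b'.
Proof.
  intros (k & d & H1 & H2 & <-) (k' & d' & H1' & H2' & <-).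
  assert (K : forall k k' d d', k < k' -> run p x (init_config (unary n)) k = Some d ->
    step p x d = None -> run p x (init_config (unary n)) k' = Some d' -> False).
  { clear. intros k k' d d' Hk. revert d'. induction Hk as [|k' Hk IH]; intros d' H1 H2 H3.
    - cbn in H3. rewrite H1, H2 in H3. discriminate.
    - cbn in H3. destruct (run p x _ k') as [e|] eqn:E; [|discriminate].
      exact (IH e H1 H2 eq_refl). }
  destruct (lt_eq_lt_dec k k') as [[H|H]|H].
  - exfalso; eauto.
  - subst k'. congruence.
  - exfalso; eauto.
Qed.

Lemma turing_tval z x : turing_computable_from z x <-> exists p, forall n, tval p n (z n) x.
Proof. reflexivity. Qed.

Lemma countable_program : countable program.
Proof.
  apply countable_list.
  set (B := bool).
  apply (countable_map (nat * (B * B * B * B) * (nat * (B * B * B * B)))%type instr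
    (fun '(s, (a, b, c, d), (s', (e, f, g, m))) =>
      mkInstr s a b c d s' e f g (if m then MoveL else MoveR))).
  - intros [s a b c d s' e f g m].
    exists (s, (a, b, c, d), (s', (e, f, g, match m with MoveL => true | MoveR => false end))).
    now destruct m.
  - auto 10 using countable_prod, countable_nat, countable_bool.
Qed.

(** * Ranks and order types *)

Section Rank.

Context (R : nat -> nat -> Prop).

Fixpoint accrk (n : nat) (a : Acc R n) {struct a} : Om :=
  least (fun i => forall m (h : R m n), olt (accrk m (Acc_inv a h)) i).

(** Outside the well-founded part the rank is the default zero, so statements about ranks carry
    [Acc]. *)
Definition rk (n : nat) : Om :=
  match excluded_middle_informative (Acc R n) with
  | left a => accrk n a | right _ => ozero end.

Lemma rk_acc n (a : Acc R n) : rk n = accrk n a.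
Proof.
  unfold rk. destruct (excluded_middle_informative (Acc R n)) as [a'|]; [|easy].
  now rewrite (proof_irrelevance _ a' a).
Qed.

Lemma rk_eq n : Acc R n -> rk n = least (fun i => forall m, R m n -> olt (rk m) i).
Proof.
  intro a. rewrite (rk_acc n a). destruct a as [a]. cbn. apply least_ext. intro i.
  split; intros H m h.
  - rewrite (rk_acc m (a m h)). apply H.
  - rewrite <- rk_acc. auto.
Qed.

Lemma rk_spec n : Acc R n -> is_least (fun i => forall m, R m n -> olt (rk m) i) (rk n).
Proof.
  intro a. rewrite (rk_eq n a). apply least_spec.
  destruct (Om_bounded rk) as [b Hb]. exists b; auto.
Qed.

Lemma rk_lt m n : Acc R n -> R m n -> olt (rk m) (rk n).
Proof. intros a. now apply (rk_spec n a). Qed.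

Lemma rk_le n i : Acc R n -> (forall m, R m n -> olt (rk m) i) -> ole (rk n) i.
Proof. intros a. now apply (rk_spec n a). Qed.

End Rank.

(** The image of [h] is closed under predecessors and [h] preserves the relation both ways, so the
    recursive computations of the two ranks coincide. *)
Lemma rk_transfer (R R' : nat -> nat -> Prop) (h : nat -> nat) :
  (forall a b, R' a b <-> R (h a) (h b)) ->
  (forall b n, R n (h b) -> exists a, h a = n) ->
  forall b, Acc R (h b) -> Acc R' b /\ rk R' b = rk R (h b).
Proof.
  intros H1 H2 b Hb. remember (h b) as n eqn:En. revert b En.
  induction Hb as [n Hn IH]; intros b ->.
  assert (A : Acc R (h b)) by now constructor.
  assert (A' : Acc R' b).
  { constructor. intros a Ha. apply H1 in Ha. exact (proj1 (IH _ Ha a eq_refl)). }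
  split; [exact A'|]. apply ole_antisym; apply rk_le; auto.
  - intros a Ha. pose proof (proj1 (H1 _ _) Ha) as Ha'.
    rewrite (proj2 (IH _ Ha' a eq_refl)). now apply rk_lt.
  - intros m Hm. destruct (H2 b m Hm) as [a <-]. rewrite <- (proj2 (IH _ Hm a eq_refl)).
    apply rk_lt; [exact A'|]. now apply H1.
Qed.

Lemma rk_emb (R R' : nat -> nat -> Prop) (g : nat -> nat) :
  (forall a b, R a b -> R' (g a) (g b)) ->
  forall a, Acc R a -> Acc R' (g a) -> ole (rk R a) (rk R' (g a)).
Proof.
  intros H a Ha. induction Ha as [a Ha IH]. intro Ha'. apply rk_le; [now constructor|].
  intros m Hm. eapply ole_lt_trans; [apply IH; [exact Hm|]|].
  - apply (Acc_inv Ha'). auto.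
  - apply rk_lt; auto.
Qed.

Definition otp (z : real) : Om := least (fun i => forall n, olt (rk (rel_of z) n) i).

Lemma otp_spec z : is_least (fun i => forall n, olt (rk (rel_of z) n) i) (otp z).
Proof. apply least_spec, Om_bounded. Qed.

Lemma otp_lt z n : olt (rk (rel_of z) n) (otp z).
Proof. apply otp_spec. Qed.

Lemma otp_le z i : (forall n, olt (rk (rel_of z) n) i) -> ole (otp z) i.
Proof. apply otp_spec. Qed.

Section WellOrder.

Context (z : real).
Hypothesis Hz : WO z.

Let trans : forall n m k, rel_of z n m -> rel_of z m k -> rel_of z n k := proj1 (proj2 Hz).
Let total : forall n m, n = m \/ rel_of z n m \/ rel_of z m n := proj1 (proj2 (proj2 Hz)).
Let wf : well_founded (rel_of z) := proj2 (proj2 (proj2 Hz)).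

Lemma rel_rk n m : rel_of z n m <-> olt (rk (rel_of z) n) (rk (rel_of z) m).
Proof.
  split; [apply rk_lt, wf|]. intro H. destruct (total n m) as [->|[E|E]]; [|exact E|].
  - now apply olt_irrefl in H.
  - exfalso. apply (olt_irrefl (rk (rel_of z) n)). eapply olt_trans; [exact H|].
    apply rk_lt; auto.
Qed.

Lemma rk_inj n m : rk (rel_of z) n = rk (rel_of z) m -> n = m.
Proof.
  intro H. destruct (total n m) as [E|[E|E]]; [exact E| |]; apply rel_rk in E;
    rewrite H in E; now apply olt_irrefl in E.
Qed.

Lemma rk_onto n i : olt i (rk (rel_of z) n) -> exists m, rel_of z m n /\ rk (rel_of z) m = i.
Proof.
  induction (wf n) as [n _ IH]. intro Hi.
  assert (H : exists m, rel_of z m n /\ ole i (rk (rel_of z) m)).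
  { apply NNPP; intro H. apply (olt_irrefl i). eapply olt_le_trans; [exact Hi|].
    apply rk_le; [apply wf|]. intros m Hm. apply not_ole; intro; eauto. }
  destruct H as [m [Hm [->|H]]]; [eauto|]. destruct (IH m Hm H) as [k [Hk <-]].
  exists k; split; [eapply trans; eauto|easy].
Qed.

Lemma otp_onto i : olt i (otp z) -> exists m, rk (rel_of z) m = i.
Proof.
  intro Hi. assert (H : exists m, ole i (rk (rel_of z) m)).
  { apply NNPP; intro H. apply (olt_irrefl i). eapply olt_le_trans; [exact Hi|].
    apply otp_le. intro m. apply not_ole; intro; eauto. }
  destruct H as [m [->|H]]; [eauto|]. destruct (rk_onto m i H) as [k [_ Hk]]; eauto.
Qed.

End WellOrder.

(** Ranks are invariant under isomorphism; conversely, matching the points of equal rank is an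
    isomorphism, as both orders realize exactly the ranks below their type. *)
Lemma cong_otp z w : WO z -> WO w -> (cong_WO z w <-> otp z = otp w).
Proof.
  intros Hz Hw. split.
  - intros (_ & _ & f & g & H1 & H2 & H3).
    assert (E : forall n, rk (rel_of z) n = rk (rel_of w) (f n)).
    { intro n. apply (rk_transfer (rel_of w) (rel_of z) f); [exact H3| |apply Hw].
      intros b m _. exists (g m); apply H2. }
    apply ole_antisym; apply otp_le; intro n.
    + rewrite E; apply otp_lt.
    + rewrite <- (H2 n), <- E. apply otp_lt.
  - intro E. split; [exact Hz|split; [exact Hw|]].
    assert (F : forall n, exists m, rk (rel_of w) m = rk (rel_of z) n).
    { intro n. apply otp_onto; [exact Hw|]. rewrite <- E. apply otp_lt. }
    assert (G : forall n, exists m, rk (rel_of z) m = rk (rel_of w) n).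
    { intro n. apply otp_onto; [exact Hz|]. rewrite E. apply otp_lt. }
    destruct (choice_fun _ F) as [f Hf], (choice_fun _ G) as [g Hg]. exists f, g.
    repeat split.
    + intro n. apply (rk_inj z Hz). now rewrite Hg, Hf.
    + intro n. apply (rk_inj w Hw). now rewrite Hf, Hg.
    + intro H. apply (rel_rk w Hw). rewrite !Hf. now apply (rel_rk z Hz).
    + intro H. apply (rel_rk z Hz). rewrite <- !Hf. now apply (rel_rk w Hw).
Qed.

Lemma emb_of_otp z w i : WO z -> WO w -> ole (otp z) i -> ole i (otp w) ->
  exists F, forall n, rk (rel_of w) (F n) = rk (rel_of z) n /\ olt (rk (rel_of w) (F n)) i.
Proof.
  intros Hz Hw H1 H2.
  apply (choice_fun (fun n m => rk (rel_of w) m = rk (rel_of z) n /\ olt (rk (rel_of w) m) i)).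
  intro n. assert (H : olt (rk (rel_of z) n) i) by (eapply olt_le_trans; [apply otp_lt|exact H1]).
  destruct (otp_onto w Hw (rk (rel_of z) n)) as [m Hm]; [eapply olt_le_trans; eauto|].
  exists m. now rewrite Hm.
Qed.

Lemma WO_inverse (R : real) (h : nat -> nat) (R' : real) :
  (forall a b, rel_of R' a b <-> rel_of R (h a) (h b)) ->
  (forall a b, h a = h b -> a = b) -> WO R -> WO R'.
Proof.
  intros H Hinj (H1 & H2 & H3 & H4). split; [|split; [|split]].
  - intros n. rewrite H. apply H1.
  - intros n m k. rewrite !H. apply H2.
  - intros n m. rewrite !H. destruct (H3 (h n) (h m)) as [E|E]; auto.
  - intro n. assert (K : forall a, Acc (rel_of R) a -> forall n, a = h n -> Acc (rel_of R') n).
    { induction 1 as [a _ IH]; intros k ->. constructor. intros b Hb. apply H in Hb. eauto. }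
    exact (K (h n) (H4 (h n)) n eq_refl).
Qed.

Lemma rel_std n m : rel_of std_code n m <-> n < m.
Proof. rewrite rel_pair. unfold std_code. rewrite cancel_of_to. apply Nat.ltb_lt. Qed.

Lemma WO_std : WO std_code.
Proof.
  split; [|split; [|split]].
  - intro n; rewrite rel_std; lia.
  - intros n m k; rewrite !rel_std; lia.
  - intros n m; rewrite !rel_std; lia.
  - intro n. induction (lt_wf n) as [n _ IH]. constructor. intros m Hm. apply IH. now apply rel_std.
Qed.

Lemma rel_succ z n m : rel_of (succ_code z) n m <->
  match n, m with 0, _ => False | S _, 0 => True | S n, S m => rel_of z n m end.
Proof.
  rewrite rel_pair. unfold succ_code. rewrite cancel_of_to. cbn [fst snd].
  destruct n as [|n], m as [|m]; cbn [Nat.eqb Nat.pred]; rewrite ?rel_pair; intuition congruence.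
Qed.

Lemma WO_succ z : WO z -> WO (succ_code z) /\ olt (otp z) (otp (succ_code z)).
Proof.
  intros Hz. pose proof Hz as (H1 & H2 & H3 & H4).
  assert (A : forall n, Acc (rel_of (succ_code z)) (S n)).
  { intro n. induction (H4 n) as [n _ IH]. constructor. intros [|m] Hm; apply rel_succ in Hm; [easy|].
    now apply IH. }
  assert (A' : well_founded (rel_of (succ_code z))).
  { intros [|n]; [|apply A]. constructor. intros [|m] Hm; apply rel_succ in Hm; [easy|apply A]. }
  split.
  - split; [|split; [|split]].
    + intros [|n]; rewrite rel_succ; [tauto|apply H1].
    + intros [|n] [|m] [|k]; rewrite !rel_succ; try tauto. apply H2.
    + intros [|n] [|m]; rewrite !rel_succ; try tauto.
      destruct (H3 n m) as [->|E]; auto.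
    + exact A'.
  - eapply ole_lt_trans; [|apply (otp_lt (succ_code z) 0)]. apply otp_le. intro n.
    eapply ole_lt_trans; [apply (rk_emb (rel_of z) (rel_of (succ_code z)) S)|].
    + intros a b Hab. now apply rel_succ.
    + apply H4.
    + apply A.
    + apply rk_lt; [apply A'|]. now apply rel_succ.
Qed.

(** * The supremum of the computable ordinals *)

Definition sig (x : real) : Om :=
  least (fun i => forall z, turing_computable_from z x -> WO z -> ole (otp z) i).

Lemma turing_bounded (x : real) (f : real -> Om) :
  exists b, forall z, turing_computable_from z x -> olt (f z) b.
Proof.
  destruct countable_program as [e He].
  destruct (Om_bounded (fun k => f (fun n => asb (tval (e k) n true x)))) as [b Hb].
  exists b. intros z Hz. apply turing_tval in Hz as [p Hp]. destruct (He p) as [k <-].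
  replace z with (fun n => asb (tval (e k) n true x)); [apply Hb|].
  apply real_ext; intro n. apply bool_ext. rewrite asbP. split; intro H.
  - exact (tval_fun _ _ _ _ _ (Hp n) H).
  - rewrite <- H. apply Hp.
Qed.

Lemma sig_spec x :
  is_least (fun i => forall z, turing_computable_from z x -> WO z -> ole (otp z) i) (sig x).
Proof.
  apply least_spec. destruct (turing_bounded x otp) as [b Hb]. exists b.
  intros z Hz _. right; auto.
Qed.

(** Strict, because a new largest element can be added computably: the supremum is not attained. *)
Lemma sig_lt x z : turing_computable_from z x -> WO z -> olt (otp z) (sig x).
Proof.
  intros Hz Wz. destruct (WO_succ z Wz) as [Wz' L].
  eapply olt_le_trans; [exact L|]. apply sig_spec; [now apply turing_succ|exact Wz'].
Qed.

Lemma sig_lt_ex x i : olt i (sig x) ->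
  exists z, turing_computable_from z x /\ WO z /\ olt i (otp z).
Proof.
  intro H. apply NNPP; intro N. apply (olt_irrefl i). eapply olt_le_trans; [exact H|].
  apply sig_spec. intros z Hz Wz. apply not_olt; intro; apply N; eauto.
Qed.

(** By pigeonhole: the infinitely many points of [w] have distinct ranks, all realized below [m]. *)
Lemma segment_infinite z w m : WO z -> WO w -> rk (rel_of z) m = otp w ->
  forall k, exists n, k < n /\ rel_of z n m.
Proof.
  intros Hz Hw Hm k. apply NNPP; intro N.
  assert (F : forall a, exists n, rk (rel_of z) n = rk (rel_of w) a /\ rel_of z n m).
  { intro a. destruct (rk_onto z Hz m (rk (rel_of w) a)) as [n [H1 H2]]; [|eauto].
    rewrite Hm. apply otp_lt. }
  destruct (choice_fun _ F) as [f Hf].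
  assert (Hinj : forall a b, f a = f b -> a = b).
  { intros a b E. apply (rk_inj w Hw). rewrite <- (proj1 (Hf a)), <- (proj1 (Hf b)). now rewrite E. }
  assert (L : length (map f (seq 0 (S (S k)))) <= length (seq 0 (S k))).
  { apply NoDup_incl_length.
    - apply Injective_map_NoDup; [exact Hinj|apply seq_NoDup].
    - intros n Hn. apply in_map_iff in Hn as [a [<- _]]. apply in_seq. split; [lia|].
      destruct (le_lt_dec (f a) k); [lia|]. exfalso. apply N. exists (f a); split; [easy|apply Hf]. }
  rewrite length_map, !length_seq in L. lia.
Qed.

(** Here [w] orders all of [nat], so its type is infinite. If it lies below the supremum, it is the
    type of an infinite initial segment of some computable well-order, which [turing_sub]
    recodes. *)
Lemma ck_ordinal_sig x w : WO w -> (ck_ordinal x w <-> olt (otp w) (sig x)).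
Proof.
  intro Hw. split.
  - intros (z & H1 & H2 & H3). apply cong_otp in H3; auto. rewrite <- H3. now apply sig_lt.
  - intro H. destruct (sig_lt_ex x _ H) as (z & H1 & H2 & H3).
    destruct (otp_onto z H2 _ H3) as [m Hm].
    destruct (turing_sub x z m H1 (segment_infinite z w m H2 Hw Hm)) as (g & G1 & G2 & G3 & G4).
    assert (Hrel : forall a b, rel_of (sub_code z g) a b <-> rel_of z (g a) (g b)).
    { intros a b. rewrite !rel_pair. unfold sub_code. now rewrite cancel_of_to. }
    assert (Ginj : forall a b, g a = g b -> a = b).
    { intros a b E. destruct (lt_eq_lt_dec a b) as [[L|L]|L]; [|exact L|];
        apply G1 in L; lia. }
    assert (W : WO (sub_code z g)) by exact (WO_inverse z g _ Hrel Ginj H2).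
    exists (sub_code z g). split; [exact G4|split; [exact W|]].
    apply cong_otp; auto. rewrite <- Hm.
    assert (E : forall a, rk (rel_of (sub_code z g)) a = rk (rel_of z) (g a)).
    { intro a. apply (rk_transfer (rel_of z) _ g Hrel); [|apply H2].
      intros b n Hn. apply G3. destruct H2 as (_ & T & _). eapply T; [exact Hn|apply G2]. }
    apply ole_antisym.
    + apply otp_le. intro n. rewrite E. apply (rel_rk z H2). apply G2.
    + apply rk_le; [apply H2|]. intros n Hn. destruct (G3 n Hn) as [a <-]. rewrite <- E. apply otp_lt.
Qed.

Lemma codes_sup_of_otp x v : WO v -> otp v = sig x -> codes_sup_ck x v.
Proof.
  intros Hv E. split; [exact Hv|split].
  - intros z H1 H2. destruct (emb_of_otp z v (otp v) H2 Hv) as [F HF].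
    + rewrite E. right; now apply sig_lt.
    + apply ole_refl.
    + exists F. intros i j Hij. apply (rel_rk v Hv). rewrite !(proj1 (HF _)). now apply (rel_rk z H2).
  - intro m. destruct (sig_lt_ex x (rk (rel_of v) m)) as (z & H1 & H2 & H3).
    { rewrite <- E. apply otp_lt. }
    exists z. split; [exact H1|split; [exact H2|]].
    assert (F : forall i, exists n, rel_of v i m -> rk (rel_of z) n = rk (rel_of v) i).
    { intro i. destruct (classic (rel_of v i m)) as [H|H]; [|exists 0; tauto].
      destruct (otp_onto z H2 (rk (rel_of v) i)) as [n Hn]; [|eauto].
      eapply olt_trans; [|exact H3]. now apply (rel_rk v Hv). }
    destruct (choice_fun _ F) as [g Hg]. exists g. intros i j Hi Hj Hij.
    apply (rel_rk z H2). rewrite !Hg by assumption. now apply (rel_rk v Hv).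
Qed.

(** [E_ck] compares ordinals only through codes, so separating two suprema requires a code of the
    smaller one: it is computed on one side and not on the other. *)
Lemma E_ck_sig : (forall x, exists v, WO v /\ otp v = sig x) ->
  forall x x', E_ck x x' <-> sig x = sig x'.
Proof.
  intros HV x x'. split.
  - intro H. assert (K : forall x x', E_ck x x' -> ~ olt (sig x) (sig x')).
    { clear x x' H. intros x x' H L. destruct (HV x) as (v & W & E). specialize (H v W).
      rewrite !ck_ordinal_sig, E in H by exact W. apply (olt_irrefl (sig x)). tauto. }
    apply ole_antisym; apply not_olt; apply K; [|exact H]. intros w Hw. symmetry. now apply H.
  - intros E w Hw. rewrite !ck_ordinal_sig, E by exact Hw. reflexivity.
Qed.

(** * Well-founded parts and ranks are infinite time computable *)

Lemma comp_of_family F : cfam (fun n x => F x n = true) -> comp F.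
Proof.
  intro H. apply (comp_ext (fun x n => asb (F x n = true))); [|now apply comp_of_cfam].
  intros x n. apply bool_ext. apply asbP.
Qed.

Lemma comp_rjn A B : comp A -> comp B -> comp (fun x => rjn (A x) (B x)).
Proof.
  intros HA HB. apply comp_of_family.
  apply (cfam_ext (fun n x => (Nat.even n = true /\ A x (Nat.div2 n) = true) \/
    (Nat.even n = false /\ B x (Nat.div2 n) = true))).
  - intros n x. unfold rjn. destruct (Nat.even n); intuition congruence.
  - auto using cfam_or, cfam_and, cfam_const, cfam_of_comp.
Qed.

Lemma comp_rcons (P : real -> Prop) A : cfam (fun (_ : unit) x => P x) -> comp A ->
  comp (fun x => rcons (asb (P x)) (A x)).
Proof.
  intros HP HA. apply comp_of_family.
  apply (cfam_ext (fun n x => (n = 0 /\ P x) \/ (n <> 0 /\ A x (Nat.pred n) = true))).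
  - intros [|n] x; cbn; rewrite ?asbP; intuition congruence.
  - apply cfam_or; apply cfam_and; auto using cfam_const, cfam_of_comp.
    exact (cfam_reindex (fun _ => tt) _ HP).
Qed.

Lemma comp_id : comp (fun x => x).
Proof. apply comp_opn, opn_id. Qed.

Lemma comp_sub (h : nat -> nat) F : comp F -> comp (fun x n => F x (h n)).
Proof.
  intro HF. apply (comp_comp F (fun y n => y (h n)) HF), comp_opn. intro n; apply popen_bit.
Qed.

Lemma comp_rev F : comp F -> comp (fun x => rev (F x)).
Proof. apply (comp_sub (fun n => 2 * n)). Qed.

Lemma comp_rod F : comp F -> comp (fun x => rod (F x)).
Proof. apply (comp_sub (fun n => S (2 * n))). Qed.

Lemma comp_rtl F : comp F -> comp (fun x => rtl (F x)).
Proof. apply (comp_sub S). Qed.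

Lemma rk_onto_gen (R : nat -> nat -> Prop) n i : Acc R n -> olt i (rk R n) ->
  exists m, Acc R m /\ rk R m = i.
Proof.
  intro Hn. induction Hn as [n Hn IH]. intro Hi.
  assert (H : exists m, R m n /\ ole i (rk R m)).
  { apply NNPP; intro H. apply (olt_irrefl i). eapply olt_le_trans; [exact Hi|].
    apply rk_le; [now constructor|]. intros m Hm. apply not_ole; intro; eauto. }
  destruct H as [m [Hm [->|H]]]; [exists m; auto|]. eauto.
Qed.

(** The ranks that occur form a bounded initial segment, so the running flag goes off eventually. It
    cannot go off first at a limit, where the limsup of ones is one; hence it does so just after the
    least ordinal that is not a rank. *)
Lemma ranks_exhausted (R : nat -> nat -> Prop) (G : real -> real) (tr : Om -> real) :
  rtraj G tr -> tr ozero 0 = true ->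
  (forall j, tr (osucc j) 0 = true <-> exists n, Acc R n /\ rk R n = j) ->
  exists j, tr (osucc j) 0 = false /\ (forall l, olt l (osucc j) -> tr l 0 = true) /\
    forall n, Acc R n -> olt (rk R n) j.
Proof.
  intros Htr H0 Hrun. destruct (least_ex (fun i => tr i 0 = false)) as [i [Hi Hmin]].
  { destruct (Om_bounded (rk R)) as [b Hb]. exists (osucc b). apply not_true_iff_false.
    rewrite Hrun. intros [n [_ <-]]. now apply (olt_irrefl (rk R n)). }
  assert (Hlive : forall j, olt j i -> tr j 0 = true).
  { intros j Hj. destruct (tr j 0) eqn:E; [easy|]. exfalso. apply (olt_irrefl j).
    eapply olt_le_trans; [exact Hj|]. now apply Hmin. }
  assert (Hj : exists j, i = osucc j).
  { destruct (Om_cases i) as [->|[H|Hl]]; [|exact H|]; exfalso.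
    - congruence.
    - rewrite (proj2 Htr i Hl) in Hi. unfold limsup in Hi. rewrite asbF in Hi. apply Hi.
      intros s Hs. exists (osucc s). assert (olt (osucc s) i) by now apply olim_succ.
      auto using olt_succ. }
  destruct Hj as [j ->]. exists j. split; [exact Hi|split; [exact Hlive|]].
  intros n a. apply not_ole; intros [H|H].
  - rewrite (proj2 (Hrun j)) in Hi; [discriminate|eauto].
  - destruct (rk_onto_gen R n j a H) as [m Hm].
    rewrite (proj2 (Hrun j)) in Hi; [discriminate|eauto].
Qed.

(** Ill-founded points count as having infinite rank, above all ranks in the well-founded part. *)
Definition rless (R : nat -> nat -> Prop) (p q : nat) : Prop :=
  Acc R p /\ (Acc R q -> olt (rk R p) (rk R q)).

Section Loop.

(** Behind the flag, the state holds the relation, the set of points not yet removed, and the pairs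
    seen at some stage with the first point removed and the second still present. A point survives a
    round if a predecessor of it is present. *)
Definition lp_r (s : real) : real := rev (rtl s).
Definition lp_n (s : real) : real := rev (rod (rtl s)).
Definition lp_q (s : real) : real := rod (rod (rtl s)).

Definition lp_n' (s : real) : real :=
  fun n => asb (exists m, lp_r s (to_nat (m, n)) = true /\ lp_n s m = true).

Definition lp_q' (s : real) : real :=
  fun k => asb (lp_q s k = true \/
    (lp_n s (fst (of_nat k)) <> true /\ lp_n s (snd (of_nat k)) = true)).

Definition lp_body (s : real) : real :=
  rcons (asb (exists n, lp_n s n = true /\ lp_n' s n <> true))
    (rjn (lp_r s) (rjn (lp_n' s) (lp_q' s))).

Definition lp_init (r : real) : real := rcons true (rjn r (rjn (fun _ => true) zeros)).

Lemma comp_lp_body : comp lp_body.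
Proof.
  assert (Hr : comp lp_r) by exact (comp_rev _ (comp_rtl _ comp_id)).
  assert (Hn : comp lp_n) by exact (comp_rev _ (comp_rod _ (comp_rtl _ comp_id))).
  assert (Hq : comp lp_q) by exact (comp_rod _ (comp_rod _ (comp_rtl _ comp_id))).
  assert (Hn' : comp lp_n').
  { apply comp_of_cfam. apply (cfam_ex (fun n m x => lp_r x (to_nat (m, n)) = true /\ lp_n x m = true)
      countable_nat). apply cfam_and; now apply cfam_of_comp. }
  assert (Hq' : comp lp_q').
  { apply comp_of_cfam. apply cfam_or; [now apply cfam_of_comp|]. apply cfam_and.
    - apply cfam_not. now apply cfam_of_comp.
    - now apply cfam_of_comp. }
  apply comp_rcons; [|auto using comp_rjn].
  apply (cfam_ex (fun (_ : unit) n x => lp_n x n = true /\ lp_n' x n <> true) countable_nat).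
  apply cfam_and; [now apply cfam_of_comp|]. apply cfam_not. now apply cfam_of_comp.
Qed.

Context (r : real).
Let R := rel_of r.

Definition st_n (i : Om) : real := fun n => asb (Acc R n -> ole i (rk R n)).
Definition st_q (i : Om) : real := fun k => asb (exists j, olt j i /\
  st_n j (fst (of_nat k)) <> true /\ st_n j (snd (of_nat k)) = true).

Lemma st_n_anti i j n : ole i j -> st_n j n = true -> st_n i n = true.
Proof. unfold st_n. rewrite !asbP. intros H H' a. eapply ole_trans; eauto. Qed.

Context (tr : Om -> real).
Hypothesis Htr0 : tr ozero = lp_init r.
Hypothesis Htr : rtraj lp_body tr.

Lemma loop_n' i : lp_r (tr i) = r -> lp_n (tr i) = st_n i -> lp_n' (tr i) = st_n (osucc i).
Proof.
  intros Hr Hn. apply real_ext; intro n. apply asb_ext. rewrite Hr, Hn. split.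
  - intros [m [H1 H2]] a. apply rel_pair in H1. unfold st_n in H2. rewrite asbP in H2.
    apply osucc_le. eapply ole_lt_trans; [apply H2, (Acc_inv a H1)|]. now apply rk_lt.
  - intro H. apply NNPP; intro N.
    assert (K : forall m, R m n -> Acc R m /\ olt (rk R m) i).
    { intros m Hm. apply NNPP; intro N'. apply N. exists m. split; [now apply rel_pair|].
      unfold st_n. rewrite asbP. intro a. apply not_olt. tauto. }
    assert (a : Acc R n) by (constructor; apply K).
    apply (olt_irrefl i). apply olt_le_trans with (rk R n).
    + apply (olt_le_trans i (osucc i)); [apply olt_succ|auto].
    + apply rk_le; [exact a|apply K].
Qed.

Lemma loop_q' i : lp_n (tr i) = st_n i -> lp_q (tr i) = st_q i -> lp_q' (tr i) = st_q (osucc i).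
Proof.
  intros Hn Hq. apply real_ext; intro k. apply asb_ext. rewrite Hn, Hq. unfold st_q at 1. rewrite asbP.
  split.
  - intros [[j (H1 & H2)]|H].
    + exists j; split; [|exact H2]. eapply olt_trans; [exact H1|apply olt_succ].
    + exists i; split; [apply olt_succ|exact H].
  - intros [j [H1 H2]]. apply olt_succ_le in H1 as [->|H1]; eauto.
Qed.

(** Limits cause no loss since both varying parts are monotone: for the shrinking set of remaining
    points the limsup is the intersection, for the growing set of pairs it is the union. *)
Lemma loop_state i : rtl (tr i) = rjn r (rjn (st_n i) (st_q i)).
Proof.
  induction i as [i IH] using olt_ind.
  destruct (Om_cases i) as [->|[[j ->]|Hl]].
  - rewrite Htr0. unfold lp_init. rewrite rtl_cons. do 2 f_equal.
    + apply real_ext; intro n. symmetry. apply asbP. intros _. apply ozero_le.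
    + apply real_ext; intro n. symmetry. apply asbF. intros [j [H _]]. now apply olt_zero in H.
  - specialize (IH j (olt_succ j)).
    assert (Hr : lp_r (tr j) = r) by (unfold lp_r; now rewrite IH, rev_jn).
    assert (Hn : lp_n (tr j) = st_n j) by (unfold lp_n; now rewrite IH, rod_jn, rev_jn).
    assert (Hq : lp_q (tr j) = st_q j) by (unfold lp_q; now rewrite IH, !rod_jn).
    rewrite (proj1 Htr). unfold lp_body. rewrite rtl_cons, Hr, loop_n', loop_q'; auto.
  - apply real_ext; intro k. unfold rtl. rewrite (proj2 Htr i Hl). unfold limsup.
    assert (Hb : forall u, olt u i -> tr u (S k) = rjn r (rjn (st_n u) (st_q u)) k).
    { intros u Hu. now rewrite <- (IH u Hu). }
    assert (Hz : olt ozero i) by now apply olim_zero_lt.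
    apply bool_ext. rewrite asbP.
    assert (Hc : forall P : Om -> Prop, (forall u, olt u i -> (tr u (S k) = true <-> P u)) ->
      (cofinal olt i (fun u => tr u (S k) = true) <-> cofinal olt i P)).
    { intros P HP. split; intros H s Hs; destruct (H s Hs) as [u (U1 & U2 & U3)]; exists u;
        (split; [exact U1|split; [exact U2|]]); now apply HP. }
    unfold rjn in *. destruct (Nat.even k).
    + rewrite (Hc (fun _ => r (Nat.div2 k) = true)) by (intros u Hu; rewrite (Hb u Hu); reflexivity).
      split.
      * intro H. destruct (H _ Hz) as [u (_ & _ & U)]; exact U.
      * intros H s Hs. exists (osucc s). split; [apply olt_succ|split; [now apply olim_succ|exact H]].
    + set (n := Nat.div2 k) in *. destruct (Nat.even n); set (l := Nat.div2 n) in *.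
      * rewrite (Hc (fun u => st_n u l = true)) by (intros u Hu; rewrite (Hb u Hu); reflexivity).
        split.
        -- intro H. unfold st_n. rewrite asbP. intro a. apply not_olt; intro L.
           destruct (H _ L) as [u (U1 & U2 & U3)]. unfold st_n in U3. rewrite asbP in U3.
           apply (olt_irrefl u). eapply ole_lt_trans; [apply U3, a|exact U1].
        -- intros H s Hs. exists (osucc s). assert (olt (osucc s) i) by now apply olim_succ.
           split; [apply olt_succ|split; [assumption|]]. eapply st_n_anti; [|exact H]. now right.
      * rewrite (Hc (fun u => st_q u l = true)) by (intros u Hu; rewrite (Hb u Hu); reflexivity).
        rewrite cofinal_mono; [|exact Hl|].
        -- unfold st_q. setoid_rewrite asbP. split.
           ++ intros [u [U1 [j [J1 J2]]]]. exists j; split; [eapply olt_trans; eauto|exact J2].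
           ++ intros [j [J1 J2]]. exists (osucc j). split; [now apply olim_succ|].
              exists j; split; [apply olt_succ|exact J2].
        -- unfold st_q. intros u u' Hu _. rewrite !asbP. intros [j [J1 J2]].
           exists j; split; [eapply olt_trans; eauto|exact J2].
Qed.

Lemma loop_run j : tr (osucc j) 0 = true <-> exists n, Acc R n /\ rk R n = j.
Proof.
  assert (Hr : lp_r (tr j) = r) by (unfold lp_r; now rewrite loop_state, rev_jn).
  assert (Hn : lp_n (tr j) = st_n j) by (unfold lp_n; now rewrite loop_state, rod_jn, rev_jn).
  rewrite (proj1 Htr). unfold lp_body. cbn [rcons]. rewrite asbP, loop_n', Hn by assumption.
  unfold st_n. setoid_rewrite asbP. split.
  - intros [n [H1 H2]]. exists n.
    assert (a : Acc R n) by (apply NNPP; intro N; apply H2; tauto).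
    split; [exact a|]. apply ole_antisym; [|auto]. apply olt_succ_le, not_ole. intro; apply H2; auto.
  - intros [n [a <-]]. exists n; split; [intros _; apply ole_refl|]. intro H.
    apply (olt_irrefl (rk R n)). apply (olt_le_trans _ (osucc (rk R n))); [apply olt_succ|auto].
Qed.

Lemma loop_halts : exists i, tr i 0 = false /\ (forall j, olt j i -> tr j 0 = true) /\
  rtl (tr i) = rjn r (rjn (fun n => asb (~ Acc R n))
    (fun k => asb (rless R (fst (of_nat k)) (snd (of_nat k))))).
Proof.
  destruct (ranks_exhausted R lp_body tr Htr) as (j & H1 & H2 & Hrk); [now rewrite Htr0|exact loop_run|].
  exists (osucc j). split; [exact H1|split; [exact H2|]].
  rewrite loop_state. do 2 f_equal.
  - apply real_ext; intro n. apply asb_ext. split.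
    + intros H a. apply (olt_irrefl j). apply (olt_le_trans _ (osucc j)); [apply olt_succ|].
      eapply ole_trans; [apply H, a|right; auto].
    + tauto.
  - apply real_ext; intro k. apply asb_ext. set (p := fst (of_nat k)). set (q := snd (of_nat k)).
    unfold st_n, rless. setoid_rewrite asbP. split.
    + intros [l (L1 & L2 & L3)].
      assert (a : Acc R p) by (apply NNPP; intro N; apply L2; tauto).
      split; [exact a|]. intro aq. eapply olt_le_trans; [|apply L3, aq].
      apply not_ole. intro; apply L2; auto.
    + intros [a H]. exists (osucc (rk R p)). split; [|split].
      * now apply olt_succ_le, osucc_le, Hrk.
      * intro H'. apply (olt_irrefl (rk R p)). apply (olt_le_trans _ (osucc (rk R p)));
          [apply olt_succ|auto].
      * intro aq. apply osucc_le; auto.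
Qed.

End Loop.

Lemma comp_loop : comp (fun r => rjn r (rjn (fun n => asb (~ Acc (rel_of r) n))
    (fun k => asb (rless (rel_of r) (fst (of_nat k)) (snd (of_nat k)))))).
Proof.
  apply (comp_while lp_body lp_init).
  - exact comp_lp_body.
  - unfold lp_init. apply opn_cons, opn_jn; [apply opn_id|apply opn_const].
  - intro r. destruct (traj_ex lp_body (fun x => x) (fun x => x) (lp_init r)) as [tr [T0 T]].
    destruct (loop_halts r tr T0 T) as (i & H1 & H2 & H3).
    exists (tr i). split; [|now rewrite H3]. exists tr, i. auto.
Qed.

Definition rcode (R : real -> nat -> nat -> Prop) (x : real) : real :=
  fun k => asb (R x (fst (of_nat k)) (snd (of_nat k))).

Lemma rel_rcode R x : rel_of (rcode R x) = R x.
Proof.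
  do 2 (apply functional_extensionality; intro). apply propositional_extensionality.
  rewrite rel_pair. unfold rcode. now rewrite asbP, cancel_of_to.
Qed.

Lemma comp_rcode R : cfam (fun mn x => R x (fst mn) (snd mn)) -> comp (rcode R).
Proof. intro H. apply comp_of_cfam. exact (cfam_reindex of_nat _ H). Qed.

Lemma cfam_nacc {A} (R : real -> nat -> nat -> Prop) (h : A -> nat) :
  cfam (fun mn x => R x (fst mn) (snd mn)) -> cfam (fun a x => ~ Acc (R x) (h a)).
Proof.
  intro H. pose proof (comp_comp _ _ (comp_rcode R H) comp_loop) as H1.
  apply comp_rod, comp_rev in H1. apply (cfam_ext (fun a x =>
    (fun n => asb (~ Acc (rel_of (rcode R x)) n)) (h a) = true)).
  - intros a x. cbv beta. now rewrite asbP, rel_rcode.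
  - pose proof (cfam_of_comp _ h H1) as H2. cbv beta in H2.
    eapply cfam_ext; [|exact H2]. intros a x. cbv beta. now rewrite rod_jn, rev_jn.
Qed.

Lemma cfam_acc {A} (R : real -> nat -> nat -> Prop) (h : A -> nat) :
  cfam (fun mn x => R x (fst mn) (snd mn)) -> cfam (fun a x => Acc (R x) (h a)).
Proof.
  intro H. apply (cfam_ext (fun a x => ~ ~ Acc (R x) (h a))).
  - intros a x; split; [apply NNPP|tauto].
  - now apply cfam_not, cfam_nacc.
Qed.

Lemma cfam_rless {A} (R : real -> nat -> nat -> Prop) (h h' : A -> nat) :
  cfam (fun mn x => R x (fst mn) (snd mn)) -> cfam (fun a x => rless (R x) (h a) (h' a)).
Proof.
  intro H. pose proof (comp_comp _ _ (comp_rcode R H) comp_loop) as H1.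
  apply comp_rod, comp_rod in H1.
  pose proof (cfam_of_comp _ (fun a => to_nat (h a, h' a)) H1) as H2. cbv beta in H2.
  eapply cfam_ext; [|exact H2]. intros a x. cbv beta.
  now rewrite !rod_jn, asbP, rel_rcode, cancel_of_to.
Qed.

(** * Suprema of families of well-orders *)

Definition sec (r : real) (e : nat) : real := fun k => r (to_nat (e, k)).

Lemma enumeration (D : nat -> Prop) : (forall k, exists n, k < n /\ D n) ->
  exists h, (forall i j, i < j -> h i < h j) /\ (forall n, D n <-> exists i, h i = n).
Proof.
  intro Hinf.
  assert (Hnx : forall k, exists n, (k <= n /\ D n) /\ forall j, j < n -> ~ (k <= j /\ D j)).
  { intro k. destruct (Hinf k) as [n [H1 H2]].
    apply (nat_least (fun n => k <= n /\ D n) n). split; [lia|exact H2]. }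
  destruct (choice_fun _ Hnx) as [nx N].
  set (h := fix h i := match i with 0 => nx 0 | S i => nx (S (h i)) end).
  assert (Hmono : forall i j, i < j -> h i < h j).
  { induction 1 as [|j Hj IH]; cbn.
    - destruct (N (S (h i))) as [[H _] _]. lia.
    - destruct (N (S (h j))) as [[H _] _]. lia. }
  exists h. split; [exact Hmono|]. intro n. split.
  - intro Hn.
    assert (Hge : forall i, i <= h i).
    { induction i as [|i IH]; [lia|]. specialize (Hmono i (S i)). lia. }
    assert (Hmin : forall k, k <= n -> nx k <= n).
    { intros k Hk. destruct (le_lt_dec (nx k) n) as [H|H]; [exact H|].
      exfalso. now apply (proj2 (N k) n H). }
    assert (K : forall i, n < h i -> exists j, h j = n).
    { induction i as [|i IH]; intro Hi.
      - specialize (Hmin 0 ltac:(lia)). cbn in Hi. lia.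
      - destruct (lt_eq_lt_dec (h i) n) as [[H|H]|H]; [|eauto|auto].
        specialize (Hmin (S (h i)) ltac:(lia)). cbn in Hi. lia. }
    apply (K (S n)). specialize (Hge (S n)). lia.
  - intros [[|i] <-]; apply N.
Qed.

(** Counting is expressed by a finite list, so that only quantifiers over countable types occur and
    the closure properties of [cfam] apply. *)
Definition nth_elem (D : nat -> Prop) (i p : nat) : Prop :=
  D p /\ exists l : list nat, (NoDup l /\ length l = i) /\ forall q, In q l <-> (q < p /\ D q).

Lemma nth_elem_spec (D : nat -> Prop) (h : nat -> nat) :
  (forall i j, i < j -> h i < h j) -> (forall n, D n <-> exists i, h i = n) ->
  forall i p, nth_elem D i p <-> h i = p.
Proof.
  intros Hm HD i p.
  assert (Hinj : Injective h).
  { intros a b E. destruct (lt_eq_lt_dec a b) as [[L|L]|L]; [|exact L|]; apply Hm in L; lia. }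
  assert (Hl : forall j q, In q (map h (seq 0 j)) <-> (q < h j /\ D q)).
  { intros j q. rewrite in_map_iff. setoid_rewrite in_seq. split.
    - intros [a [<- Ha]]. split; [apply Hm; lia|apply HD; eauto].
    - intros [H1 H2]. apply HD in H2 as [a <-]. exists a; split; [easy|].
      destruct (le_lt_dec j a) as [H|H]; [|lia]. exfalso.
      destruct (Nat.eq_dec j a) as [->|]; [lia|]. specialize (Hm j a); lia. }
  assert (Hnd : forall j, NoDup (map h (seq 0 j))).
  { intro j. apply Injective_map_NoDup; [exact Hinj|apply seq_NoDup]. }
  split.
  - intros [Hp [l [[L1 L2] L3]]]. apply HD in Hp as [j <-]. f_equal.
    assert (E : forall q, In q l <-> In q (map h (seq 0 j))) by (intro q; now rewrite L3, Hl).
    assert (A : length l <= length (map h (seq 0 j)))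
      by (apply NoDup_incl_length; [exact L1|intros q; apply E]).
    assert (B : length (map h (seq 0 j)) <= length l)
      by (apply NoDup_incl_length; [apply Hnd|intros q; apply E]).
    rewrite length_map, length_seq in *. lia.
  - intros <-. split; [apply HD; eauto|]. exists (map h (seq 0 i)).
    split; [split; [apply Hnd|now rewrite length_map, length_seq]|apply Hl].
Qed.

(** The disjoint sum of all sections: points of different sections become comparable by their ranks
    in a single relation. *)
Definition rsum (r : real) (p q : nat) : Prop :=
  fst (of_nat p) = fst (of_nat q) /\
  rel_of (sec r (fst (of_nat q))) (snd (of_nat p)) (snd (of_nat q)).

Lemma rsum_pair r e n p : rsum r p (to_nat (e, n)) <->
  exists m, p = to_nat (e, m) /\ rel_of (sec r e) m n.
Proof.
  unfold rsum. rewrite cancel_of_to. cbn [fst snd]. split.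
  - intros [H1 H2]. exists (snd (of_nat p)). split; [|exact H2].
    rewrite <- H1, <- surjective_pairing. now rewrite cancel_to_of.
  - intros [m [-> H]]. now rewrite cancel_of_to.
Qed.

Lemma rsum_acc r e n : Acc (rel_of (sec r e)) n -> Acc (rsum r) (to_nat (e, n)).
Proof.
  induction 1 as [n _ IH]. constructor. intros p Hp. apply rsum_pair in Hp as [m [-> Hm]]. auto.
Qed.

Lemma rsum_rk r e n : Acc (rsum r) (to_nat (e, n)) ->
  Acc (rel_of (sec r e)) n /\ rk (rel_of (sec r e)) n = rk (rsum r) (to_nat (e, n)).
Proof.
  apply (rk_transfer (rsum r) (rel_of (sec r e)) (fun n => to_nat (e, n))).
  - intros a b. rewrite rsum_pair. split; [eauto|]. intros [m [E H]].
    apply (f_equal of_nat) in E. rewrite !cancel_of_to in E. now injection E as ->.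
  - intros b m Hm. apply rsum_pair in Hm as [a [-> _]]. eauto.
Qed.

(** Among the points of well-ordered sections that share a rank, the one with the least index is
    selected; [wsup] renumbers these representatives by all of [nat]. *)
Definition sup_d (r : real) (p : nat) : Prop :=
  WO (sec r (fst (of_nat p))) /\
  forall p', p' < p -> WO (sec r (fst (of_nat p'))) -> rless (rsum r) p' p \/ rless (rsum r) p p'.

Definition wsup (r : real) : real := fun k => asb (exists p q,
  (nth_elem (sup_d r) (fst (of_nat k)) p /\ nth_elem (sup_d r) (snd (of_nat k)) q) /\
  rless (rsum r) p q).

Lemma cfam_rsum : cfam (fun mn x => rsum x (fst mn) (snd mn)).
Proof.
  unfold rsum. apply cfam_and; [apply cfam_const|]. unfold rel_of, sec. apply cfam_bit.
Qed.

Lemma cfam_WO_sec {A} (h : A -> nat) : cfam (fun a x => WO (sec x (h a))).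
Proof.
  unfold WO, rel_of at 1 2 3 4 5 6, sec at 1 2 3 4 5 6.
  apply cfam_and; [|apply cfam_and; [|apply cfam_and]].
  - apply (cfam_all (fun a n x => _ <> _) countable_nat). apply cfam_not, cfam_bit.
  - apply (cfam_all (fun a n x => forall m k, _ -> _ -> _) countable_nat).
    apply (cfam_all (fun a m x => forall k, _ -> _ -> _) countable_nat).
    apply (cfam_all (fun a k x => _ -> _ -> _) countable_nat).
    repeat apply cfam_imp; apply cfam_bit.
  - apply (cfam_all (fun a n x => forall m, _ \/ _) countable_nat).
    apply (cfam_all (fun a m x => _ \/ _) countable_nat).
    repeat apply cfam_or; try apply cfam_bit. apply cfam_const.
  - unfold well_founded.
    apply (cfam_all (fun a n x => Acc (rel_of (sec x (h a))) n) countable_nat).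
    (* [cfam_acc] treats one relation per real, so the section is viewed inside the sum. *)
    apply (cfam_ext (fun an x => Acc (rsum x) (to_nat (h (fst an), snd an)))).
    + intros [a n] x. cbn [fst snd]. split; [apply rsum_rk|apply rsum_acc].
    + apply cfam_acc, cfam_rsum.
Qed.

Lemma cfam_sup_d {A} (h : A -> nat) : cfam (fun a x => sup_d x (h a)).
Proof.
  unfold sup_d. apply cfam_and; [apply cfam_WO_sec|].
  apply (cfam_all (fun a p' x => _ -> _ -> _) countable_nat).
  apply cfam_imp; [apply cfam_const|]. apply cfam_imp; [apply cfam_WO_sec|].
  apply cfam_or; apply cfam_rless, cfam_rsum.
Qed.

Lemma cfam_nth_elem {A} (P : nat -> real -> Prop) (h h' : A -> nat) :
  (forall B (g : B -> nat), cfam (fun b x => P (g b) x)) ->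
  cfam (fun a x => nth_elem (fun n => P n x) (h a) (h' a)).
Proof.
  intro HP. unfold nth_elem. apply cfam_and; [apply HP|].
  apply (cfam_ex (fun a l x => _ /\ _) (countable_list _ countable_nat)).
  apply cfam_and; [apply cfam_const|].
  apply (cfam_all (fun a q x => _ <-> _) countable_nat).
  apply cfam_iff; [apply cfam_const|]. apply cfam_and; [apply cfam_const|]. apply HP.
Qed.

Lemma comp_wsup : comp wsup.
Proof.
  apply comp_of_cfam.
  apply (cfam_ex (fun k p x => exists q, _) countable_nat).
  apply (cfam_ex (fun k q x => _ /\ _) countable_nat).
  apply cfam_and; [|apply cfam_rless, cfam_rsum].
  apply cfam_and; apply (cfam_nth_elem (fun n x => sup_d x n)); intros B g; apply cfam_sup_d.
Qed.

Lemma rk_of_ranks (v : real) (rho : nat -> Om) :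
  (forall i j, rel_of v i j <-> olt (rho i) (rho j)) -> (forall i j, rho i = rho j -> i = j) ->
  (forall i u, olt u (rho i) -> exists j, rho j = u) ->
  WO v /\ forall i, rk (rel_of v) i = rho i.
Proof.
  intros H1 H2 H3.
  assert (W : well_founded (rel_of v)).
  { intro n. remember (rho n) as a eqn:E. revert n E. induction a as [a IH] using olt_ind.
    intros n ->. constructor. intros m Hm. apply H1 in Hm. eauto. }
  split.
  - split; [|split; [|split; [|exact W]]].
    + intros n Hn. apply H1 in Hn. now apply olt_irrefl in Hn.
    + intros n m k. rewrite !H1. apply olt_trans.
    + intros n m. rewrite !H1. destruct (olt_total (rho n) (rho m)) as [E|E]; auto.
  - intro i. induction (W i) as [i _ IH]. apply ole_antisym.
    + apply rk_le; [apply W|]. intros m Hm. rewrite (IH m Hm). now apply H1.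
    + apply not_olt; intro L. destruct (H3 i _ L) as [j Hj]. rewrite <- Hj in L.
      apply H1 in L. pose proof (rk_lt (rel_of v) j i (W i) L) as L'. rewrite (IH j L), Hj in L'.
      now apply olt_irrefl in L'.
Qed.

(** The ranks of points of well-ordered sections form an initial segment of [Om], the union of the
    types of these sections. A single well-ordered section already supplies infinitely many
    representatives, so the enumeration is total. *)
Theorem wsup_spec r : (exists e, WO (sec r e)) ->
  WO (wsup r) /\
  is_least (fun i => forall e, WO (sec r e) -> ole (otp (sec r e)) i) (otp (wsup r)).
Proof.
  intros [e0 He0].
  set (rho := fun p => rk (rsum r) p). set (good := fun p => WO (sec r (fst (of_nat p)))).
  assert (Gacc : forall p, good p -> Acc (rsum r) p).
  { intros p Hp. rewrite <- (cancel_to_of p), (surjective_pairing (of_nat p)).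
    apply rsum_acc. apply Hp. }
  assert (Gp : forall e n, WO (sec r e) -> good (to_nat (e, n))).
  { intros e n H. unfold good. now rewrite cancel_of_to. }
  assert (Grho : forall e n, WO (sec r e) -> rho (to_nat (e, n)) = rk (rel_of (sec r e)) n).
  { intros e n H. unfold rho. symmetry. apply rsum_rk. apply Gacc. now apply Gp. }
  assert (Gless : forall p q, good p -> good q -> (rless (rsum r) p q <-> olt (rho p) (rho q))).
  { intros p q Hp Hq. unfold rless. pose proof (Gacc p Hp). pose proof (Gacc q Hq).
    unfold rho. tauto. }
  assert (Dspec : forall p, sup_d r p <-> good p /\ forall p', p' < p -> good p' -> rho p' <> rho p).
  { intro p. unfold sup_d. fold (good p). split; intros [H1 H2]; (split; [exact H1|]); intros p' L G.
    - intro E. destruct (H2 p' L G) as [K|K]; apply Gless in K; auto; rewrite E in K;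
        now apply olt_irrefl in K.
    - rewrite !Gless by auto. destruct (olt_total (rho p') (rho p)) as [E|E]; [|exact E].
      exfalso. eapply H2; eauto. }
  assert (Drep : forall p, good p -> exists q, sup_d r q /\ rho q = rho p).
  { intros p Hp. destruct (nat_least (fun q => good q /\ rho q = rho p) p) as [q [[Q1 Q2] Q3]]; [auto|].
    exists q. split; [|exact Q2]. apply Dspec. split; [exact Q1|]. intros p' L G E.
    apply (Q3 p' L). split; [exact G|congruence]. }
  assert (Dinj : forall p q, sup_d r p -> sup_d r q -> rho p = rho q -> p = q).
  { intros p q Hp Hq E. apply Dspec in Hp, Hq. destruct Hp as [P1 P2], Hq as [Q1 Q2].
    destruct (lt_eq_lt_dec p q) as [[L|L]|L]; [|exact L|]; exfalso; [eapply Q2|eapply P2]; eauto. }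
  assert (Dinf : forall k, exists n, k < n /\ sup_d r n).
  { intro k. apply NNPP; intro N.
    destruct (choice_fun _ (fun n => Drep (to_nat (e0, n)) (Gp e0 n He0))) as [f Hf].
    assert (Hinj : Injective f).
    { intros a b E. destruct (Hf a) as [_ A], (Hf b) as [_ B]. rewrite E, B in A.
      rewrite !Grho in A by exact He0. symmetry. exact (rk_inj _ He0 _ _ A). }
    assert (L : length (map f (seq 0 (S (S k)))) <= length (seq 0 (S k))).
    { apply NoDup_incl_length.
      - apply Injective_map_NoDup; [exact Hinj|apply seq_NoDup].
      - intros n Hn. apply in_map_iff in Hn as [a [<- _]]. apply in_seq. split; [lia|].
        destruct (le_lt_dec (f a) k); [lia|]. exfalso. apply N. exists (f a); split; [easy|apply Hf]. }
    rewrite length_map, !length_seq in L. lia. }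
  destruct (enumeration (sup_d r) Dinf) as [h [Hm HD]].
  assert (Hh : forall i, sup_d r (h i)) by (intro i; apply HD; eauto).
  assert (Hg : forall i, good (h i)) by (intro i; exact (proj1 (proj1 (Dspec _) (Hh i)))).
  assert (Hrel : forall i j, rel_of (wsup r) i j <-> olt (rho (h i)) (rho (h j))).
  { intros i j. rewrite rel_pair. unfold wsup. rewrite asbP, cancel_of_to. cbn [fst snd].
    rewrite <- (Gless _ _ (Hg i) (Hg j)). split.
    - intros (p & q & [H1 H2] & H3). apply (nth_elem_spec _ h Hm HD) in H1, H2. now subst.
    - intro H. exists (h i), (h j). split; [|exact H]. split; now apply (nth_elem_spec _ h Hm HD). }
  destruct (rk_of_ranks (wsup r) (fun i => rho (h i)) Hrel) as [W Wrk].
  - intros i j E. apply Dinj in E; auto.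
    destruct (lt_eq_lt_dec i j) as [[L|L]|L]; [|exact L|]; apply Hm in L; lia.
  - intros i u Hu. pose proof (Hg i) as Gi. unfold good in Gi.
    rewrite <- (cancel_to_of (h i)), (surjective_pairing (of_nat (h i))), Grho in Hu by exact Gi.
    destruct (rk_onto _ Gi _ _ Hu) as [m [_ Hm']].
    destruct (Drep (to_nat (fst (of_nat (h i)), m)) (Gp _ m Gi)) as [q [Q1 Q2]].
    apply HD in Q1 as [j <-]. exists j. rewrite Q2, Grho by exact Gi. exact Hm'.
  - split; [exact W|]. split.
    + intros e He. apply otp_le. intro n. rewrite <- Grho by exact He.
      destruct (Drep (to_nat (e, n)) (Gp e n He)) as [q [Q1 Q2]]. apply HD in Q1 as [j <-].
      rewrite <- Q2, <- Wrk. apply otp_lt.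
    + intros i Hi. apply otp_le. intro n. rewrite Wrk. pose proof (Hg n) as Gn. unfold good in Gn.
      rewrite <- (cancel_to_of (h n)), (surjective_pairing (of_nat (h n))), Grho by exact Gn.
      eapply olt_le_trans; [apply otp_lt|now apply Hi].
Qed.

(** * The reduction of [E_ck] *)

Definition prog_enum : nat -> program :=
  proj1_sig (constructive_indefinite_description _ countable_program).

Lemma prog_enum_onto p : exists e, prog_enum e = p.
Proof. exact (proj2_sig (constructive_indefinite_description _ countable_program) p). Qed.

Definition ttotal (e : nat) (x : real) : Prop := forall n, exists b, tval (prog_enum e) n b x.

(* Non-total programs contribute the empty relation, which is not a linear order. *)
Definition tfam (x : real) : real := fun k =>
  asb (ttotal (fst (of_nat k)) x /\ tval (prog_enum (fst (of_nat k))) (snd (of_nat k)) true x).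

Lemma cfam_tval {A} (p : A -> program) n b : cfam (fun a x => tval (p a) (n a) (b a) x).
Proof. apply cfam_open. intro a; apply popen_tval. Qed.

Lemma comp_tfam : comp tfam.
Proof.
  apply comp_of_cfam. apply cfam_and; [|apply cfam_tval]. unfold ttotal.
  apply (cfam_all (fun k n x => exists b, _) countable_nat).
  apply (cfam_ex (fun k b x => tval _ _ _ _) countable_bool). apply cfam_tval.
Qed.

Lemma sec_tfam x e : ttotal e x -> forall n, tval (prog_enum e) n (sec (tfam x) e n) x.
Proof.
  intros H n. unfold sec, tfam. rewrite cancel_of_to. cbn [fst snd].
  destruct (asb _) eqn:E; [rewrite asbP in E; tauto|]. destruct (H n) as [[] Hb]; [|exact Hb].
  exfalso. rewrite asbF in E. tauto.
Qed.

Lemma sec_tfam_WO x e : WO (sec (tfam x) e) -> ttotal e x.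
Proof.
  intros (_ & _ & T & _). apply NNPP; intro N.
  assert (F : forall n m, ~ rel_of (sec (tfam x) e) n m).
  { intros n m. rewrite rel_pair. unfold sec, tfam. rewrite asbP, cancel_of_to. cbn [fst]. tauto. }
  destruct (T 0 1) as [H|[H|H]]; [discriminate H| |]; now apply F in H.
Qed.

Lemma tfam_turing x z : turing_computable_from z x <-> exists e, ttotal e x /\ sec (tfam x) e = z.
Proof.
  split.
  - intros [p Hp]. destruct (prog_enum_onto p) as [e He]. exists e.
    assert (T : ttotal e x) by (intro n; exists (z n); rewrite He; apply Hp).
    split; [exact T|]. apply real_ext; intro n. apply (tval_fun p n _ _ x); [|apply Hp].
    rewrite <- He. now apply sec_tfam.
  - intros [e [T <-]]. exists (prog_enum e). exact (sec_tfam x e T).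
Qed.

Definition cksup (x : real) : real := wsup (tfam x).

Lemma comp_cksup : comp cksup.
Proof. exact (comp_comp _ _ comp_tfam comp_wsup). Qed.

Theorem cksup_spec x : WO (cksup x) /\ otp (cksup x) = sig x.
Proof.
  destruct (wsup_spec (tfam x)) as [W [L1 L2]].
  { destruct (proj1 (tfam_turing x std_code) (turing_std x)) as [e [_ He]].
    exists e. rewrite He. exact WO_std. }
  split; [exact W|]. destruct (sig_spec x) as [S1 S2]. apply ole_antisym.
  - apply L2. intros e He. apply S1; [|exact He]. apply tfam_turing. exists e.
    split; [now apply sec_tfam_WO|easy].
  - apply S2. intros z Hz Wz. apply tfam_turing in Hz as [e [_ <-]]. now apply L1.
Qed.

Lemma E_ck_iff x x' : E_ck x x' <-> sig x = sig x'.
Proof. apply E_ck_sig. intro y. exists (cksup y). apply cksup_spec. Qed.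

(** Bit 0 codes the pair (0, 0), so irreflexivity supplies the condition that [comp_ittm] puts on
    outputs. *)
Lemma WO_zero v : WO v -> v 0 = false.
Proof. intros [H _]. specialize (H 0). unfold rel_of in H. now apply not_true_iff_false. Qed.

Theorem cksup_reduction : ittm_computable all_reals cksup /\
  (forall x, codes_sup_ck x (cksup x)) /\
  (forall x x', E_ck x x' <-> cong_WO (cksup x) (cksup x')).
Proof.
  split; [|split].
  - apply comp_ittm; [exact comp_cksup|]. intros x _. apply WO_zero, cksup_spec.
  - intro x. apply codes_sup_of_otp; apply cksup_spec.
  - intros x x'. rewrite E_ck_iff, cong_otp by apply cksup_spec.
    now rewrite !(proj2 (cksup_spec _)).
Qed.

(** * Uniformization of closed relations *)

Definition vagree (l : nat) (v v' : nat -> nat) : Prop := forall i, i < l -> v' i = v i.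

Definition pclosed (K : (nat -> nat) -> real -> Prop) : Prop := forall v p,
  (forall l, exists v' p', vagree l v v' /\ agree l p p' /\ K v' p') -> K v p.

Section Uniformize.

Context (K : nat -> (nat -> nat) -> real -> Prop).
Hypothesis HK : forall m, pclosed (K m).

(* Since [K] is closed, it is the set of branches through this tree. *)
Definition tree (m : nat) (s : list nat) (p : real) : Prop :=
  exists v' p', vagree (length s) (fun i => nth i s 0) v' /\ agree (length s) p p' /\ K m v' p'.

Lemma popen_tree m s : popen (tree m s).
Proof.
  intros p (v' & p' & H1 & H2 & H3). exists (length s). intros q Hq. exists v', p'.
  split; [exact H1|split; [|exact H3]]. intros i Hi. now rewrite H2, Hq.
Qed.

Context (nd : nat -> nat * list nat) (cd : nat * list nat -> nat).
Hypothesis Hnd : forall x, nd (cd x) = x.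

(** Predecessors of a node are its children in the tree, so an inaccessible node is one through
    which a branch passes. Nodes carry the index [m], so that one relation serves all the trees. *)
Definition child (p : real) (a b : nat) : Prop :=
  exists k, nd a = (fst (nd b), snd (nd b) ++ [k]) /\ tree (fst (nd a)) (snd (nd a)) p.

Lemma cfam_child : cfam (fun mn x => child x (fst mn) (snd mn)).
Proof.
  apply (cfam_ex (fun mn k x => _ /\ _) countable_nat).
  apply cfam_and; [apply cfam_const|]. apply cfam_open. intros [[a b] k]. apply popen_tree.
Qed.

Definition alive (m : nat) (s : list nat) (p : real) : Prop :=
  ~ Acc (child p) (cd (m, s)) /\ tree m s p.

Definition solvable (m : nat) (p : real) : Prop := ~ Acc (child p) (cd (m, [])).

(** Finite pieces of the leftmost branch, described by quantifiers over numbers only, so that the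
    branch is read off computably. *)
Definition onpath (m : nat) (s : list nat) (p : real) : Prop := forall i, i < length s ->
  alive m (firstn (S i) s) p /\ forall k, k < nth i s 0 -> ~ alive m (firstn i s ++ [k]) p.

Definition bvalue (m n c : nat) (p : real) : Prop :=
  exists s, (n < length s /\ nth n s 0 = c) /\ onpath m s p.

Lemma cfam_solvable {A} (h : A -> nat) : cfam (fun a p => solvable (h a) p).
Proof. apply (cfam_nacc child (fun a => cd (h a, []))), cfam_child. Qed.

Lemma cfam_alive {A} (h : A -> nat) (s : A -> list nat) : cfam (fun a p => alive (h a) (s a) p).
Proof.
  apply cfam_and.
  - apply (cfam_nacc child (fun a => cd (h a, s a))), cfam_child.
  - apply cfam_open. intro a; apply popen_tree.
Qed.

Lemma cfam_bvalue {A} (h n c : A -> nat) : cfam (fun a p => bvalue (h a) (n a) (c a) p).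
Proof.
  apply (cfam_ex (fun a s p => _ /\ _) (countable_list _ countable_nat)).
  apply cfam_and; [apply cfam_const|].
  apply (cfam_all (fun a i p => _ -> _) countable_nat).
  apply cfam_imp; [apply cfam_const|]. apply cfam_and; [apply cfam_alive|].
  apply (cfam_all (fun a k p => _ -> _) countable_nat).
  apply cfam_imp; [apply cfam_const|]. apply cfam_not, cfam_alive.
Qed.

Lemma map_seq_S {A} (v : nat -> A) n : map v (seq 0 (S n)) = map v (seq 0 n) ++ [v n].
Proof. now rewrite seq_S, map_app. Qed.

Lemma tree_branch m v p n : K m v p -> tree m (map v (seq 0 n)) p.
Proof.
  intro H. exists v, p. split; [|split; [easy|exact H]]. intros i Hi.
  rewrite length_map, length_seq in Hi. rewrite (nth_indep _ 0 (v 0)) by (now rewrite length_map, length_seq).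
  now rewrite map_nth, seq_nth.
Qed.

Lemma solvable_ex m v p : K m v p -> solvable m p.
Proof.
  intros H a. assert (L : forall a, Acc (child p) a -> forall n, nd a = (m, map v (seq 0 n)) -> False).
  { clear a. induction 1 as [a _ IH]. intros n E.
    apply (IH (cd (m, map v (seq 0 (S n)))) ) with (n := S n); [|apply Hnd].
    exists (v n). rewrite Hnd, E. cbn [fst snd]. split; [now rewrite map_seq_S|].
    now apply tree_branch. }
  apply (L _ a 0). now rewrite Hnd.
Qed.

Lemma acc_same p a b : nd a = nd b -> Acc (child p) a -> Acc (child p) b.
Proof.
  intros E [H]. constructor. intros c Hc. apply H. unfold child in *. now rewrite E.
Qed.

Lemma alive_child m s p : ~ Acc (child p) (cd (m, s)) -> exists k, alive m (s ++ [k]) p.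
Proof.
  intro H. apply NNPP; intro N. apply H. constructor. intros a (k & E & T).
  rewrite Hnd in E. cbn [fst snd] in E. rewrite E in T. cbn [fst snd] in T.
  apply NNPP; intro N'. apply N. exists k. split; [|exact T].
  intro A. apply N'. eapply acc_same; [|exact A]. now rewrite Hnd.
Qed.

(** An inaccessible node has a live child, so taking the least one forever yields a branch, and
    closedness makes the branch a solution. The greedy choice determines every finite piece, so
    [bvalue] describes this very branch. *)
Theorem solvable_branch m p : solvable m p ->
  exists v, K m v p /\ forall n c, bvalue m n c p <-> v n = c.
Proof.
  intro H.
  assert (Hnx : forall s, exists k, ~ Acc (child p) (cd (m, s)) ->
    alive m (s ++ [k]) p /\ forall j, j < k -> ~ alive m (s ++ [j]) p).
  { intro s. destruct (classic (~ Acc (child p) (cd (m, s)))) as [A|A]; [|exists 0; tauto].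
    destruct (alive_child m s p A) as [k Hk].
    destruct (nat_least (fun k => alive m (s ++ [k]) p) k Hk) as [k' Hk']. exists k'; auto. }
  destruct (choice_fun _ Hnx) as [nx N].
  set (path := fix path n := match n with 0 => [] | S n => path n ++ [nx (path n)] end).
  set (v := fun n => nx (path n)).
  assert (Hp : forall n, path n = map v (seq 0 n)).
  { induction n as [|n IH]; [easy|]. rewrite map_seq_S, <- IH. reflexivity. }
  assert (Hal : forall n, ~ Acc (child p) (cd (m, path n))).
  { induction n as [|n IH]; [exact H|]. apply (N (path n) IH). }
  assert (Hlen : forall n, length (path n) = n) by (intro n; now rewrite Hp, length_map, length_seq).
  assert (Hfst : forall n i, i <= n -> firstn i (path n) = path i).
  { intros n i Hi. rewrite !Hp, firstn_map. f_equal.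
    replace n with (i + (n - i)) by lia. rewrite seq_app, firstn_app, length_seq, Nat.sub_diag.
    rewrite firstn_all2 by (rewrite length_seq; lia). cbn. apply app_nil_r. }
  assert (Hnth : forall n i, i < n -> nth i (path n) 0 = v i).
  { intros n i Hi. rewrite Hp. rewrite (nth_indep _ 0 (v 0)) by (now rewrite length_map, length_seq).
    now rewrite map_nth, seq_nth. }
  assert (Hon : forall n, onpath m (path n) p).
  { intros n i Hi. rewrite Hlen in Hi. rewrite !Hfst, Hnth by lia. exact (N (path i) (Hal i)). }
  assert (Huniq : forall s, onpath m s p -> s = path (length s)).
  { intros s Hs. assert (L : forall i, i <= length s -> firstn i s = path i).
    { induction i as [|i IH]; intro Hi; [easy|]. specialize (IH ltac:(lia)).
      destruct (Hs i) as [S1 S2]; [lia|].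
      assert (E : firstn (S i) s = path i ++ [nth i s 0]).
      { rewrite <- IH. clear -Hi. revert i Hi. induction s as [|a s IHs]; intros i Hi; [cbn in Hi; lia|].
        destruct i as [|i]; [easy|]. cbn in Hi. cbn [firstn nth app]. f_equal. apply IHs. lia. }
      rewrite E in *. rewrite IH in S2. cbn [path]. do 2 f_equal.
      destruct (N (path i) (Hal i)) as [N1 N2].
      destruct (lt_eq_lt_dec (nth i s 0) (nx (path i))) as [[L|L]|L]; [|exact L|]; exfalso.
      - exact (N2 _ L S1).
      - exact (S2 _ L N1). }
    rewrite <- (L (length s)) by lia. now rewrite firstn_all. }
  exists v. split.
  - apply HK. intro l.
    assert (T : tree m (path (S l)) p) by (cbn [path]; apply (N (path l) (Hal l))).
    destruct T as (v' & p' & T1 & T2 & T3). rewrite Hlen in T1, T2. exists v', p'.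
    split; [|split; [|exact T3]].
    + intros i Hi. rewrite T1 by lia. apply Hnth; lia.
    + intros i Hi. apply T2; lia.
  - intros n c. split.
    + intros (s & [S1 S2] & S3). rewrite <- S2, (Huniq s S3). symmetry. now apply Hnth.
    + intros <-. exists (path (S n)). split; [|apply Hon]. rewrite Hlen. split; [lia|].
      apply Hnth; lia.
Qed.

End Uniformize.

(** * Closed conditions *)

Definition vcont {B : Type} (f : (nat -> nat) -> B) : Prop :=
  forall v, exists l, forall v', vagree l v v' -> f v' = f v.

Lemma vagree_le l l' v v' : l <= l' -> vagree l' v v' -> vagree l v v'.
Proof. intros H H' i Hi. apply H'. lia. Qed.

Lemma vcont_at k : vcont (fun v => v k).
Proof. intro v. exists (S k). intros v' H. apply H. lia. Qed.

Lemma vcont_comp (f : (nat -> nat) -> nat) (h : nat -> nat) :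
  vcont f -> vcont (fun v => v (h (f v))).
Proof.
  intros Hf v. destruct (Hf v) as [l Hl]. exists (l + S (h (f v))). intros v' H.
  rewrite (Hl v') by (eapply vagree_le; [|exact H]; lia). apply H. lia.
Qed.

Lemma pclosed_all {B : Type} (P : B -> (nat -> nat) -> real -> Prop) :
  (forall b, pclosed (P b)) -> pclosed (fun v p => forall b, P b v p).
Proof.
  intros H v p Hv b. apply H. intro l. destruct (Hv l) as (v' & p' & H1 & H2 & H3).
  exists v', p'; auto.
Qed.

Lemma pclosed_and P Q : pclosed P -> pclosed Q -> pclosed (fun v p => P v p /\ Q v p).
Proof.
  intros HP HQ v p H. split; [apply HP|apply HQ]; intro l;
    destruct (H l) as (v' & p' & H1 & H2 & H3); exists v', p'; tauto.
Qed.

(** A value read continuously from [v] is locally constant, so closedness may be checked with this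
    value held fixed. *)
Lemma pclosed_case {B : Type} (f : (nat -> nat) -> B) (P : B -> (nat -> nat) -> real -> Prop) :
  vcont f -> (forall b, pclosed (P b)) -> pclosed (fun v p => P (f v) v p).
Proof.
  intros Hf HP v p H. apply HP. intro l. destruct (Hf v) as [k Hk].
  destruct (H (l + k)) as (v' & p' & H1 & H2 & H3). exists v', p'.
  rewrite (Hk v') in H3 by (eapply vagree_le; [|exact H1]; lia).
  split; [eapply vagree_le; [|exact H1]; lia|split; [|exact H3]].
  eapply agree_le; [|exact H2]; lia.
Qed.

Lemma pclosed_const (P : Prop) : pclosed (fun _ _ => P).
Proof. intros v p H. destruct (H 0) as (_ & _ & _ & _ & H'); exact H'. Qed.

Lemma pclosed_bit k b : pclosed (fun _ p => p k = b).
Proof.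
  intros v p H. destruct (H (S k)) as (v' & p' & _ & H2 & <-). symmetry. apply H2. lia.
Qed.

Lemma pclosed_or P Q : pclosed P -> pclosed Q -> pclosed (fun v p => P v p \/ Q v p).
Proof.
  intros HP HQ v p H. apply NNPP; intro N.
  assert (NP : ~ forall l, exists v' p', vagree l v v' /\ agree l p p' /\ P v' p') by (intro; auto).
  assert (NQ : ~ forall l, exists v' p', vagree l v v' /\ agree l p p' /\ Q v' p') by (intro; auto).
  apply not_all_ex_not in NP as [l1 N1]. apply not_all_ex_not in NQ as [l2 N2].
  destruct (H (l1 + l2)) as (v' & p' & H1 & H2 & [H3|H3]); [apply N1|apply N2]; exists v', p';
    (split; [eapply vagree_le; [|exact H1]; lia|split; [eapply agree_le; [|exact H2]; lia|exact H3]]).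
Qed.

Definition ybits (v : nat -> nat) : real := fun n => Nat.eqb (v (to_nat (0, n))) 1.

Lemma ybits_agree v t : exists l, forall v', vagree l v v' -> agree t (ybits v) (ybits v').
Proof.
  induction t as [|t [l IH]]; [exists 0; intros v' _ i Hi; lia|].
  exists (l + S (to_nat (0, t))). intros v' H i Hi.
  destruct (Nat.eq_dec i t) as [->|].
  - unfold ybits. now rewrite (H (to_nat (0, t))) by lia.
  - apply IH; [|lia]. eapply vagree_le; [|exact H]; lia.
Qed.

Lemma pclosed_not_open O : popen O -> pclosed (fun v _ => ~ O (ybits v)).
Proof.
  intros HO v p H Hv. destruct (HO _ Hv) as [t Ht]. destruct (ybits_agree v t) as [l Hl].
  destruct (H l) as (v' & p' & H1 & _ & H3). apply H3. auto.
Qed.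

(* [t] witnesses that the open condition [O] holds at [y]. *)
Definition cyl (O : real -> Prop) (y : real) (t : nat) : Prop := forall y', agree t y y' -> O y'.

Lemma cyl_elim O y t : cyl O y t -> O y.
Proof. intro H. apply H. easy. Qed.

(** Whether the first [t] bits force [O] depends on these bits alone. So an open fact becomes a
    closed condition once its modulus is stored on the branch. *)
Lemma pclosed_cyl O t : pclosed (fun v _ => cyl O (ybits v) t).
Proof.
  intros v p H y' Hy. destruct (ybits_agree v t) as [l Hl].
  destruct (H l) as (v' & p' & H1 & _ & H3). apply H3. intros i Hi.
  now rewrite Hy, (Hl v' H1 i Hi).
Qed.

(** * Copies of a well-order computing as few ordinals as possible *)

Definition tvp (e i j : nat) (b : bool) (y : real) : Prop :=
  tval (prog_enum e) (to_nat (i, j)) b y.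

(** Missing relations are expressed by halting with answer [false], not by a failure to answer
    [true], which keeps the condition open. *)
Definition nonlin (e : nat) (y : real) : Prop :=
  (exists n, tvp e n n true y) \/
  (exists n m k, tvp e n m true y /\ tvp e m k true y /\ tvp e n k false y) \/
  (exists n m, n <> m /\ tvp e n m false y /\ tvp e m n false y).

Lemma popen_nonlin e : popen (nonlin e).
Proof.
  unfold nonlin, tvp.
  apply popen_or; [|apply popen_or].
  - apply popen_ex; intro n. apply popen_tval.
  - apply popen_ex; intro n. apply popen_ex; intro m. apply popen_ex; intro k.
    repeat apply popen_and; apply popen_tval.
  - apply popen_ex; intro n. apply popen_ex; intro m.
    apply popen_and; [exact (popen_const (n <> m))|]. apply popen_and; apply popen_tval.
Qed.

(* Evidence that the [e]-th relation computed from [y] is not a well-order of type greater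
   than the initial segment of [B] below [m]: it is partial, not linear, has a descending
   sequence, or embeds into that segment. *)
Definition evidence (B : real) (m e : nat) (y : real) (tag a : nat) (D k : nat -> nat) : Prop :=
  match tag with
  | 0 => forall b, ~ tval (prog_enum e) a b y
  | 1 => cyl (nonlin e) y a
  | 2 => forall n, cyl (tvp e (D (S n)) (D n) true) y (k n)
  | _ => forall n, B (to_nat (D n, m)) = true /\
           forall n', ~ tvp e n n' true y \/ B (to_nat (D n, D n')) = true
  end.

(** The branch is split into columns: 0 for the copy, 1 and 2 for the isomorphism and its inverse, 3
    for the kind of evidence, 4 for its numerical witness, 5 for a descending sequence or an
    embedding, and 6 for the moduli of the descents. *)
Definition vph (v : nat -> nat) (i : nat) : nat := v (to_nat (1, i)).
Definition vps (v : nat -> nat) (i : nat) : nat := v (to_nat (2, i)).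
Definition vtag (v : nat -> nat) (e : nat) : nat := v (to_nat (3, e)).
Definition vwit (v : nat -> nat) (e : nat) : nat := v (to_nat (4, e)).
Definition vseq (v : nat -> nat) (e n : nat) : nat := v (to_nat (5, to_nat (e, n))).
Definition vuse (v : nat -> nat) (e n : nat) : nat := v (to_nat (6, to_nat (e, n))).

(** The parameter joins the well-order [b] to be copied and the bounding order [B]. The inverse is
    part of the branch because surjectivity of the isomorphism would otherwise not be a closed
    condition. *)
Definition lowcopy (m : nat) (v : nat -> nat) (p : real) : Prop :=
  (forall i, vps v (vph v i) = i /\ vph v (vps v i) = i) /\
  (forall i j, rev p (to_nat (vph v i, vph v j)) = ybits v (to_nat (i, j))) /\
  (forall e, evidence (rod p) m e (ybits v) (vtag v e) (vwit v e) (vseq v e) (vuse v e)).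

Lemma pclosed_lowcopy m : pclosed (lowcopy m).
Proof.
  apply pclosed_and; [|apply pclosed_and].
  - apply pclosed_all; intro i. apply pclosed_and.
    + apply (pclosed_case (fun v => vps v (vph v i)) (fun x _ _ => x = i)).
      * exact (vcont_comp _ (fun x => to_nat (2, x)) (vcont_at _)).
      * intro; apply pclosed_const.
    + apply (pclosed_case (fun v => vph v (vps v i)) (fun x _ _ => x = i)).
      * exact (vcont_comp _ (fun x => to_nat (1, x)) (vcont_at _)).
      * intro; apply pclosed_const.
  - apply pclosed_all; intro i. apply pclosed_all; intro j. unfold ybits.
    apply (pclosed_case (fun v => vph v i) (fun a v p => rev p (to_nat (a, vph v j)) = _)); [apply vcont_at|].
    intro a. apply (pclosed_case (fun v => vph v j) (fun b v p => rev p (to_nat (a, b)) = _)); [apply vcont_at|].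
    intro b. apply (pclosed_case (fun v => v (to_nat (0, to_nat (i, j))))
      (fun c v p => rev p (to_nat (a, b)) = Nat.eqb c 1)); [apply vcont_at|].
    intro c. apply pclosed_bit.
  - apply pclosed_all; intro e.
    apply (pclosed_case (fun v => vtag v e) (fun tag v p =>
      evidence (rod p) m e (ybits v) tag (vwit v e) (vseq v e) (vuse v e))); [apply vcont_at|].
    intros [|[|[|tag]]]; unfold evidence.
    + apply (pclosed_case (fun v => vwit v e) (fun a v p =>
        forall b, ~ tval (prog_enum e) a b (ybits v))); [apply vcont_at|].
      intro a. apply pclosed_all; intro b. apply (pclosed_not_open _ (popen_tval _ _ _)).
    + apply (pclosed_case (fun v => vwit v e) (fun a v p => cyl (nonlin e) (ybits v) a)); [apply vcont_at|].
      intro a. apply pclosed_cyl.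
    + apply pclosed_all; intro n.
      apply (pclosed_case (fun v => vseq v e (S n)) (fun a v p =>
        cyl (tvp e a (vseq v e n) true) (ybits v) (vuse v e n))); [apply vcont_at|].
      intro a. apply (pclosed_case (fun v => vseq v e n) (fun b v p =>
        cyl (tvp e a b true) (ybits v) (vuse v e n))); [apply vcont_at|].
      intro b. apply (pclosed_case (fun v => vuse v e n) (fun c v p =>
        cyl (tvp e a b true) (ybits v) c)); [apply vcont_at|].
      intro c. apply pclosed_cyl.
    + apply pclosed_all; intro n. apply pclosed_and.
      * apply (pclosed_case (fun v => vseq v e n) (fun a v p => rod p (to_nat (a, m)) = true)); [apply vcont_at|].
        intro a. apply pclosed_bit.
      * apply pclosed_all; intro n'. apply pclosed_or.
        -- apply (pclosed_not_open _ (popen_tval _ _ _)).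
        -- apply (pclosed_case (fun v => vseq v e n) (fun a v p => 
             rod p (to_nat (a, vseq v e n')) = true)); [apply vcont_at|].
           intro a. apply (pclosed_case (fun v => vseq v e n') (fun b v p => rod p (to_nat (a, b)) = true)); [apply vcont_at|].
           intro b. apply pclosed_bit.
Qed.

(** If program [e] computes a well-order from the copy, only the last kind of evidence is possible;
    its embedding bounds the order type by the rank of [m]. *)
Lemma lowcopy_sound b B m v : WO b -> WO B -> lowcopy m v (rjn b B) ->
  WO (ybits v) /\ otp (ybits v) = otp b /\ ole (sig (ybits v)) (rk (rel_of B) m).
Proof.
  intros Hb HB (H1 & H2 & H3). rewrite rev_jn in H2. rewrite rod_jn in H3.
  set (y := ybits v) in *.
  assert (Hrel : forall i j, rel_of y i j <-> rel_of b (vph v i) (vph v j)).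
  { intros i j. rewrite !rel_pair, H2. reflexivity. }
  assert (Hinj : forall i j, vph v i = vph v j -> i = j).
  { intros i j E. rewrite <- (proj1 (H1 i)), E. apply H1. }
  assert (W : WO y) by exact (WO_inverse b (vph v) y Hrel Hinj Hb).
  split; [exact W|split].
  - apply cong_otp; auto. split; [exact W|split; [exact Hb|]]. exists (vph v), (vps v).
    split; [|split; [|exact Hrel]]; intro; apply H1.
  - apply sig_spec. intros z Hz Wz. apply tfam_turing in Hz as [e [Te Ez]].
    assert (T : forall i j b, tvp e i j b y -> z (to_nat (i, j)) = b).
    { intros i j c Hc. eapply tval_fun; [|exact Hc]. rewrite <- Ez. now apply sec_tfam. }
    assert (T' : forall i j, rel_of z i j -> tvp e i j true y).
    { intros i j Hij. apply rel_pair in Hij. unfold tvp. rewrite <- Hij, <- Ez. now apply sec_tfam. }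
    assert (Tt : forall i j, tvp e i j true y -> rel_of z i j).
    { intros i j Hij. apply rel_pair. now apply T. }
    assert (Tf : forall i j, tvp e i j false y -> ~ rel_of z i j).
    { intros i j Hij. rewrite rel_pair, (T _ _ _ Hij). discriminate. }
    specialize (H3 e). pose proof Wz as (Z1 & Z2 & Z3 & Z4).
    destruct (vtag v e) as [|[|[|tag]]]; cbn in H3.
    + exfalso. destruct (Te (vwit v e)) as [c Hc]. now apply H3 in Hc.
    + exfalso. apply cyl_elim in H3 as [[n Hn]|[(n & j & k & K1 & K2 & K3)|(n & j & K1 & K2 & K3)]].
      * apply (Z1 n). auto.
      * apply Tf in K3. apply K3. eapply Z2; eauto.
      * apply Tf in K2, K3. destruct (Z3 n j); tauto.
    + exfalso. assert (L : forall a, Acc (rel_of z) a -> forall n, a <> vseq v e n).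
      { induction 1 as [a _ IH]. intros n ->. apply (IH (vseq v e (S n))) with (n := S n); [|easy].
        apply Tt. exact (cyl_elim _ _ _ (H3 n)). }
      exact (L _ (Z4 (vseq v e 0)) 0 eq_refl).
    + apply otp_le. intro n. eapply ole_lt_trans.
      * apply (rk_emb (rel_of z) (rel_of B) (vseq v e)); [|apply Z4|apply HB].
        intros i j Hij. apply rel_pair. destruct (H3 i) as [_ H]. destruct (H j) as [N|E]; [|exact E].
        exfalso. apply N. auto.
      * apply (rel_rk B HB). apply rel_pair. apply H3.
Qed.

Lemma not_wf_descending (R : nat -> nat -> Prop) : ~ well_founded R ->
  exists D : nat -> nat, forall n, R (D (S n)) (D n).
Proof.
  intro H. apply not_all_ex_not in H as [a0 H0].
  assert (N : forall a, exists b, ~ Acc R a -> ~ Acc R b /\ R b a).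
  { intro a. destruct (classic (Acc R a)) as [A|A]; [exists 0; tauto|].
    apply NNPP; intro N. apply A. constructor. intros b Hb. apply NNPP; intro Nb.
    apply N. exists b; tauto. }
  destruct (choice_fun _ N) as [f Hf].
  exists (fun n => Nat.iter n f a0). intro n. rewrite Nat.iter_succ. apply Hf.
  induction n as [|n IH]; [exact H0|]. rewrite Nat.iter_succ. now apply Hf.
Qed.

(** A total program without a defect computes a well-order, whose type is below [sig y], hence below
    the rank of [m]; matching ranks gives the embedding. *)
Lemma evidence_ex B m e y : WO B -> ole (sig y) (rk (rel_of B) m) ->
  exists tag a D k, evidence B m e y tag a D k.
Proof.
  intros HB Hs. destruct (classic (ttotal e y)) as [T|T].
  2:{ apply not_all_ex_not in T as [a Ha]. exists 0, a, (fun _ => 0), (fun _ => 0).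
      intros b Hb. eauto. }
  set (z := sec (tfam y) e). pose proof (sec_tfam y e T) as Hz. fold z in Hz.
  assert (Hz' : turing_computable_from z y) by (exists (prog_enum e); exact Hz).
  clearbody z.
  assert (Tv : forall i j b, tvp e i j b y <-> z (to_nat (i, j)) = b).
  { intros i j b. split; [|intros <-; apply Hz]. intro H. exact (tval_fun _ _ _ _ _ (Hz _) H). }
  destruct (classic (nonlin e y)) as [N|N].
  { destruct (popen_nonlin e y N) as [t Ht]. exists 1, t, (fun _ => 0), (fun _ => 0). exact Ht. }
  destruct (classic (well_founded (rel_of z))) as [W|W].
  - assert (Wz : WO z).
    { split; [|split; [|split; [|exact W]]].
      - intros n Hn. apply N. left. exists n. apply Tv. now apply rel_pair.
      - intros n j k H1 H2. apply NNPP; intro H3. apply N. right; left. exists n, j, k.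
        rewrite !Tv. apply rel_pair in H1, H2. rewrite rel_pair in H3.
        repeat split; auto. now apply not_true_iff_false.
      - intros n j. apply NNPP; intro H. apply N. right; right. exists n, j. rewrite !Tv.
        rewrite !rel_pair in H. split; [tauto|]. split; apply not_true_iff_false; tauto. }
    destruct (emb_of_otp z B (rk (rel_of B) m) Wz HB) as [F HF].
    { right. eapply olt_le_trans; [exact (sig_lt y z Hz' Wz)|exact Hs]. }
    { right. apply otp_lt. }
    exists 3, 0, F, (fun _ => 0). intro n. split.
    + apply rel_pair, (rel_rk B HB), HF.
    + intro n'. destruct (classic (tvp e n n' true y)) as [H|H]; [right|now left].
      apply rel_pair, (rel_rk B HB). rewrite !(proj1 (HF _)). apply (rel_rk z Wz).
      apply rel_pair. now apply Tv.
  - destruct (not_wf_descending _ W) as [D HD].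
    assert (Hk : forall n, exists k, cyl (tvp e (D (S n)) (D n) true) y k).
    { intro n. apply (popen_tval (prog_enum e) (to_nat (D (S n), D n)) true y).
      apply Tv. now apply rel_pair. }
    destruct (choice_fun _ Hk) as [k Hk']. exists 2, 0, D, k. exact Hk'.
Qed.

Lemma lowcopy_complete b B m y : WO b -> WO B -> WO y -> otp y = otp b ->
  ole (sig y) (rk (rel_of B) m) -> exists v, lowcopy m v (rjn b B).
Proof.
  intros Hb HB Hy E Hs.
  destruct (proj2 (cong_otp y b Hy Hb) E) as (_ & _ & f & g & F1 & F2 & F3).
  destruct (choice_fun _ (fun e => evidence_ex B m e y HB Hs)) as [tag H1].
  destruct (choice_fun _ H1) as [wit H2]. destruct (choice_fun _ H2) as [D H3].
  destruct (choice_fun _ H3) as [k H4]. clear H1 H2 H3.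
  set (v := fun c => let (t, i) := of_nat c in let (e, n) := of_nat i in
    match t with
    | 0 => Nat.b2n (y i) | 1 => f i | 2 => g i | 3 => tag i | 4 => wit i | 5 => D e n | _ => k e n
    end).
  assert (Ey : ybits v = y).
  { apply real_ext; intro n. unfold ybits, v. rewrite cancel_of_to. destruct (of_nat n).
    now destruct (y n). }
  exists v. unfold lowcopy. rewrite rev_jn, rod_jn, Ey.
  assert (Ef : forall i, vph v i = f i) by (intro i; unfold vph, v; rewrite cancel_of_to; now destruct (of_nat i)).
  assert (Eg : forall i, vps v i = g i) by (intro i; unfold vps, v; rewrite cancel_of_to; now destruct (of_nat i)).
  split; [|split].
  - intro i. now rewrite !Ef, !Eg, F1, F2.
  - intros i j. rewrite !Ef. apply bool_ext. rewrite <- !rel_pair. symmetry. apply F3.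
  - intro e.
    assert (E3 : vtag v e = tag e) by (unfold vtag, v; rewrite cancel_of_to; now destruct (of_nat e)).
    assert (E4 : vwit v e = wit e) by (unfold vwit, v; rewrite cancel_of_to; now destruct (of_nat e)).
    assert (E5 : vseq v e = D e)
      by (apply functional_extensionality; intro; unfold vseq, v; now rewrite !cancel_of_to).
    assert (E6 : vuse v e = k e)
      by (apply functional_extensionality; intro; unfold vuse, v; now rewrite !cancel_of_to).
    rewrite E3, E4, E5, E6. apply H4.
Qed.

Definition nodes : {nd : nat -> nat * list nat & {cd : nat * list nat -> nat | forall x, nd (cd x) = x}}.
Proof.
  destruct (constructive_indefinite_description _
    (countable_prod _ _ countable_nat (countable_list _ countable_nat))) as [nd H].
  exists nd. exact (constructive_indefinite_description _ (choice_fun _ H)).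
Defined.

Definition low_solvable (m : nat) (p : real) : Prop :=
  solvable lowcopy (projT1 nodes) (proj1_sig (projT2 nodes)) m p.

Definition low_value (m n c : nat) (p : real) : Prop :=
  bvalue lowcopy (projT1 nodes) (proj1_sig (projT2 nodes)) m n c p.

Definition low_least (m : nat) (p : real) : Prop :=
  low_solvable m p /\ forall m', rod p (to_nat (m', m)) = true -> ~ low_solvable m' p.

(** If no point bounds the supremum of a copy, the second real comes back unimproved from the first
    half of the parameter. With [B] the code of the supremum attained by [b], this happens only if
    [b] is itself optimal. *)
Definition lowest (p : real) : real := fun k => asb (
  (exists m, low_least m p /\ low_value m (to_nat (0, k)) 1 p) \/
  ((forall m, ~ low_solvable m p) /\ rev p k = true)).

Definition low (b : real) : real := lowest (rjn b (cksup b)).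

Lemma comp_low : comp low.
Proof.
  apply (comp_comp (fun b => rjn b (cksup b)) lowest).
  { exact (comp_keep _ comp_cksup). }
  apply comp_of_cfam. apply cfam_or.
  - apply (cfam_ex (fun k m p => _ /\ _) countable_nat). apply cfam_and; [|apply cfam_bvalue].
    apply cfam_and; [apply cfam_solvable|].
    apply (cfam_all (fun km m' p => _ -> _) countable_nat).
    apply cfam_imp; [apply cfam_bit|]. apply cfam_not, cfam_solvable.
  - apply cfam_and; [|apply cfam_bit].
    apply (cfam_all (fun k m p => ~ _) countable_nat). apply cfam_not, cfam_solvable.
Qed.

(** A copy whose supremum is below the type of [cksup b] has this supremum as the rank of a point,
    and would be a solution at that point. So minimality of the chosen point, or the absence of
    solvable points, gives optimality. *)
Theorem low_spec b : WO b -> WO (low b) /\ otp (low b) = otp b /\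
  forall y, WO y -> otp y = otp b -> ole (sig (low b)) (sig y).
Proof.
  intro Hb. destruct (cksup_spec b) as [HB EB]. set (B := cksup b) in *.
  set (p := rjn b B).
  pose proof (solvable_branch lowcopy pclosed_lowcopy (projT1 nodes) (proj1_sig (projT2 nodes))
    (proj2_sig (projT2 nodes))) as Hbr.
  assert (Hsol : forall m y, WO y -> otp y = otp b -> ole (sig y) (rk (rel_of B) m) -> low_solvable m p).
  { intros m y H1 H2 H3. destruct (lowcopy_complete b B m y Hb HB H1 H2 H3) as [v Hv].
    exact (solvable_ex _ _ _ (proj2_sig (projT2 nodes)) m v p Hv). }
  destruct (classic (exists m, low_solvable m p)) as [[m1 Hm1]|N].
  - assert (Hm : exists m, low_least m p).
    { destruct HB as (_ & _ & _ & W). revert Hm1. induction (W m1) as [m1 _ IH]. intro Hm1.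
      destruct (classic (exists m', rel_of B m' m1 /\ low_solvable m' p)) as [[m' [M1 M2]]|N].
      - exact (IH m' M1 M2).
      - exists m1. split; [exact Hm1|]. unfold p. rewrite rod_jn. intros m' H1 H2. apply N.
        exists m'. split; [now apply rel_pair|exact H2]. }
    destruct Hm as [m [M1 M2]]. unfold p in M2. rewrite rod_jn in M2. fold p in M2.
    destruct (Hbr m p M1) as [v [Kv Vv]].
    assert (E : low b = ybits v).
    { apply real_ext; intro k. unfold low. fold B p. apply bool_ext. unfold lowest, ybits.
      rewrite asbP, Nat.eqb_eq. split.
      - intros [[m' [[L1 L2] L3]]|[L _]]; [|exfalso; eapply L; eauto].
        assert (m' = m) as ->.
        { unfold p in L2. rewrite rod_jn in L2. fold p in L2.
          destruct HB as (_ & _ & T & _). destruct (T m' m) as [E|[E|E]]; [exact E| |];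
            apply rel_pair in E; exfalso; [exact (M2 _ E L1)|exact (L2 _ E M1)]. }
        now apply Vv.
      - intro H. left. exists m. split; [|now apply Vv]. split; [exact M1|].
        unfold p at 1. now rewrite rod_jn. }
    destruct (lowcopy_sound b B m v Hb HB Kv) as (S1 & S2 & S3).
    rewrite E. split; [exact S1|split; [exact S2|]].
    intros y Y1 Y2. apply not_olt; intro L.
    destruct (rk_onto B HB m (sig y)) as [m' [R1 R2]]; [eapply olt_le_trans; eauto|].
    apply (M2 m'); [now apply rel_pair|]. apply (Hsol m' y Y1 Y2). rewrite R2. apply ole_refl.
  - assert (E : low b = b).
    { apply real_ext; intro k. unfold low. fold B p. apply bool_ext. unfold lowest.
      rewrite asbP. unfold p at 4. rewrite rev_jn. split.
      - intros [[m [[L1 _] _]]|[_ L]]; [exfalso; eauto|exact L].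
      - intro H. right. split; [|exact H]. intros m Hm. eauto. }
    rewrite E. split; [exact Hb|split; [reflexivity|]].
    intros y Y1 Y2. apply not_olt; intro L. rewrite <- EB in L.
    destruct (otp_onto B HB _ L) as [m Hm]. apply N. exists m.
    apply (Hsol m y Y1 Y2). rewrite Hm. apply ole_refl.
Qed.

(** * Iterating along a well-order *)

(** The state holds the well-order, the set of treated points, and a table with one row for each
    point. Set and table only grow, so limits take unions. *)
Definition it_w (t : real) : real := rev t.
Definition it_d (t : real) : real := rev (rod t).
Definition it_u (t : real) : real := rod (rod t).

Definition it_cur (t : real) (n : nat) : Prop :=
  it_d t n <> true /\ forall m, it_w t (to_nat (m, n)) = true -> it_d t m = true.

Definition it_fam (t : real) : real := fun k => asb (
  (fst (of_nat k) = 0 /\ std_code (snd (of_nat k)) = true) \/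
  (fst (of_nat k) <> 0 /\ it_u t (to_nat (Nat.pred (fst (of_nat k)), snd (of_nat k))) = true)).

Definition it_sup (t : real) : real := low (wsup (it_fam t)).

Definition it_val (t : real) : real := cksup (it_sup t).

Definition it_d' (t : real) : real := fun n => asb (it_d t n = true \/ it_cur t n).

Definition it_u' (t : real) : real := fun k => asb (it_u t k = true \/
  (it_cur t (fst (of_nat k)) /\ it_val t (snd (of_nat k)) = true)).

Definition it_body (s : real) : real :=
  rcons (asb (exists n, it_cur (rtl s) n))
    (rjn (it_w (rtl s)) (rjn (it_d' (rtl s)) (it_u' (rtl s)))).

Definition it_init (w : real) : real := rcons true (rjn w (rjn zeros zeros)).

Lemma comp_it_u : comp it_u.
Proof. exact (comp_rod _ (comp_rod _ comp_id)). Qed.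

Lemma comp_it_sup : comp it_sup.
Proof.
  apply (comp_comp (fun t => wsup (it_fam t)) low); [|exact comp_low].
  apply (comp_comp it_fam wsup); [|exact comp_wsup].
  apply comp_of_cfam. apply cfam_or; [apply cfam_const|].
  apply cfam_and; [apply cfam_const|]. apply cfam_of_comp, comp_it_u.
Qed.

Lemma comp_it_body : comp it_body.
Proof.
  apply (comp_comp rtl (fun t => rcons (asb (exists n, it_cur t n))
    (rjn (it_w t) (rjn (it_d' t) (it_u' t))))); [exact (comp_rtl _ comp_id)|].
  assert (Hw : comp it_w) by exact (comp_rev _ comp_id).
  assert (Hd : comp it_d) by exact (comp_rev _ (comp_rod _ comp_id)).
  assert (Hv : comp it_val) by exact (comp_comp _ _ comp_it_sup comp_cksup).
  assert (Hc : forall A (h : A -> nat), cfam (fun a t => it_cur t (h a))).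
  { intros A h. apply cfam_and; [apply cfam_not; now apply cfam_of_comp|].
    apply (cfam_all (fun a m t => _ -> _) countable_nat).
    apply cfam_imp; now apply cfam_of_comp. }
  apply comp_rcons.
  - apply (cfam_ex (fun (_ : unit) n t => it_cur t n) countable_nat). apply Hc.
  - apply comp_rjn; [exact Hw|]. apply comp_rjn; apply comp_of_cfam; apply cfam_or;
      auto using cfam_of_comp, comp_it_u. apply cfam_and; [apply Hc|]. now apply cfam_of_comp.
Qed.

Section Iteration.

Context (w : real).
Let R := rel_of w.

Context (tr : Om -> real).
Hypothesis Htr0 : tr ozero = it_init w.
Hypothesis Htr : rtraj it_body tr.

Definition is_d (i : Om) : real := fun n => asb (Acc R n /\ olt (rk R n) i).
(** Row [n] is described through the trajectory itself: it is the value computed from the state at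
    stage [rk R n], which is earlier than [i]. *)
Definition is_u (i : Om) : real := fun k =>
  asb ((Acc R (fst (of_nat k)) /\ olt (rk R (fst (of_nat k))) i) /\
       it_val (rtl (tr (rk R (fst (of_nat k))))) (snd (of_nat k)) = true).

Definition is_state (i : Om) : real := rjn w (rjn (is_d i) (is_u i)).

Lemma it_w_state i : it_w (is_state i) = w.
Proof. apply rev_jn. Qed.

Lemma it_d_state i : it_d (is_state i) = is_d i.
Proof. unfold it_d, is_state. now rewrite rod_jn, rev_jn. Qed.

Lemma it_u_state i : it_u (is_state i) = is_u i.
Proof. unfold it_u, is_state. now rewrite !rod_jn. Qed.

Lemma it_cur_state j n : it_cur (is_state j) n <-> Acc R n /\ rk R n = j.
Proof.
  unfold it_cur. rewrite it_w_state, it_d_state. unfold is_d. setoid_rewrite asbP. split.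
  - intros [H1 H2].
    assert (a : Acc R n) by (constructor; intros m Hm; apply H2; now apply rel_pair).
    split; [exact a|]. apply ole_antisym.
    + apply rk_le; [exact a|]. intros m Hm. apply H2. now apply rel_pair.
    + apply not_olt. tauto.
  - intros [a <-]. split; [intros [_ H]; now apply olt_irrefl in H|].
    intros m Hm. apply rel_pair in Hm. split; [exact (Acc_inv a Hm)|now apply rk_lt].
Qed.

Lemma it_state i : rtl (tr i) = is_state i.
Proof.
  induction i as [i IH] using olt_ind.
  destruct (Om_cases i) as [->|[[j ->]|Hl]].
  - rewrite Htr0. unfold it_init, is_state. rewrite rtl_cons. do 2 f_equal;
      apply real_ext; intro n; symmetry; apply asbF.
    + intros [_ H]. now apply olt_zero in H.
    + intros [[_ H] _]. now apply olt_zero in H.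
  - specialize (IH j (olt_succ j)).
    rewrite (proj1 Htr). unfold it_body. rewrite rtl_cons, IH, it_w_state. unfold is_state at 3.
    f_equal. f_equal; apply real_ext; intro n; apply asb_ext.
    + rewrite it_cur_state, it_d_state. unfold is_d. rewrite asbP, olt_succ_le. unfold ole. tauto.
    + rewrite it_cur_state, it_u_state. unfold is_u. rewrite asbP, olt_succ_le. split.
      * intros [[[a H] E]|[[a H] E]]; (split; [split; [exact a|]|]).
        -- now right.
        -- exact E.
        -- now left.
        -- now rewrite H, IH.
      * intros [[a [H|H]] E]; [right|left; exact (conj (conj a H) E)].
        rewrite H, IH in E. exact (conj (conj a H) E).
  - apply real_ext; intro k. unfold rtl. rewrite (proj2 Htr i Hl). unfold limsup.
    assert (Hb : forall u, olt u i -> tr u (S k) = is_state u k).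
    { intros u Hu. now rewrite <- (IH u Hu). }
    apply bool_ext. rewrite asbP.
    assert (Hc : cofinal olt i (fun u => tr u (S k) = true) <->
      cofinal olt i (fun u => is_state u k = true)).
    { split; intros H s Hs; destruct (H s Hs) as [u (U1 & U2 & U3)]; exists u;
        (split; [exact U1|split; [exact U2|]]); [rewrite <- Hb|rewrite Hb]; assumption. }
    rewrite Hc. clear Hc Hb. unfold is_state, rjn. destruct (Nat.even k).
    + rewrite cofinal_mono by auto. split; [intros [u [_ H]]; exact H|].
      intro H. destruct Hl as [[s Hs] _]. eauto.
    + destruct (Nat.even (Nat.div2 k)); set (l := Nat.div2 (Nat.div2 k)).
      * rewrite cofinal_mono; [|exact Hl|].
        -- unfold is_d. setoid_rewrite asbP. split.
           ++ intros [u [U1 [a U2]]]. split; [exact a|eapply olt_trans; eauto].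
           ++ intros [a U]. exists (osucc (rk R l)). split; [now apply olim_succ|].
              auto using olt_succ.
        -- unfold is_d. intros u u' H _. rewrite !asbP. intros [a H']. split; [exact a|].
           eapply olt_trans; eauto.
      * rewrite cofinal_mono; [|exact Hl|].
        -- unfold is_u. setoid_rewrite asbP. split.
           ++ intros [u [U1 [[a U2] U3]]]. split; [split; [exact a|eapply olt_trans; eauto]|exact U3].
           ++ intros [[a U2] U3]. exists (osucc (rk R (fst (of_nat l)))).
              split; [now apply olim_succ|]. auto using olt_succ.
        -- unfold is_u. intros u u' H _. rewrite !asbP. intros [[a H'] E]. split; [|exact E].
           split; [exact a|]. eapply olt_trans; eauto.
Qed.

Lemma it_run j : tr (osucc j) 0 = true <-> exists n, Acc R n /\ rk R n = j.
Proof.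
  rewrite (proj1 Htr). unfold it_body. cbn [rcons]. rewrite asbP, it_state.
  setoid_rewrite it_cur_state. reflexivity.
Qed.

Lemma it_halts : exists i, tr i 0 = false /\ (forall j, olt j i -> tr j 0 = true) /\
  forall n, Acc R n -> olt (rk R n) i.
Proof.
  destruct (ranks_exhausted R it_body tr Htr) as (j & H1 & H2 & Hrk); [now rewrite Htr0|exact it_run|].
  exists (osucc j). split; [exact H1|split; [exact H2|]]. intros n a.
  eapply olt_trans; [exact (Hrk n a)|apply olt_succ].
Qed.

End Iteration.

Definition it_traj (w : real) : {tr : Om -> real | tr ozero = it_init w /\ rtraj it_body tr} :=
  constructive_indefinite_description _ (traj_ex it_body (fun x => x) (fun x => x) (it_init w)).

Definition it_end (w : real) : Om :=
  proj1_sig (constructive_indefinite_description _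
    (it_halts w (proj1_sig (it_traj w)) (proj1 (proj2_sig (it_traj w))) (proj2 (proj2_sig (it_traj w))))).

Lemma it_end_spec w : proj1_sig (it_traj w) (it_end w) 0 = false /\
  (forall j, olt j (it_end w) -> proj1_sig (it_traj w) j 0 = true) /\
  forall n, Acc (rel_of w) n -> olt (rk (rel_of w) n) (it_end w).
Proof.
  exact (proj2_sig (constructive_indefinite_description _ (it_halts w (proj1_sig (it_traj w))
    (proj1 (proj2_sig (it_traj w))) (proj2 (proj2_sig (it_traj w)))))).
Qed.

Definition it_tr (w : real) (i : Om) : real := rtl (proj1_sig (it_traj w) i).

Definition iterate (w : real) : real := it_tr w (it_end w).

Lemma comp_iterate : comp iterate.
Proof.
  apply (comp_while it_body it_init).
  - exact comp_it_body.
  - unfold it_init. apply opn_cons, opn_jn; [apply opn_id|apply opn_const].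
  - intro w. destruct (it_end_spec w) as (H1 & H2 & _).
    exists (proj1_sig (it_traj w) (it_end w)). split; [|reflexivity].
    exists (proj1_sig (it_traj w)), (it_end w). destruct (proj2_sig (it_traj w)). auto.
Qed.

(** The final state only stores values; one more [it_sup] turns them into a real whose computable
    ordinals have the next value as supremum. *)
Definition climb (w : real) : real := it_sup (iterate w).

Lemma comp_climb : comp climb.
Proof. exact (comp_comp _ _ comp_iterate comp_it_sup). Qed.

Definition minsig (i : Om) : Om := least (fun j => exists y, WO y /\ otp y = i /\ sig y = j).

Lemma sig_low b : WO b -> sig (low b) = minsig (otp b).
Proof.
  intro Hb. destruct (low_spec b Hb) as (L1 & L2 & L3). symmetry. apply least_unique. split.
  - eauto.
  - intros j (y & Y1 & Y2 & <-). auto.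
Qed.

Definition ub_std (P : Om -> Prop) (b : Om) : Prop :=
  ole (otp std_code) b /\ forall j, P j -> ole j b.

(** [H] is defined on ordinals, without reference to codes, so matching the values along [w] with it
    shows that they depend on the order type alone. *)
Lemma climb_rec : exists H : Om -> Om, forall i,
  H i = minsig (least (ub_std (fun j => exists k, olt k i /\ j = H k))).
Proof.
  apply (Om_rec ozero (fun i H => minsig (least (ub_std (fun j => exists k, olt k i /\ j = H k))))).
  intros i f g E. f_equal. apply least_ext. intro b. unfold ub_std.
  split; intros [H1 H2]; (split; [exact H1|]); intros j [k [K1 ->]]; apply H2; exists k;
    (split; [exact K1|]); [rewrite E|rewrite <- E]; auto.
Qed.

Section Climb.

Context (w : real).
Hypothesis Hw : WO w.

Let R := rel_of w.
Let val (i : Om) : real := it_val (it_tr w i).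

Lemma climb_sup i : WO (wsup (it_fam (it_tr w i))) /\
  otp (wsup (it_fam (it_tr w i))) =
    least (ub_std (fun j => exists n, olt (rk R n) i /\ j = otp (val (rk R n)))).
Proof.
  set (t := it_tr w i).
  assert (Et : t = is_state w (proj1_sig (it_traj w)) i).
  { apply it_state; apply (proj2_sig (it_traj w)). }
  assert (S0 : sec (it_fam t) 0 = std_code).
  { apply real_ext; intro k. unfold sec, it_fam. rewrite cancel_of_to. cbn [fst snd].
    apply bool_ext. rewrite asbP. intuition congruence. }
  assert (SS : forall n k, sec (it_fam t) (S n) k = true <-> olt (rk R n) i /\ val (rk R n) k = true).
  { intros n k. unfold sec, it_fam. rewrite cancel_of_to. cbn [fst snd Nat.pred].
    rewrite asbP, Et, it_u_state. unfold is_u. rewrite asbP, cancel_of_to. cbn [fst snd].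
    fold R. unfold val, it_tr. pose proof (proj2 (proj2 (proj2 Hw)) n) as a. intuition congruence. }
  assert (Vw : forall n, WO (val (rk R n))) by (intro n; apply cksup_spec).
  assert (S1 : forall n, olt (rk R n) i -> sec (it_fam t) (S n) = val (rk R n)).
  { intros n Hn. apply real_ext; intro k. apply bool_ext. rewrite SS. tauto. }
  assert (S2 : forall n, WO (sec (it_fam t) (S n)) -> olt (rk R n) i).
  { intros n (_ & _ & T & _). destruct (T 0 1) as [E|[E|E]]; [discriminate E| |];
      unfold rel_of in E; now apply SS in E. }
  destruct (wsup_spec (it_fam t)) as [W L].
  { exists 0. rewrite S0. exact WO_std. }
  split; [exact W|]. symmetry. apply least_unique. destruct L as [L1 L2]. split.
  - split.
    + rewrite <- S0. apply L1. rewrite S0. exact WO_std.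
    + intros j [n [Hn ->]]. rewrite <- (S1 n Hn). apply L1. rewrite (S1 n Hn). apply Vw.
  - intros b [B1 B2]. apply L2. intros [|n] He.
    + now rewrite S0.
    + pose proof (S2 n He) as Hn. rewrite (S1 n Hn). eauto.
Qed.

Lemma climb_level i : WO (it_sup (it_tr w i)) /\ olt (otp (wsup (it_fam (it_tr w i)))) (otp (val i)) /\
  otp (val i) = sig (it_sup (it_tr w i)) /\
  sig (it_sup (it_tr w i)) = minsig (otp (wsup (it_fam (it_tr w i)))).
Proof.
  destruct (climb_sup i) as [W _]. destruct (low_spec _ W) as (L1 & L2 & _).
  fold (it_sup (it_tr w i)) in L1, L2.
  assert (E : otp (val i) = sig (it_sup (it_tr w i))) by apply cksup_spec.
  split; [exact L1|split; [|split]].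
  - rewrite <- L2, E. apply sig_lt; [apply turing_refl|exact L1].
  - exact E.
  - exact (sig_low _ W).
Qed.

Lemma climb_mono n i : olt (rk R n) i -> olt (otp (val (rk R n))) (otp (val i)).
Proof.
  intro Hn. eapply ole_lt_trans; [|apply climb_level]. rewrite (proj2 (climb_sup i)).
  apply (least_spec (ub_std (fun j => exists n, olt (rk R n) i /\ j = otp (val (rk R n))))).
  - destruct (Om_bounded (fun n => match n with 0 => otp std_code | S n => otp (val (rk R n)) end))
      as [b Hb].
    exists b. split; [right; exact (Hb 0)|]. intros j [m [_ ->]]. right; exact (Hb (S m)).
  - eauto.
Qed.

Lemma climb_value (H : Om -> Om) :
  (forall i, H i = minsig (least (ub_std (fun j => exists k, olt k i /\ j = H k)))) ->
  forall i, ole i (otp w) -> otp (val i) = H i.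
Proof.
  intros HH i. induction i as [i IH] using olt_ind. intro Hi.
  destruct (climb_level i) as (_ & _ & E1 & E2). rewrite E1, E2, HH, (proj2 (climb_sup i)).
  f_equal. apply least_ext. intro b. unfold ub_std.
  split; intros [B1 B2]; (split; [exact B1|]).
  - intros j [k [K1 ->]]. destruct (otp_onto w Hw k) as [n Hn]; [eapply olt_le_trans; eauto|].
    apply B2. exists n. fold R in Hn. rewrite Hn. split; [exact K1|].
    symmetry. apply IH; [exact K1|right; eapply olt_le_trans; eauto].
  - intros j [n [N1 ->]]. apply B2. exists (rk R n). split; [exact N1|].
    apply IH; [exact N1|right; apply otp_lt].
Qed.

(** The loop may stop later than [otp w], but all ranks lie below both stages, so set and table are
    already complete. *)
Lemma iterate_end : it_tr w (it_end w) = it_tr w (otp w).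
Proof.
  assert (He : forall n, olt (rk R n) (it_end w)).
  { intro n. apply it_end_spec. apply Hw. }
  unfold it_tr. rewrite !(it_state w) by apply (proj2_sig (it_traj w)).
  unfold is_state. do 2 f_equal; apply real_ext; intro k; apply asb_ext.
  - pose proof (He k). pose proof (otp_lt w k). unfold R in *. tauto.
  - pose proof (He (fst (of_nat k))). pose proof (otp_lt w (fst (of_nat k))). unfold R in *. tauto.
Qed.

End Climb.

Theorem climb_spec : exists H : Om -> Om,
  (forall w, WO w -> WO (climb w) /\ sig (climb w) = H (otp w)) /\
  (forall w w', WO w -> WO w' -> olt (otp w) (otp w') -> olt (H (otp w)) (H (otp w'))).
Proof.
  destruct climb_rec as [H HH]. exists H. split.
  - intros w Hw. unfold climb, iterate. rewrite iterate_end by exact Hw.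
    destruct (climb_level w Hw (otp w)) as (L1 & _ & L3 & _). split; [exact L1|].
    rewrite <- L3. apply climb_value; auto using ole_refl.
  - intros w w' Hw Hw' L. destruct (otp_onto w' Hw' _ L) as [n Hn].
    rewrite <- Hn in *.
    rewrite <- (climb_value w' Hw' H HH (otp w')) by apply ole_refl.
    rewrite <- (climb_value w' Hw' H HH (rk (rel_of w') n)) by (right; exact L).
    now apply climb_mono.
Qed.

Theorem climb_reduction : c_reducible WO cong_WO all_reals E_ck.
Proof.
  destruct climb_spec as [H [H1 H2]]. exists climb. split; [|split].
  - apply comp_ittm; [exact comp_climb|]. intros w Hw. apply WO_zero. now apply H1.
  - easy.
  - intros w w' Hw Hw'. rewrite cong_otp, E_ck_iff by assumption.
    rewrite (proj2 (H1 w Hw)), (proj2 (H1 w' Hw')). split; [congruence|].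
    intro E. destruct (olt_total (otp w) (otp w')) as [L|[L|L]]; [exact L| |];
      apply H2 in L; auto; rewrite E in L; now apply olt_irrefl in L.
Qed.

Theorem mainTheorem6 :
  c_reducible all_reals E_ck WO cong_WO /\
  c_reducible WO cong_WO all_reals E_ck /\
  (exists f : real -> real,
     ittm_computable all_reals f /\
     (forall x, codes_sup_ck x (f x)) /\
     (forall x x', E_ck x x' <-> cong_WO (f x) (f x'))).
Proof.
  destruct cksup_reduction as (C1 & C2 & C3). split; [|split].
  - exists cksup. split; [exact C1|split].
    + intros x _. apply C2.
    + intros x x' _ _. apply C3.
  - exact climb_reduction.
  - exists cksup. auto.
Qed.
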